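(* Let $\mathbb{X}$ be a weighted projective line over a finite field $\mathbf{k}=\mathbb{F}_q$. Let $L,L'$ be line bundles on $\mathbb{X}$ and let $S,S',S''$ be torsion sheaves (or zero sheaves). Then there exists an exact sequence $$0\longrightarrow L\oplus S\longrightarrow L'\oplus S'\longrightarrow S''\longrightarrow 0$$ if and only if there are sheaves $S_1$ and $S_2$ with exact sequences $$0\to S\to S'\to S_1\to 0,\qquad 0\to L\to L'\to S_2\to 0,\qquad 0\to S_1\to S''\to S_2\to 0.$$ In this case, we have $$F_{S''\,L\oplus S}^{L'\oplus S'}=\frac{|\mathrm{Hom}(L',S')|}{|\mathrm{Hom}(L',S)|}\cdot\sum_{[X_2]}F_{X_2S}^{S'}F_{S_2X_2}^{S''}\frac{a_{X_2}a_{S_2}}{a_{S''}},$$ where the sum runs over isomorphism classes of objects $X_2$. In particular, if both $S'$ and $S''$ are indecomposable, then (in this case) $$F_{S''\,L\oplus S}^{L'\oplus S'}=\begin{cases}|\mathrm{Hom}(L,S'')|,&\text{if }L\cong L';\\ a_{S'/S},&\text{if }L\not\cong L'.\end{cases}$$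
   Context: Weighted projective line $\mathbb{X}$ over a field $\mathbf{k}$: given by a weight sequence $(p_1,\dots,p_t)$ of positive integers and distinct points $\lambda_1,\dots,\lambda_t\in\mathbb{P}^1(\mathbf{k})$ normalized so that $\lambda_1=\infty,\lambda_2=0,\lambda_3=1$. $\mathbb{L}$ is the abelian group with generators $\vec{x}_1,\dots,\vec{x}_t$ and relations $p_1\vec{x}_1=\cdots=p_t\vec{x}_t=:\vec{c}$. Let $A=\mathbf{k}[X_1,\dots,X_t]/(f_3,\dots,f_t)$ with $f_i=X_i^{p_i}-X_2^{p_2}+\lambda_iX_1^{p_1}$, $\mathbb{L}$-graded by $\deg X_i=\vec{x}_i$. Then $\mathrm{coh}\,\mathbb{X}=\mathrm{mod}^{\mathbb{L}}(A)/\mathrm{mod}_0^{\mathbb{L}}(A)$, the quotient of finitely generated $\mathbb{L}$-graded $A$-modules by those of finite length; it is a hereditary abelian category. The structure sheaf $\mathcal{O}$ is the image of $A$, and the line bundles are the grading shifts $\mathcal{O}(\vec{x})$, $\vec{x}\in\mathbb{L}$. Torsion sheaves are the finite length objects of $\mathrm{coh}\,\mathbb{X}$; indecomposable torsion sheaves are uniserial. Hall number: $F_{AB}^{M}=|\{X\subseteq M\mid X\cong B,\ M/X\cong A\}|$. For an object $M$, $a_M=|\mathrm{Aut}(M)|$ (so $a_0=1$). $S'/S$ denotes the cokernel of the embedding $S\to S'$. *)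

(* Defs.v *)
From HB Require Import structures.
From mathcomp Require Import all_boot all_order all_algebra.
From mathcomp Require Import generic_quotient ring_quotient zify ring.
From mathcomp Require Import boolp classical_sets.
From mathcomp Require Import mpoly.

Set Implicit Arguments.
Unset Strict Implicit.
Unset Printing Implicit Defensive.

Import GRing.Theory.
Import Quotient.Exports.

Local Open Scope classical_set_scope.
Local Open Scope ring_scope.
Local Open Scope quotient_scope.

(* The number of elements of A; the value is 0 when A is infinite.  Here and in
   the categorical part plain predicates are used instead of set, whose universe
   is too small for the objects of the category constructed below. *)
Definition ncard (T : Type) (A : T -> Prop) : nat :=
  xget 0%N [set n : nat | exists f : 'I_n -> T,
    (forall i j, f i = f j -> i = j) /\ forall x, A x <-> exists i, f i = x].

Record category := Category {
  obj :> Type;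
  hom : obj -> obj -> Type;
  idm : forall A, hom A A;
  comp : forall A B C, hom B C -> hom A B -> hom A C;
  comp_idl : forall A B (f : hom A B), comp (idm B) f = f;
  comp_idr : forall A B (f : hom A B), comp f (idm A) = f;
  comp_assoc : forall A B C D (h : hom C D) (g : hom B C) (f : hom A B),
    comp h (comp g f) = comp (comp h g) f }.

Arguments idm {c} A.

Section CategoryTheory.
Variable C : category.
Implicit Types A B M X Y Z E : C.

Definition is_iso A B (f : hom A B) : Prop :=
  exists g : hom B A, comp g f = idm A /\ comp f g = idm B.

Definition isomorphic A B : Prop := exists f : hom A B, is_iso f.

Definition is_mono A B (f : hom A B) : Prop :=
  forall X (g h : hom X A), comp f g = comp f h -> g = h.

Definition is_zero Z : Prop :=
  forall X, (exists! f : hom X Z, True) /\ (exists! f : hom Z X, True).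

Definition zero_mor A B (f : hom A B) : Prop :=
  exists Z, is_zero Z /\
    exists (g : hom A Z) (h : hom Z B), f = comp h g.

Definition is_kernel K A B (i : hom K A) (f : hom A B) : Prop :=
  zero_mor (comp f i) /\
  forall X (g : hom X A), zero_mor (comp f g) ->
    exists! u : hom X K, comp i u = g.

Definition is_cokernel A B Q (p : hom B Q) (f : hom A B) : Prop :=
  zero_mor (comp p f) /\
  forall X (g : hom B X), zero_mor (comp g f) ->
    exists! u : hom Q X, comp u p = g.

(* There is an exact sequence 0 -> A -> B -> Q -> 0. *)
Definition ses A B Q : Prop :=
  exists (i : hom A B) (p : hom B Q), is_kernel i p /\ is_cokernel p i.

Definition is_biproduct A B E : Prop :=
  exists (i1 : hom A E) (i2 : hom B E) (p1 : hom E A) (p2 : hom E B),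
    [/\ comp p1 i1 = idm A /\ comp p2 i2 = idm B,
        zero_mor (comp p1 i2) /\ zero_mor (comp p2 i1),
        forall X (f : hom X A) (g : hom X B),
          exists! u : hom X E, comp p1 u = f /\ comp p2 u = g
      & forall X (f : hom A X) (g : hom B X),
          exists! u : hom E X, comp u i1 = f /\ comp u i2 = g].

Definition indecomposable M : Prop :=
  ~ is_zero M /\
  forall A B, is_biproduct A B M -> is_zero A \/ is_zero B.

Definition simple M : Prop :=
  ~ is_zero M /\
  forall X (i : hom X M), is_mono i -> is_zero X \/ is_iso i.

(* M has a composition series. *)
Inductive finite_length : C -> Prop :=
| finite_length0 Z : is_zero Z -> finite_length Z
| finite_lengthS A B M :
    ses A B M -> simple A -> finite_length M -> finite_length B.

(* A subobject of M is an equivalence class of monomorphisms into M. *)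
Definition sub_class M X (i : hom X M) : {Y : C & hom Y M} -> Prop :=
  fun j => exists2 u : hom X (projT1 j), is_iso u & comp (projT2 j) u = i.

(* The Hall number F_{AB}^M. *)
Definition hall A B M : nat :=
  ncard (fun K : {Y : C & hom Y M} -> Prop =>
    exists X (i : hom X M),
      [/\ is_mono i, isomorphic X B,
          exists p : hom M A, is_cokernel p i
        & K = sub_class i]).

Definition aut_card M : nat := ncard (fun f : hom M M => is_iso f).

Definition hom_card A B : nat := ncard (fun _ : hom A B => True).

(* The sum of f over the isomorphism classes of objects, for an
   isomorphism-invariant f of finite support: e enumerates, without repetition,
   representatives of finitely many classes, including all those where f does
   not vanish. *)
Definition sum_iso (f : C -> rat) : rat :=
  xget 0 [set v : rat | exists (n : nat) (e : 'I_n -> C),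
    [/\ forall i j, isomorphic (e i) (e j) -> i = j,
        forall X, f X <> 0 -> exists i, isomorphic X (e i)
      & v = \sum_i f (e i)]].

End CategoryTheory.

(* P^1(F) is option F, with None as the point at infinity.  There are
   t = wt_n.+2 marked points, indexed from 0; the condition on the third one
   is only present when t >= 3. *)
Record wpl (F : fieldType) := Wpl {
  wt_n : nat;
  wt : 'I_wt_n.+2 -> nat;
  pt : 'I_wt_n.+2 -> option F;
  wt_gt0 : forall i, (0 < wt i)%N;
  pt_inj : injective pt;
  pt0 : pt ord0 = None;
  pt1 : pt (lift ord0 ord0) = Some 0;
  pt2 : forall i : 'I_wt_n.+2, i = 2%N :> nat -> pt i = Some 1 }.

Arguments wt {F} w i.
Arguments pt {F} w i.
Arguments wt_gt0 {F} w i.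

Section Algebra.
Variables (F : fieldType) (X : wpl F).
Local Notation t := (wt_n X).+2.
Local Notation o1 := (lift ord0 ord0 : 'I_t).
Local Notation poly := {mpoly F[t]}.

(* The subgroup of Z^t generated by the elements p_i e_i - p_j e_j. *)
Definition Lrel : {pred 'rV[int]_t} := fun v =>
  `[< exists c : 'I_t -> 'I_t -> int,
        v = \sum_i \sum_j
          (delta_mx 0 i *+ wt X i - delta_mx 0 j *+ wt X j) *~ c i j >].

Lemma Lrel_closed : zmod_closed Lrel.
Proof.
split=> [|u v /asboolP[c ->] /asboolP[d ->]]; apply/asboolP.
  by exists (fun _ _ => 0); rewrite big1 // => i _; rewrite big1.
exists (fun i j => c i j - d i j); rewrite -sumrB; apply: eq_bigr => i _.
by rewrite -sumrB; apply: eq_bigr => j _; rewrite mulrzBr.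
Qed.

HB.instance Definition _ :=
  GRing.isZmodClosed.Build 'rV[int]_t Lrel Lrel_closed.

Definition Lgrp := Quotient.quot (Lrel : zmodClosed 'rV[int]_t).
HB.instance Definition _ := GRing.Zmodule.on Lgrp.

Definition Lgen (i : 'I_t) : Lgrp := \pi_Lgrp (delta_mx 0 i).

Definition frel (i : 'I_t) : poly :=
  'X_i ^+ wt X i - 'X_o1 ^+ wt X o1
  + (odflt 0 (pt X i))%:MP * 'X_ord0 ^+ wt X ord0.

Definition Aideal : {pred poly} := fun p =>
  `[< exists g : 'I_t -> poly, p = \sum_(i < t | (2 <= i)%N) g i * frel i >].

Lemma frel_at0 i : (frel i).@[fun=> 0] = 0.
Proof.
rewrite /frel mevalD mevalB mevalM !rmorphXn /= !mevalXU.
by rewrite !expr0n !(gtn_eqF (wt_gt0 X _)) mulr0 subr0 addr0.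
Qed.

Lemma Aideal_closed : idealr_closed Aideal.
Proof.
split.
- by apply/asboolP; exists (fun _ => 0); rewrite big1 // => i _; exact: mul0r.
- apply/negP => /asboolP[g] /(congr1 (meval (fun=> 0))).
  rewrite meval1 rmorph_sum /= big1 => [/eqP|i _]; first by rewrite oner_eq0.
  by rewrite mevalM frel_at0 mulr0.
- move=> a u v /asboolP[g ->] /asboolP[h ->]; apply/asboolP.
  exists (fun i => a * g i + h i).
  by rewrite mulr_sumr -big_split; apply: eq_bigr => i _ /=; ring.
Qed.

HB.instance Definition _ := isIdealr.Build poly Aideal Aideal_closed.

Definition Aalg := Quotient.quot (Aideal : idealr poly).
HB.instance Definition _ := GRing.ComNzRing.on Aalg.

Definition mdegL (m : 'X_{1..t}) : Lgrp := \sum_i Lgen i *+ m i.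

Definition Ahomog (y : Lgrp) (a : Aalg) : Prop :=
  exists2 p : poly, {in msupp p, forall m, mdegL m = y} & a = \pi_Aalg p.

(* A finitely generated L-graded A-module.  The decomposition into the direct
   sum of the homogeneous parts M_x is given by its projections gpr x, so that
   M_x = [set m | gpr x m = m]. *)
Record gmod := GMod {
  car :> lmodType Aalg;
  gpr : Lgrp -> car -> car;
  gprB : forall x, {morph gpr x : m n / m - n};
  gpr_idem : forall x y m, gpr x (gpr y m) = if x == y then gpr y m else 0;
  gpr_sum : forall m, exists s : seq Lgrp,
    [/\ uniq s, forall x, x \notin s -> gpr x m = 0
      & m = \sum_(x <- s) gpr x m];
  gpr_act : forall x y a m, Ahomog y a -> gpr (x + y) (a *: m) = a *: gpr x m;
  gmod_fg : exists (n : nat) (e : 'I_n -> car),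
    forall m, exists c : 'I_n -> Aalg, m = \sum_i c i *: e i }.

Definition hpart (y : Lgrp) (p : poly) : poly :=
  \sum_(m <- msupp p | mdegL m == y) p@_m *: 'X_[m].

Lemma hpartE y p m : (hpart y p)@_m = if mdegL m == y then p@_m else 0.
Proof.
rewrite /hpart raddf_sum /= big_mkcond /=.
under eq_bigr do rewrite mcoeffZ mcoeffX.
have [mp|mp] := boolP (m \in msupp p).
  rewrite (bigD1_seq m) //= eqxx mulr1 big1_seq => [|k /andP[/negbTE km _]].
    by rewrite addr0.
  by rewrite km mulr0 if_same.
rewrite big1_seq => [|k /andP[_ kp]].
  by rewrite (memN_msupp_eq0 mp) if_same.
case: eqP => // _; case: eqP kp => [->|]; first by rewrite (negbTE mp).
by rewrite mulr0.
Qed.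

Lemma hpartB y : {morph hpart y : p q / p - q}.
Proof.
move=> p q; apply/mpolyP => m; rewrite mcoeffB !hpartE mcoeffB.
by case: ifP; rewrite ?subr0.
Qed.

HB.instance Definition _ y :=
  GRing.isZmodMorphism.Build poly poly (hpart y) (hpartB y).

Lemma hpartZ y c p : hpart y (c *: p) = c *: hpart y p.
Proof.
apply/mpolyP => m; rewrite mcoeffZ !hpartE mcoeffZ.
by case: ifP; rewrite ?mulr0.
Qed.

Lemma mdegLD m n : mdegL (m + n) = mdegL m + mdegL n.
Proof.
by rewrite -big_split; apply: eq_bigr => i _; rewrite mnmDE mulrnDr.
Qed.

Lemma hpartX y m : hpart y 'X_[m] = if mdegL m == y then 'X_[m] else 0.
Proof.
apply/mpolyP => n; rewrite hpartE mcoeffX.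
case: (eqVneq m n) => [->|mn]; first by case: ifP; rewrite ?mcoeffX ?eqxx ?mcoeff0.
by case: ifP; case: ifP; rewrite ?mcoeffX ?(negbTE mn) ?mcoeff0.
Qed.

Lemma hpartM x y p q : {in msupp p, forall m, mdegL m = y} ->
  hpart (x + y) (p * q) = p * hpart x q.
Proof.
move=> hp; rewrite [p]mpolyE mulr_suml raddf_sum mulr_suml /=.
apply: eq_big_seq => m /hp hm; rewrite {1}[q]mpolyE [in RHS]/hpart.
rewrite !mulr_sumr raddf_sum /= [RHS]big_mkcond /=.
apply: eq_bigr => n _.
rewrite -!scalerAl -!scalerAr -mpolyXD !hpartZ hpartX mdegLD hm addrC.
by rewrite (inj_eq (addIr y)); case: ifP; rewrite ?scaler0.
Qed.

Lemma Lgen_rel i j : Lgen i *+ wt X i = Lgen j *+ wt X j.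
Proof.
apply/eqP; rewrite -subr_eq0 -!raddfMn -raddfB.
rewrite -(raddf0 (\pi_Lgrp)) /=.
rewrite -Quotient.idealrBE subr0; apply/asboolP.
exists (fun k l => ((k == i) && (l == j))%:R).
rewrite (bigD1 i) //= (bigD1 j) //= !eqxx mulr1z big1 => [|l /negbTE lj].
  rewrite big1 ?addr0 // => k /negbTE ki.
  by rewrite big1 // => l _; rewrite ki mulr0z.
by rewrite lj mulr0z.
Qed.

Lemma frel_homog i : {in msupp (frel i), forall m, mdegL m = Lgen ord0 *+ wt X ord0}.
Proof.
have XE j : 'X_j ^+ wt X j = 'X_[U_(j) *+ wt X j] :> poly by rewrite mpolyXn.
have dE j : mdegL (U_(j) *+ wt X j)%MM = Lgen ord0 *+ wt X ord0.
  rewrite (Lgen_rel ord0 j) /mdegL (bigD1 j) //= big1 ?addr0.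
    by rewrite mulmnE mnm1E eqxx mul1n.
  by move=> k /negbTE kj; rewrite mulmnE mnm1E eq_sym kj mul0n mulr0n.
move=> m; rewrite mcoeff_msupp /frel !XE mcoeffD mcoeffB mcoeffCM !mcoeffX.
move=> nz; apply/eqP; apply: contraNT nz => ne.
have ne' j : ((U_(j) *+ wt X j)%MM == m) = false.
  by apply/negP => /eqP jm; move: ne; rewrite -jm dE eqxx.
by rewrite !ne' mulr0 subr0 addr0.
Qed.

Lemma hpart_ideal y p : p \in Aideal -> hpart y p \in Aideal.
Proof.
move=> /asboolP[g ->]; apply/asboolP.
exists (fun i => hpart (y - Lgen ord0 *+ wt X ord0) (g i)).
rewrite raddf_sum /=; apply: eq_bigr => i _; rewrite mulrC.
rewrite -{1}[y](subrK (Lgen ord0 *+ wt X ord0)) hpartM; last exact: frel_homog.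
by rewrite mulrC.
Qed.

Definition Apr (y : Lgrp) (a : Aalg^o) : Aalg^o := \pi_Aalg (hpart y (repr a)).

Lemma AprE y p : Apr y (\pi_Aalg p) = \pi_Aalg (hpart y p).
Proof.
apply/eqP; rewrite -Quotient.idealrBE -hpartB; apply: hpart_ideal.
by rewrite Quotient.idealrBE reprK.
Qed.

Lemma Apr_lift (a : Aalg) : exists p : poly, a = \pi_Aalg p.
Proof. by exists (repr a); rewrite reprK. Qed.

Lemma AprB y : {morph Apr y : a b / a - b}.
Proof.
move=> a b; have [p ->] := Apr_lift a; have [q ->] := Apr_lift b.
by rewrite -[_ - _](raddfB (\pi_Aalg)) !AprE hpartB raddfB.
Qed.

Lemma Apr_idem x y a : Apr x (Apr y a) = if x == y then Apr y a else 0.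
Proof.
have [p ->] := Apr_lift a; rewrite !AprE.
have -> : hpart x (hpart y p) = if x == y then hpart y p else 0.
  apply/mpolyP => m; case: (eqVneq x y) => [->|xy] /=; rewrite ?mcoeff0 !hpartE.
    by case: (mdegL m == y).
  by case: eqP => // ->; rewrite (negbTE xy).
by case: ifP => // _; rewrite raddf0.
Qed.

Lemma Apr_sum a : exists s : seq Lgrp,
  [/\ uniq s, forall x, x \notin s -> Apr x a = 0 & a = \sum_(x <- s) Apr x a].
Proof.
have [p ->] := Apr_lift a.
exists (undup (map mdegL (msupp p))); split; first exact: undup_uniq.
  move=> x; rewrite mem_undup => xs; rewrite AprE /hpart big1_seq ?raddf0 //.
  move=> m /andP[/eqP mx mp]; case/negP: xs; apply/mapP; by exists m.
under eq_bigr do rewrite AprE.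
rewrite -(raddf_sum (\pi_Aalg)); congr (\pi_Aalg _); apply/mpolyP => m.
rewrite raddf_sum /=; under eq_bigr do rewrite hpartE.
have [mp|mp] := boolP (m \in msupp p).
  rewrite (bigD1_seq (mdegL m)) ?undup_uniq //=; last first.
    by rewrite mem_undup map_f.
  by rewrite eqxx big1 ?addr0 // => k; rewrite eq_sym => /negbTE ->.
by rewrite (memN_msupp_eq0 mp) big1 // => k _; rewrite if_same.
Qed.

Lemma Apr_act x y a (b : Aalg^o) :
  Ahomog y a -> Apr (x + y) (a *: b) = a *: Apr x b.
Proof.
move=> [p hp ->]; have [r ->] := Apr_lift b.
have pM q : \pi_Aalg p *: (\pi_Aalg q : Aalg^o) = \pi_Aalg (p * q).
  by rewrite rmorphM.
by rewrite pM !AprE hpartM // pM.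
Qed.

Lemma Afg : exists (n : nat) (e : 'I_n -> Aalg^o),
  forall m, exists c : 'I_n -> Aalg, m = \sum_i c i *: e i.
Proof.
exists 1%N, (fun=> 1) => m; exists (fun=> m).
by rewrite big_ord1 -[RHS]/(m * 1) mulr1.
Qed.

Definition Amod : gmod := GMod AprB Apr_idem Apr_sum Apr_act Afg.

Section Shift.
Variables (M : gmod) (z : Lgrp).

Lemma shift_idem x y (m : M) :
  gpr (x + z) (gpr (y + z) m) = if x == y then gpr (y + z) m else 0.
Proof. by rewrite gpr_idem (inj_eq (addIr z)). Qed.

Lemma shift_sum (m : M) : exists s : seq Lgrp,
  [/\ uniq s, forall x, x \notin s -> gpr (x + z) m = 0
    & m = \sum_(x <- s) gpr (x + z) m].
Proof.
have [s [su s0 sE]] := gpr_sum m.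
exists [seq x - z | x <- s]; split.
- by rewrite map_inj_uniq //; exact: addIr.
- move=> x xs; apply: s0; apply: contra xs => xs.
  by apply/mapP; exists (x + z); rewrite ?addrK.
- by rewrite big_map [LHS]sE; apply: eq_bigr => x _; rewrite subrK.
Qed.

Lemma shift_act x y a (m : M) :
  Ahomog y a -> gpr (x + y + z) (a *: m) = a *: gpr (x + z) m.
Proof. by move=> h; rewrite addrAC gpr_act. Qed.

(* M(z)_x = M_(x + z). *)
Definition shift : gmod :=
  @GMod (car M) (fun x => gpr (x + z)) (fun x => @gprB M (x + z))
    shift_idem shift_sum shift_act (gmod_fg M).

End Shift.

Definition gsub (M : gmod) (P : set M) : Prop :=
  [/\ P 0, forall a m n, P m -> P n -> P (a *: m + n)
    & forall x m, P m -> P (gpr x m)].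

(* Q/P has finite length as a graded module: the lengths of the strictly
   increasing chains of graded submodules between P and Q are bounded. *)
Definition fin_len (M : gmod) (P Q : set M) : Prop :=
  exists n : nat, forall U : nat -> set M,
    (forall i, [/\ gsub (U i), P `<=` U i & U i `<=` Q]) ->
    (forall i, U i `<=` U i.+1) ->
    exists2 i, (i < n)%N & U i.+1 `<=` U i.

Definition rdom (M N : gmod) (R : M -> N -> Prop) : set M :=
  [set m | exists n, R m n].

Definition rind (M N : gmod) (R : M -> N -> Prop) : set N := [set n | R 0 n].

(* Representatives of the morphisms M -> N of the quotient category
   mod(A)/mod_0(A), where Hom(M, N) is the colimit of the groups
   Hom(M', N/N') over the graded submodules M' of M and N' of N such that
   M/M' and N' have finite length.  A degree-preserving A-linear map
   f : M' -> N/N' is encoded by the relation R m n <-> m \in M' /\ n \in f m;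
   the graded submodules R of M x N correspond bijectively to the triples
   (M', N', f), with M' = rdom R and N' = rind R. *)
Definition frac (M N : gmod) (R : M -> N -> Prop) : Prop :=
  [/\ R 0 0,
      forall a m n m' n', R m n -> R m' n' -> R (a *: m + m') (a *: n + n'),
      forall x m n, R m n -> R (gpr x m) (gpr x n),
      fin_len (rdom R) setT
    & fin_len [set 0] (rind R)].

(* R and R' induce the same map M' -> N/N' for some M' and N' as above, that is,
   they are equal in the colimit. *)
Definition frac_eq (M N : gmod) (R R' : M -> N -> Prop) : Prop :=
  exists (M' : set M) (N' : set N),
    [/\ gsub M' /\ fin_len M' setT, gsub N' /\ fin_len [set 0] N',
        M' `<=` rdom R /\ M' `<=` rdom R'
      & forall m n n', M' m -> R m n -> R' m n' -> N' (n - n')].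

Definition rcomp (M N P : gmod) (S : N -> P -> Prop) (R : M -> N -> Prop) :
  M -> P -> Prop := fun m p => exists2 n, R m n & S n p.

End Algebra.

Section Coh.
Variables (F : fieldType) (X : wpl F).
Section Submodules.
Variable M : gmod X.
Implicit Types P Q U V : set M.

Lemma gsubD P m n : gsub P -> P m -> P n -> P (m + n).
Proof. by move=> [_ h _] pm pn; rewrite -[m]scale1r; apply: h. Qed.

Lemma gsubN P m : gsub P -> P m -> P (- m).
Proof. by move=> [z h _] pm; rewrite -scaleN1r -[_ *: _]addr0; apply: h. Qed.

Lemma gsubB P m n : gsub P -> P m -> P n -> P (m - n).
Proof. by move=> h pm pn; apply: gsubD => //; apply: gsubN. Qed.

Lemma gpr0 x : gpr x (0 : M) = 0.
Proof. by have := gprB x (0 : M) 0; rewrite !subrr. Qed.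

Lemma gprD x (m n : M) : gpr x (m + n) = gpr x m + gpr x n.
Proof. by rewrite -{1}[n]opprK -[- n]sub0r !gprB gpr0 sub0r opprK. Qed.

Lemma gsub0 : gsub [set (0 : M)].
Proof.
split=> [|a m n -> ->|x m ->] /=; first by [].
  by rewrite scaler0 addr0.
exact: gpr0.
Qed.

Lemma gsubT : gsub [set: M]. Proof. by split. Qed.

Lemma gsubI P Q : gsub P -> gsub Q -> gsub (P `&` Q).
Proof.
move=> [p1 p2 p3] [q1 q2 q3]; split=> [//|a m n [? ?] [? ?]|x m [? ?]].
  by split; [apply: p2 | apply: q2].
by split; [apply: p3 | apply: q3].
Qed.

Definition gadd P Q : set M := [set m | exists p q, [/\ P p, Q q & m = p + q]].

Lemma gsubA P Q : gsub P -> gsub Q -> gsub (gadd P Q).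
Proof.
move=> [p1 p2 p3] [q1 q2 q3]; split.
- by exists 0, 0; rewrite addr0.
- move=> a m n [p [q [hp hq ->]]] [p' [q' [hp' hq' ->]]].
  exists (a *: p + p'), (a *: q + q'); split; [exact: p2|exact: q2|].
  by rewrite scalerDr addrACA.
- move=> x m [p [q [hp hq ->]]]; exists (gpr x p), (gpr x q).
  by split; [exact: p3|exact: q3|exact: gprD].
Qed.

Lemma gaddl P Q : gsub Q -> P `<=` gadd P Q.
Proof. by move=> [q _ _] m pm; exists m, 0; rewrite addr0. Qed.

Lemma gaddr P Q : gsub P -> Q `<=` gadd P Q.
Proof. by move=> [q _ _] m pm; exists 0, m; rewrite add0r. Qed.

Definition inter P Q U := [/\ gsub U, P `<=` U & U `<=` Q].

Lemma fin_len_rank P Q : fin_len P Q ->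
  exists (n : nat) (r : set M -> nat),
    [/\ forall U, inter P Q U -> (r U <= n)%N,
        forall U V, inter P Q U -> inter P Q V -> U `<=` V -> (r U <= r V)%N
      & forall U V, inter P Q U -> inter P Q V -> U `<=` V ->
          (r V <= r U)%N -> V `<=` U].
Proof.
move=> [n hn].
pose ch U k := exists c : nat -> set M,
  [/\ forall i, inter P Q (c i), forall i, c i `<=` c i.+1,
      forall i, (i < k)%N -> ~ c i.+1 `<=` c i & c k `<=` U].
have ch0 U : inter P Q U -> ch U 0%N.
  by move=> iU; exists (fun=> U); split=> // i m.
have chn U k : ch U k -> (k <= n)%N.
  move=> [c [c1 c2 c3 _]]; rewrite leqNgt; apply/negP => nk.
  have [i iln] := hn c c1 c2; apply: c3; exact: ltn_trans nk.
pose pr U : pred nat := fun k => `[< ch U k >].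
have prn U k : pr U k -> (k <= n)%N by move=> /asboolP; apply: chn.
pose r U := if pselect (exists k, pr U k) is left e then ex_maxn e (@prn U)
            else 0%N.
have rP U : inter P Q U -> ch U (r U) /\ forall k, ch U k -> (k <= r U)%N.
  move=> iU; rewrite /r; case: pselect => [e|[]]; last first.
    by exists 0%N; apply/asboolP; apply: ch0.
  by case: ex_maxnP => k /asboolP ck mx; split=> // j cj; apply: mx; apply/asboolP.
exists n, r; split.
- by move=> U /rP[/chn].
- move=> U V /rP[cU _] /rP[_ mV] UV; apply: mV.
  by move: cU => [c [c1 c2 c3 c4]]; exists c; split=> // m /c4 /UV.
- move=> U V iU iV UV rVU; apply: contrapT => VU.
  have [[c [c1 c2 c3 c4]] _] := rP U iU; have [_ mV] := rP V iV.
  suff /mV : ch V (r U).+1 by rewrite ltnNge rVU.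
  exists (fun i => if (i <= r U)%N then c i else V); split.
  + by move=> i; case: ifP.
  + move=> i; case: (ltngtP i (r U)) => [iU'|iU'|iU'].
    * exact: c2.
    * by [].
    * by move=> m; rewrite iU' => /c4 /UV.
  + move=> i; rewrite ltnS => iU'; rewrite iU'.
    case: ltnP => [|le]; first exact: c3.
    have -> : i = r U by apply/eqP; rewrite eqn_leq iU'.
    by move=> h; apply: VU => m /h /c4.
  + by rewrite ltnn.
Qed.

Lemma rank_fin_len P Q (n : nat) (r : set M -> nat) :
  (forall U, inter P Q U -> (r U <= n)%N) ->
  (forall U V, inter P Q U -> inter P Q V -> U `<=` V ->
     (r V <= r U)%N -> V `<=` U) -> fin_len P Q.
Proof.
move=> rn rs; exists n.+1 => U U1 U2; apply: contrapT => no.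
have st i : (i < n.+1)%N -> (r (U i) < r (U i.+1))%N.
  move=> il; rewrite ltnNge; apply/negP => le; apply: no; exists i => //.
  exact: rs le.
have : (n.+1 <= r (U n.+1))%N.
  have : (n.+1 <= n.+1)%N by [].
  elim: {1 3 4}n.+1 => [//|k ih] kn.
  exact: leq_ltn_trans (ih (ltnW kn)) (st k kn).
by rewrite ltnNge rn.
Qed.

Lemma fin_len_ext P Q U : gsub Q -> gsub U -> P `<=` Q -> Q `<=` U ->
  fin_len P Q -> fin_len Q U -> fin_len P U.
Proof.
move=> gQ gU PQ QU /fin_len_rank[n1 [r1 [b1 m1 s1]]].
move=> /fin_len_rank[n2 [r2 [b2 m2 s2]]].
have i1 V : inter P U V -> inter P Q (V `&` Q).
  by move=> [gV PV VU]; split=> [|m pm|m []//]; [exact: gsubI|split; auto].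
have i2 V : inter P U V -> inter Q U (gadd V Q).
  move=> [gV PV VU]; split=> [||m [v [q [hv hq ->]]]].
  - exact: gsubA.
  - exact: gaddr.
  - by apply: gsubD => //; auto.
apply: (@rank_fin_len _ _ (n1 + n2)
          (fun V => r1 (V `&` Q) + r2 (gadd V Q))%N) => [V iV|V W iV iW VW le].
  by apply: leq_add; [apply: b1; apply: i1|apply: b2; apply: i2].
have VW1 : V `&` Q `<=` W `&` Q by move=> m [/VW ? ?].
have VW2 : gadd V Q `<=` gadd W Q.
  by move=> m [v [q [/VW hv hq ->]]]; exists v, q.
have l1 := m1 _ _ (i1 _ iV) (i1 _ iW) VW1.
have l2 := m2 _ _ (i2 _ iV) (i2 _ iW) VW2.
have {}s1 := s1 _ _ (i1 _ iV) (i1 _ iW) VW1 ltac:(lia).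
have {}s2 := s2 _ _ (i2 _ iV) (i2 _ iW) VW2 ltac:(lia).
have [gV _ _] := iV; have [gW _ _] := iW.
move=> w hw; have [v [q [hv hq E]]] := s2 w (gaddl gQ hw).
have [vq _] : (V `&` Q) q.
  apply: s1; split=> //; have -> : q = w - v by rewrite E addrAC subrr add0r.
  by apply: gsubB => //; apply: VW.
by rewrite E; apply: gsubD.
Qed.

Lemma fin_len_transport (N : gmod X) (P Q : set M) (P' Q' : set N)
    (phi : set M -> set N) :
  (forall U, inter P Q U -> [/\ gsub (phi U), P' `<=` phi U & phi U `<=` Q']) ->
  (forall U V, inter P Q U -> inter P Q V -> U `<=` V -> phi U `<=` phi V) ->
  (forall U V, inter P Q U -> inter P Q V -> U `<=` V -> phi V `<=` phi U ->
     V `<=` U) ->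
  fin_len P' Q' -> fin_len P Q.
Proof.
move=> h1 h2 h3 [n hn]; exists n => U U1 U2.
have [i|i|i iln le] := hn (phi \o U); [exact/h1|exact/h2|].
by exists i => //; apply: h3 le.
Qed.

Lemma fin_len_sub P Q Q' : Q `<=` Q' -> fin_len P Q' -> fin_len P Q.
Proof.
move=> QQ; apply: (@fin_len_transport _ _ _ _ _ id) => // U [? ? UQ]; split=> //.
by move=> m /UQ /QQ.
Qed.

Lemma fin_len_refl P : fin_len P P.
Proof.
exists 1%N => U U1 U2; exists 0%N => //.
by have [_ h _] := U1 0%N; have [_ _ h'] := U1 1%N; move=> m /h' /h.
Qed.

Lemma fin_len_add P Q : gsub P -> gsub Q ->
  fin_len [set 0] P -> fin_len [set 0] Q -> fin_len [set 0] (gadd P Q).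
Proof.
move=> gP gQ fP fQ; apply: (@fin_len_ext _ P) => //.
- exact: gsubA.
- by move=> m ->; case: gP.
- exact: gaddl.
apply: (@fin_len_transport _ _ _ _ _ (fun U => U `&` Q)) fQ.
- move=> U [gU _ _]; split=> [|m ->|m []//]; first exact: gsubI.
  by case: (gsubI gU gQ).
- by move=> U V _ _ UV m [/UV].
- move=> U V [gU PU _] [gV PV Va] UV VU v hv.
  have [p [q [hp hq E]]] := Va v hv.
  have [uq _] : (U `&` Q) q.
    apply: VU; split=> //; have -> : q = v - p by rewrite E addrAC subrr add0r.
    by apply: gsubB => //; apply: PV.
  by rewrite E; apply: gsubD => //; apply: PU.
Qed.

Lemma cofin_cap P Q : gsub P -> gsub Q ->
  fin_len P setT -> fin_len Q setT -> fin_len (P `&` Q) setT.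
Proof.
move=> gP gQ fP fQ; apply: (fin_len_ext gP gsubT _ _ _ fP) => //.
apply: (@fin_len_transport _ _ _ _ _ (fun U => gadd U Q)) fQ.
- by move=> U [gU _ _]; split=> //; [exact: gsubA|exact: gaddr].
- by move=> U V _ _ UV m [v [q [/UV hv hq ->]]]; exists v, q.
- move=> U V [gU PU UP] [gV PV VP] UV VU v hv.
  have [u [q [hu hq E]]] := VU v (gaddl gQ hv).
  have uq : U q.
    apply: PU; split=> //; have -> : q = v - u by rewrite E addrAC subrr add0r.
    by apply: gsubB => //; [apply: VP|apply: UP].
  by rewrite E; apply: gsubD.
Qed.

End Submodules.

Section Fractions.
Variables M N : gmod X.
Implicit Types R : M -> N -> Prop.

Definition rlin R : Prop :=
  [/\ R 0 0,
      forall a m n m' n', R m n -> R m' n' -> R (a *: m + m') (a *: n + n')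
    & forall x m n, R m n -> R (gpr x m) (gpr x n)].

Lemma frac_rlin R : frac R -> rlin R. Proof. by case. Qed.

Lemma rlinB R m n m' n' : rlin R -> R m n -> R m' n' -> R (m - m') (n - n').
Proof.
move=> [_ h _] r r'; have := h (-1) _ _ _ _ r' r.
by rewrite !scaleN1r [- m' + _]addrC [- n' + _]addrC.
Qed.

Definition rim R (U : set M) : set N := [set n | exists2 m, U m & R m n].
Definition rpre R (U : set N) : set M := [set m | exists2 n, U n & R m n].

Lemma gsub_rim R U : rlin R -> gsub U -> gsub (rim R U).
Proof.
move=> [r0 rl rg] [u0 ul ug]; split; first by exists 0.
- move=> a n n' [m um rm] [m' um' rm']; exists (a *: m + m'); first exact: ul.
  exact: rl.
- by move=> x n [m um rm]; exists (gpr x m); [exact: ug|exact: rg].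
Qed.

Lemma gsub_rpre R U : rlin R -> gsub U -> gsub (rpre R U).
Proof.
move=> [r0 rl rg] [u0 ul ug]; split; first by exists 0.
- move=> a n n' [m um rm] [m' um' rm']; exists (a *: m + m'); first exact: ul.
  exact: rl.
- by move=> x n [m um rm]; exists (gpr x m); [exact: ug|exact: rg].
Qed.

Lemma rdomE R : rdom R = rpre R setT.
Proof. by rewrite eqEsubset; split=> m [n]; [exists n|exists n]. Qed.

Lemma rindE R : rind R = rim R [set 0].
Proof.
by rewrite eqEsubset; split=> [n r|n [m -> r]//]; exists 0.
Qed.

Lemma gsub_rdom R : rlin R -> gsub (rdom R).
Proof. by move=> h; rewrite rdomE; apply: gsub_rpre. Qed.

Lemma gsub_rind R : rlin R -> gsub (rind R).
Proof. by move=> h; rewrite rindE; apply: gsub_rim => //; apply: gsub0. Qed.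

Lemma cofin_rpre R U : frac R -> gsub U -> fin_len U setT ->
  fin_len (rpre R U) setT.
Proof.
move=> fR gU fU; have lR := frac_rlin fR; have gd := gsub_rdom lR.
have [_ _ _ cR _] := fR.
apply: (fin_len_ext gd (gsubT _) _ _ _ cR) => //.
  by move=> m [n _ r]; exists n.
apply: (@fin_len_transport _ _ _ _ _ _ (fun V => gadd (rim R V) U)) fU.
- move=> V [gV _ _]; have g1 := gsub_rim lR gV.
  by split=> //; [exact: gsubA|exact: gaddr].
- move=> V W _ _ VW n [p [q [[m /VW hm r] hq ->]]].
  by exists p, q; split=> //; exists m.
- move=> V W [gV pV Vd] [gW pW Wd] VW WV w hw.
  have [n r] := Wd w hw.
  have [p [q [[v hv rv] hq E]]] : gadd (rim R V) U n.
    by apply: WV; apply: gaddl => //; exists w.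
  rewrite -(subrK v w); apply: gsubD => //; apply: pV; exists q => //.
  have -> : q = n - p by rewrite E addrAC subrr add0r.
  exact: rlinB.
Qed.

Lemma fin_rim R U : frac R -> gsub U -> fin_len [set 0] U ->
  fin_len [set 0] (rim R U).
Proof.
move=> fR gU fU; have lR := frac_rlin fR; have gd := gsub_rind lR.
have [_ _ _ _ cR] := fR.
apply: (@fin_len_ext _ _ (rind R)) => //.
- exact: gsub_rim.
- by move=> n ->; case: lR.
- by move=> n r; exists 0 => //; case: gU.
apply: (@fin_len_transport _ _ _ _ _ _ (fun V => rpre R V `&` U)) fU.
- move=> V [gV _ _]; have g1 := gsubI (gsub_rpre lR gV) gU.
  split=> [//|m ->|m []//]; by case: g1.
- by move=> V W _ _ VW m [[n /VW hn r] um]; split=> //; exists n.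
- move=> V W [gV pV Vd] [gW pW Wd] VW WV w hw.
  have [m um r] := Wd w hw.
  have [[v hv rv] _] : (rpre R V `&` U) m by apply: WV; split=> //; exists w.
  rewrite -(subrK v w); apply: gsubD => //; apply: pV.
  by rewrite /rind /= -(subrr m); apply: rlinB.
Qed.

Lemma frac_eq_refl R : frac R -> frac_eq R R.
Proof.
move=> fR; have lR := frac_rlin fR; exists (rdom R), (rind R).
have [_ _ _ ? ?] := fR; split.
- by split=> //; exact: gsub_rdom.
- by split=> //; exact: gsub_rind.
- by split.
- by move=> m n n' _ r r'; rewrite /rind /= -(subrr m); apply: rlinB.
Qed.

Lemma frac_eq_sym R R' : frac_eq R R' -> frac_eq R' R.
Proof.
move=> [M' [N' [h1 [h2 h2'] [h3 h3'] h4]]]; exists M', N'; split=> //.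
by move=> m n n' hm r r'; rewrite -opprB; apply: gsubN => //; apply: h4 hm r' r.
Qed.

Lemma frac_eq_trans R R' R'' :
  frac_eq R R' -> frac_eq R' R'' -> frac_eq R R''.
Proof.
move=> [M1 [N1 [[g1 f1] [g1' f1'] [d1 d1'] h1]]].
move=> [M2 [N2 [[g2 f2] [g2' f2'] [d2 d2'] h2]]].
exists (M1 `&` M2), (gadd N1 N2); split.
- by split; [exact: gsubI|exact: cofin_cap].
- by split; [exact: gsubA|exact: fin_len_add].
- by split=> m [? ?]; [apply: d1|apply: d2'].
- move=> m n n'' [m1 m2] r r''; have [n' r'] := d1' m m1.
  exists (n - n'), (n' - n''); split; [exact: h1 r r'|exact: h2 r' r''|].
  by rewrite addrA subrK.
Qed.

End Fractions.

Lemma frac_rcomp (M N P : gmod X) (S : N -> P -> Prop) (R : M -> N -> Prop) :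
  frac S -> frac R -> frac (rcomp S R).
Proof.
move=> fS fR; have [s0 sl sg sd si] := fS; have [r0 rl rg rd ri] := fR.
have lS := frac_rlin fS; have lR := frac_rlin fR.
have dE : rdom (rcomp S R) = rpre R (rdom S).
  rewrite eqEsubset; split=> [m [p [n r s]]|m [n [p s] r]].
    by exists n => //; exists p.
  by exists p, n.
have iE : rind (rcomp S R) = rim S (rind R).
  by rewrite eqEsubset; split=> [p [n r s]|p [n r s]]; exists n.
split.
- by exists 0.
- move=> a m p m' p' [n r s] [n' r' s']; exists (a *: n + n'); [exact: rl|exact: sl].
- by move=> x m p [n r s]; exists (gpr x n); [exact: rg|exact: sg].
- by rewrite dE; apply: cofin_rpre => //; apply: gsub_rdom.
- by rewrite iE; apply: fin_rim => //; apply: gsub_rind.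
Qed.

Lemma frac_eq_comp (M N P : gmod X) (S S' : N -> P -> Prop)
    (R R' : M -> N -> Prop) :
  frac S -> frac S' -> frac R -> frac R' -> frac_eq S S' -> frac_eq R R' ->
  frac_eq (rcomp S R) (rcomp S' R').
Proof.
move=> fS fS' fR fR' [N1 [P1 [[g1 f1] [g1' f1'] [d1 d1'] h1]]].
move=> [M2 [N2 [[g2 f2] [g2' f2'] [d2 d2'] h2]]].
have lS := frac_rlin fS; have lR := frac_rlin fR.
have lS' := frac_rlin fS'; have lR' := frac_rlin fR'.
have gi := gsub_rim lS g2'; have gi' := gsub_rim lS' g2'.
have gp := gsub_rpre lR g1; have gp' := gsub_rpre lR' g1.
have fi := fin_rim fS g2' f2'; have fi' := fin_rim fS' g2' f2'.
have fp := cofin_rpre fR g1 f1; have fp' := cofin_rpre fR' g1 f1.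
exists (M2 `&` (rpre R N1 `&` rpre R' N1)),
  (gadd P1 (gadd (rim S N2) (rim S' N2))); split.
- have g := gsubI gp gp'.
  by split; [exact: gsubI|apply: cofin_cap => //; exact: cofin_cap].
- have g := gsubA gi gi'.
  by split; [exact: gsubA|apply: fin_len_add => //; exact: fin_len_add].
- split=> m [_ [[n hn r] [n' hn' r']]].
    by have [p s] := d1 n hn; exists p, n.
  by have [p s] := d1' n' hn'; exists p, n'.
- move=> m p p' [m2 [[n0 hn0 r0] _]] [n r s] [n' r' s'].
  have [p0 s0] := d1 n0 hn0; have [p0' s0'] := d1' n0 hn0.
  exists (p0 - p0'), ((p - p0) + (p0' - p')); split; first exact: h1 s0 s0'.
  + exists (p - p0), (p0' - p'); split=> //.
      exists (n - n0); last exact: rlinB.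
      rewrite -[n - n0]subr0; apply: (h2 0); first by case: g2.
        by rewrite -(subrr m); apply: rlinB.
      by case: lR'.
    exists (n0 - n'); [exact: h2 r0 r'|exact: rlinB].
  + by rewrite addrCA [p0 - p0' + _]addrA subrK addrA subrK.
Qed.

(* Morphisms are equivalence classes of representatives, as sets. *)
Definition cohom (M N : gmod X) : Type :=
  {K : set (M -> N -> Prop) |
    exists2 R, frac R & K = [set R' | frac R' /\ frac_eq R R']}.

Lemma cohom_inj (M N : gmod X) (f g : cohom M N) : sval f = sval g -> f = g.
Proof. by case: f g => [K hK] [K' hK'] /= E; exact: eq_exist. Qed.

Definition cls (M N : gmod X) (R : M -> N -> Prop) (fR : frac R) : cohom M N :=
  exist _ [set R' | frac R' /\ frac_eq R R'] (ex_intro2 _ _ R fR erefl).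

Lemma clsP (M N : gmod X) (f : cohom M N) :
  exists (R : M -> N -> Prop) (fR : frac R), f = cls fR.
Proof. by case: f => K [R fR KE]; exists R, fR; apply: eq_exist. Qed.

Lemma cls_eq (M N : gmod X) (R R' : M -> N -> Prop) (fR : frac R)
  (fR' : frac R') : frac_eq R R' -> cls fR = cls fR'.
Proof.
move=> e; apply: eq_exist; rewrite eqEsubset; split=> T [fT h]; split=> //.
  exact: frac_eq_trans (frac_eq_sym e) h.
exact: frac_eq_trans e h.
Qed.

Lemma frac_id (M : gmod X) : frac (fun m n : M => m = n).
Proof.
split=> //.
- by move=> a m n m' n' -> ->.
- by move=> x m n ->.
- have -> : rdom (fun m n : M => m = n) = setT.
    by rewrite eqEsubset; split=> // m _; exists m.
  exact: fin_len_refl.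
- have -> : rind (fun m n : M => m = n) = [set 0].
    by rewrite eqEsubset; split=> m /esym.
  exact: fin_len_refl.
Qed.

Definition coh_rep (M N : gmod X) (f : cohom M N) : M -> N -> Prop :=
  s2val (cid2 (svalP f)).

Lemma coh_repP (M N : gmod X) (f : cohom M N) : frac (coh_rep f).
Proof. exact: (s2valP (cid2 (svalP f))). Qed.

Lemma coh_repK (M N : gmod X) (f : cohom M N) : cls (coh_repP f) = f.
Proof.
by apply: cohom_inj => /=; rewrite -(s2valP' (cid2 (svalP f))).
Qed.

Lemma coh_rep_cls (M N : gmod X) (R : M -> N -> Prop) (fR : frac R) :
  frac_eq (coh_rep (cls fR)) R.
Proof.
have /(congr1 sval)/= E := coh_repK (cls fR).
have : [set R' | frac R' /\ frac_eq R R'] R by split=> //; exact: frac_eq_refl.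
by rewrite -E => -[].
Qed.

Definition coh_comp (M N P : gmod X) (g : cohom N P) (f : cohom M N) :
  cohom M P := cls (frac_rcomp (coh_repP g) (coh_repP f)).

Lemma coh_compE (M N P : gmod X) (S : N -> P -> Prop) (R : M -> N -> Prop)
  (fS : frac S) (fR : frac R) :
  coh_comp (cls fS) (cls fR) = cls (frac_rcomp fS fR).
Proof.
apply: cls_eq; apply: frac_eq_comp => //; try exact: coh_repP.
  exact: coh_rep_cls.
exact: coh_rep_cls.
Qed.

Lemma cls_ext (M N : gmod X) (R R' : M -> N -> Prop) (fR : frac R)
  (fR' : frac R') : (forall m n, R m n <-> R' m n) -> cls fR = cls fR'.
Proof.
move=> h; have E : R = R' by apply/funext => m; apply/funext => n; apply/propext.
by apply: cls_eq; rewrite -E; apply: frac_eq_refl.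
Qed.

Lemma coh_idl (M N : gmod X) (f : cohom M N) :
  coh_comp (cls (frac_id N)) f = f.
Proof.
have [R [fR ->]] := clsP f; rewrite coh_compE; apply: cls_ext => m n.
by split=> [[k r <-]//|r]; exists n.
Qed.

Lemma coh_idr (M N : gmod X) (f : cohom M N) :
  coh_comp f (cls (frac_id M)) = f.
Proof.
have [R [fR ->]] := clsP f; rewrite coh_compE; apply: cls_ext => m n.
by split=> [[k <- r]//|r]; exists m.
Qed.

Lemma coh_assoc (M N P Q : gmod X) (h : cohom P Q) (g : cohom N P)
  (f : cohom M N) : coh_comp h (coh_comp g f) = coh_comp (coh_comp h g) f.
Proof.
have [R [fR ->]] := clsP f; have [S [fS ->]] := clsP g.
have [T [fT ->]] := clsP h; rewrite !coh_compE; apply: cls_ext => m q.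
split=> [[p [n r s] t]|[n r [p s t]]].
  by exists n => //; exists p.
by exists p => //; exists n.
Qed.

Definition coh : category := Category coh_idl coh_idr coh_assoc.

Definition Osh (z : Lgrp X) : coh := shift (Amod X) z.

Definition is_line_bundle (M : coh) : Prop :=
  exists z : Lgrp X, isomorphic M (Osh z).

Definition is_torsion (M : coh) : Prop := finite_length M.

End Coh.

(* Main.v *)
(** A line bundle L' lifts along epimorphisms with torsion kernel and receives no
    nonzero morphism from a torsion sheaf.  Hence an epimorphism
    pi : L' + S' -> S'' has kernel L + S exactly when its restriction
    h : S' -> S'' has kernel S and the composite L' -> S'' -> coker h is an
    epimorphism with kernel L.  The cokernel of h is then
    isomorphic to S_2: comparing localisations forces two quotients of L' by copies
    of L to be isomorphic.  Any two epimorphisms of a line bundle onto the same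
    torsion sheaf differ by an automorphism of the target, so for fixed h the
    admissible restrictions L' -> S'' number a_{S_2} |Hom(L', im h)|, where
    |Hom(L', im h)| = |Hom(L', S')| / |Hom(L', S)|.  Sorting the morphisms h by their
    image gives the sum over X_2, and dividing by a_{S''} turns epimorphisms into
    subobjects.

    If S' and S'' are indecomposable they are uniserial, because only one prime of A
    acts nilpotently on them; then every h factors through the same quotient of S'
    and the same subobject of S'', and there are a_{S'/S} of them.  If S_2 is nonzero,
    a morphism L' -> S'' is epi as soon as its composite with S'' -> S_2 is, so
    a_{S''} = a_{S_2} |Hom(L', S_1)|. *)

From Corelib Require Import RelationClasses.
From HB Require Import structures.
From mathcomp Require Import all_boot all_order all_algebra.
From mathcomp Require Import generic_quotient ring_quotient zify ring.
From mathcomp Require Import boolp classical_sets filter.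
From mathcomp Require Import ssrcomplements mpoly.
Require Import Defs.

Set Implicit Arguments.
Unset Strict Implicit.
Unset Printing Implicit Defensive.

Import Order.TTheory GRing.Theory Num.Theory.
Import Quotient.Exports.

Local Open Scope classical_set_scope.
Local Open Scope ring_scope.
Local Open Scope quotient_scope.

(** * Noetherianity of the coordinate algebra *)

Section Span.
Variables (R : pzRingType) (M : lmodType R).
Implicit Types (U V : set M) (s : seq M).

Definition submodule U : Prop :=
  U 0 /\ forall a m n, U m -> U n -> U (a *: m + n).

Definition span s : set M :=
  [set m | forall U, submodule U -> (forall e, e \in s -> U e) -> U m].

Definition fingen U : Prop :=
  exists s, (forall e, e \in s -> U e) /\ U `<=` span s.

Lemma submoduleD U m n : submodule U -> U m -> U n -> U (m + n).
Proof. by move=> [_ UD] Um Un; rewrite -[m]scale1r; apply: UD. Qed.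

Lemma submoduleZ U a m : submodule U -> U m -> U (a *: m).
Proof. by move=> [U0 UD] Um; rewrite -[_ *: _]addr0; apply: UD. Qed.

Lemma submoduleB U m n : submodule U -> U m -> U n -> U (m - n).
Proof.
by move=> hU Um Un; rewrite -scaleN1r; apply: submoduleD => //; apply: submoduleZ.
Qed.

Lemma submodule_sum U (I : Type) (r : seq I) (P : pred I) (f : I -> M) :
  submodule U -> (forall i, P i -> U (f i)) -> U (\sum_(i <- r | P i) f i).
Proof.
by move=> hU Uf; apply: big_ind => //; [case: hU|move=> ? ?; apply: submoduleD].
Qed.

Lemma submoduleI U V : submodule U -> submodule V -> submodule (U `&` V).
Proof.
move=> [U0 UD] [V0 VD]; split=> // a m n [Um Vm] [Un Vn].
by split; [apply: UD|apply: VD].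
Qed.

Lemma submodule_span s : submodule (span s).
Proof.
split=> [U [] //|a m n sm sn U hU Us]; have [_ UD] := hU.
by apply: UD; [apply: sm|apply: sn].
Qed.

Lemma mem_span s e : e \in s -> span s e.
Proof. by move=> es U _; apply. Qed.

Lemma span_cons_sub e s m : span (e :: s) m -> exists a, span s (m - a *: e).
Proof.
have hs := submodule_span s; have [s0 sD] := hs.
move=> sm; apply: (sm [set m | exists a, span s (m - a *: e)]).
  split=> [|a m1 m2 [b hb] [c hc]]; first by exists 0; rewrite scale0r subr0.
  exists (a * b + c).
  by rewrite scalerDl -scalerA opprD addrACA -scalerBr; apply: sD.
move=> f; rewrite inE => /orP[/eqP->|fs].
  by exists 1; rewrite scale1r subrr.
by exists 0; rewrite scale0r subr0; apply: mem_span.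
Qed.

Lemma span_coef s m : span s m ->
  exists c : 'I_(size s) -> R, m = \sum_i c i *: s`_i.
Proof.
move=> sm; apply: (sm [set m | exists c : 'I_(size s) -> R, m = \sum_i c i *: s`_i]).
  split=> [|a m1 m2 [b ->] [c ->]].
    by exists (fun=> 0); rewrite big1 // => i _; rewrite scale0r.
  exists (fun i => a * b i + c i); rewrite scaler_sumr -big_split.
  by apply: eq_bigr => i _; rewrite scalerDl scalerA.
move=> e es; have ei : (index e s < size s)%N by rewrite index_mem.
exists (fun i => (i == Ordinal ei)%:R).
rewrite (bigD1 (Ordinal ei)) //= eqxx scale1r nth_index // big1 ?addr0 //.
by move=> i /negbTE ->; rewrite scale0r.
Qed.

End Span.

Definition noetherian (R : pzRingType) : Prop :=
  forall J : set R^o, submodule J -> fingen J.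

Lemma submodule_coef (R : pzRingType) (M : lmodType R) (e : M) (U V : set M) :
  submodule U -> submodule V ->
  submodule ([set a | exists2 u, U u & V (u - a *: e)] : set R^o).
Proof.
move=> [U0 UD] [V0 VD]; split=> [|a b c [u Uu Vu] [v Uv Vv]].
  by exists 0; rewrite ?scale0r ?subr0.
exists (a *: u + v); first exact: UD.
by rewrite scalerDl -scalerA opprD addrACA -scalerBr; apply: VD.
Qed.

Lemma fingen_by_coef (R : pzRingType) (M : lmodType R) (e : M) (U V : set M) :
  noetherian R -> submodule U -> submodule V -> fingen (U `&` V) ->
  (forall u, U u -> exists a, V (u - a *: e)) -> fingen U.
Proof.
move=> noethR hU hV [s1 [s1P UV_s1]] UVe.
have [s2 [s2P coefs_s2]] := noethR _ (submodule_coef e hU hV).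
have /choice[w wP] : forall a : R, exists u, a \in s2 -> U u /\ V (u - a *: e).
  move=> a; have [/s2P[u Uu Vu]|_] := boolP (a \in s2); first by exists u.
  by exists 0.
pose s := s1 ++ map w s2; have hs := submodule_span s.
exists s; split=> [f|u Uu].
  by rewrite mem_cat => /orP[/s1P[]//|/mapP[a /wP[Uw _] ->]].
have [a Vua] := UVe u Uu.
have span_a : span s2 (a : R^o) by apply: coefs_s2; exists u.
have [b bs2|m [sm Um] Vma] := span_a _ (submodule_coef e (submoduleI hs hU) hV).
  have [Uw Vw] := wP b bs2; exists (w b) => //; split=> //.
  by apply: mem_span; rewrite mem_cat map_f ?orbT.
rewrite -(subrK m u); apply: (submoduleD hs) => //.
have span_um : span s1 (u - m).
  apply: UV_s1; split; first exact: submoduleB.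
  by rewrite -[u](subrK (a *: e)) -addrA -[_ - m]opprB; exact: submoduleB.
by move=> W hW Ws; apply: span_um => // f fs; apply: Ws; rewrite mem_cat fs.
Qed.

Lemma fingen_sub_span (R : pzRingType) (M : lmodType R) (s : seq M) (U : set M) :
  noetherian R -> submodule U -> U `<=` span s -> fingen U.
Proof.
move=> noethR; elim: s U => [|e s ih] U hU Us.
  by exists [::]; split.
have hs := submodule_span s.
apply: (fingen_by_coef noethR hU hs) => [|u /Us]; last exact: span_cons_sub.
by apply: ih => [|u []//]; apply: submoduleI.
Qed.

Lemma noetherian_surj (R S : pzRingType) (f : {rmorphism R -> S}) :
  (forall b, exists a, b = f a) -> noetherian R -> noetherian S.
Proof.
move=> f_surj noethR J hJ; have [J0 JD] := hJ.
have [|s [sJ sP]] := noethR [set a | J (f a)].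
  split=> [|a b c Jb Jc]; first by rewrite /= rmorph0.
  by rewrite /= rmorphD rmorphM; apply: JD.
exists (map f s); split=> [_ /mapP[a /sJ Ja ->]//|b Jb].
have [a bE] := f_surj b; rewrite bE in Jb *; move: (sP a Jb) => sa W [W0 WD] Ws.
apply: (sa [set a | W (f a)]) => [|c cs]; last by apply: Ws; apply: map_f.
split=> [|c d e Wd We]; first by rewrite /= rmorph0.
by rewrite /= rmorphD rmorphM; apply: WD.
Qed.

Lemma dickson_seq (n : nat) (S : seq nat -> Prop) :
  exists B : seq (seq nat),
    (forall b, b \in B -> S b /\ size b = n) /\
    forall s, S s -> size s = n -> exists2 b, b \in B & all2 leq b s.
Proof.
elim: n S => [|n ih] S.
  have [S0|S0] := pselect (S [::]).
    exists [:: [::]]; split=> [b|[]//]; first by rewrite inE => /eqP ->.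
    by exists [::]; rewrite ?mem_head.
  by exists [::]; split=> [b|[]//]; rewrite in_nil.
have [B [BS Bdom]] := ih (fun t => exists k, S (k :: t)).
have /choice[h hP] : forall b, exists k, b \in B -> S (k :: b).
  move=> b; have [/BS[[k hk] _]|nb] := boolP (b \in B); first by exists k.
  by exists 0%N.
pose K := (\max_(b <- B) h b)%N.
have /choice[C CP] := fun k => ih (fun t => S (k :: t)).
exists ([seq h b :: b | b <- B] ++ flatten [seq [seq k :: b | b <- C k] | k <- iota 0 K]).
split.
  move=> b; rewrite mem_cat => /orP[/mapP[b' hb ->]|/flattenP[l /mapP[k _ ->]]].
    by have [_ sz] := BS _ hb; split; [exact: hP|rewrite /= sz].
  by move=> /mapP[b' /(proj1 (CP k))[hb sz] ->]; rewrite /= sz.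
move=> [//|k t] St [sz]; have [kK|kK] := ltnP k K.
  have [b hb bt] := (proj2 (CP k)) t St sz.
  exists (k :: b); last by rewrite /= leqnn.
  rewrite mem_cat; apply/orP; right; apply/flattenP.
  exists [seq k :: b | b <- C k]; last by apply/mapP; exists b.
  by apply/mapP; exists k; rewrite ?mem_iota.
have [b hb bt] := Bdom t (ex_intro _ k St) sz.
exists (h b :: b); first by rewrite mem_cat; apply/orP; left; apply/mapP; exists b.
by rewrite /= bt andbT; apply: leq_trans kK; apply: (@leq_bigmax_seq _ B xpredT h).
Qed.

Lemma dickson (n : nat) (S : 'X_{1..n} -> Prop) :
  exists B : seq 'X_{1..n}, (forall b, b \in B -> S b) /\
    forall m, S m -> exists2 b, b \in B & (b <= m)%MM.
Proof.
have [B [BS Bdom]] := dickson_seq n (fun s => exists2 m : 'X_{1..n}, S m & s = m).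
have /choice[h hP] : forall b, exists m : 'X_{1..n}, b \in B -> S m /\ b = m.
  move=> b; have [/BS[[m Sm ->] _]|_] := boolP (b \in B); first by exists m.
  by exists 0%MM.
exists (map h B); split=> [_ /mapP[b /hP[Sb _] ->]//|m Sm].
have [|b bB] := Bdom m (ex_intro2 _ _ m Sm erefl); first exact: size_tuple.
move=> le_bm; exists (h b); first exact: map_f.
apply/mnm_lepP => j; rewrite !(mnm_nth 0%N).
have [_ bE] := hP b bB; move: le_bm; rewrite {1}bE all2E => /andP[_] /all_nthP.
move=> /(_ (0, 0)%N j); rewrite size_zip !size_tuple minnn nth_zip ?size_tuple //.
by apply.
Qed.

Lemma mlead_reduce (F : fieldType) (n : nat) (p g : {mpoly F[n]}) :
  p != 0 -> g != 0 -> (mlead g <= mlead p)%MM ->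
  exists q, p - q * g = 0 \/ (mlead (p - q * g) < mlead p)%O.
Proof.
move=> p0 g0 gp; pose m := (mlead p - mlead g)%MM.
pose c := p@_(mlead p) / g@_(mlead g); pose q : {mpoly F[n]} := c *: 'X_[m].
have c0 : c != 0 by rewrite mulf_neq0 ?invr_eq0 ?mleadc_eq0.
have qlead : mlead q = m by rewrite mleadZ // mleadXm.
have q0 : q != 0 by rewrite -mleadc_eq0 qlead mcoeffZ mcoeffX eqxx mulr1.
have qg_lead : mlead (q * g) = mlead p by rewrite mleadM // qlead submK.
exists q; have [->|pq0] := eqVneq (p - q * g) 0; [by left|right].
rewrite lt_neqAle; apply/andP; split; last first.
  by apply: le_trans (mleadB_le _ _) _; rewrite qg_lead leUx lexx.
apply: contra pq0 => /eqP lead_eq; rewrite -mleadc_eq0 lead_eq mcoeffB.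
rewrite -{2}qg_lead mleadM // mleadcM qlead mcoeffZ mcoeffX eqxx mulr1.
by rewrite /c mulfVK ?mleadc_eq0 // subrr.
Qed.

(* Elements whose leading monomials dominate all the leading monomials of the
   ideal generate it, by division. *)
Lemma mpoly_noetherian (F : fieldType) (n : nat) : noetherian {mpoly F[n]}.
Proof.
move=> U hU.
have [B [BU Bdom]] := dickson (fun m => exists p, [/\ U p, p != 0 & m = mlead p]).
have /choice[g gP] : forall b, exists p, b \in B -> [/\ U p, p != 0 & b = mlead p].
  move=> b; have [/BU[p hp]|_] := boolP (b \in B); first by exists p.
  by exists 0.
exists (map g B); split=> [_ /mapP[b /gP[Ugb _ _] ->]//|].
have hspan := submodule_span (map g B : seq {mpoly F[n]}^o).
move=> p; move: p; apply: mleadrect => p ih Up.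
have [->|p0] := eqVneq p 0; first by case: hspan.
have [|b bB le_bp] := Bdom (mlead p); first by exists p.
have [Ug g0 bE] := gP b bB.
have [|q pq] := mlead_reduce p0 g0; first by rewrite -bE.
have span_qg : span (map g B : seq {mpoly F[n]}^o) (q *: (g b : {mpoly F[n]}^o)).
  by apply: (submoduleZ _ hspan); apply: mem_span; apply: map_f.
rewrite -(subrK (q * g b) p); apply: (submoduleD hspan) => //.
case: pq => [->|lt_pq]; first by case: hspan.
by apply: ih => //; exact: (submoduleB hU Up (submoduleZ q hU Ug)).
Qed.

Lemma Aalg_noetherian (F : fieldType) (X : wpl F) : noetherian (Aalg X).
Proof.
apply: (@noetherian_surj _ _ (\pi_(Aalg X))); first exact: Apr_lift.
exact: mpoly_noetherian.
Qed.

Lemma gsub_submodule (F : fieldType) (X : wpl F) (M : gmod X) (U : set M) :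
  gsub U -> submodule U.
Proof. by case. Qed.

Lemma gsub_fingen (F : fieldType) (X : wpl F) (M : gmod X) (U : set M) :
  gsub U -> fingen U.
Proof.
move=> gU; have [n [e eP]] := gmod_fg M.
apply: (@fingen_sub_span _ M [seq e i | i <- enum 'I_n]).
- exact: Aalg_noetherian.
- exact: gsub_submodule.
have hspan := submodule_span [seq e i | i <- enum 'I_n].
move=> m _; have [c ->] := eP m.
apply: (submodule_sum _ hspan) => i _; apply: (submoduleZ _ hspan).
by apply: mem_span; apply: map_f; rewrite mem_enum.
Qed.

(** * Degrees *)

Section Degree.
Variables (F : fieldType) (X : wpl F).
Local Notation t := (wt_n X).+2.
Local Notation L := (Lgrp X).

(* [ldeg] is normalised so that the canonical element c has degree [wt_prod]. *)
Definition wt_prod : nat := (\prod_i wt X i)%N.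
Definition gen_deg (i : 'I_t) : nat := wt_prod %/ wt X i.

Lemma gen_deg_wt i : (gen_deg i * wt X i)%N = wt_prod.
Proof. by rewrite divnK // /wt_prod (bigD1 i) //=; apply: dvdn_mulr. Qed.

Lemma wt_prod_gt0 : (0 < wt_prod)%N.
Proof. by apply: prodn_gt0 => i; apply: wt_gt0. Qed.

Lemma gen_deg_gt0 i : (0 < gen_deg i)%N.
Proof. by have := wt_prod_gt0; rewrite -(gen_deg_wt i) muln_gt0 => /andP[]. Qed.

Definition vdeg (v : 'rV[int]_t) : int := \sum_i v 0 i * (gen_deg i)%:Z.

Lemma vdegB : {morph vdeg : u v / u - v}.
Proof.
move=> u v; rewrite /vdeg -sumrB; apply: eq_bigr => i _.
by rewrite !mxE mulrBl.
Qed.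

HB.instance Definition _ := GRing.isZmodMorphism.Build _ _ vdeg vdegB.

Lemma vdeg_delta i : vdeg (delta_mx 0 i) = (gen_deg i)%:Z.
Proof.
rewrite /vdeg (bigD1 i) //= mxE !eqxx mul1r big1 ?addr0 // => j /negbTE ji.
by rewrite mxE ji andbF mul0r.
Qed.

Lemma vdeg_rel v : v \in @Lrel F X -> vdeg v = 0.
Proof.
move=> /asboolP[c ->]; rewrite raddf_sum big1 // => i _.
rewrite raddf_sum big1 // => j _ /=.
rewrite raddfMz raddfB !raddfMn /= !vdeg_delta.
rewrite -[_ *+ wt X i]mulr_natr -[_ *+ wt X j]mulr_natr !natz.
by rewrite mulNr -!PoszM !gen_deg_wt subrr mul0rz.
Qed.

Definition ldeg (x : L) : int := vdeg (repr x).

Lemma ldeg_pi v : ldeg (\pi_(Lgrp X) v) = vdeg v.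
Proof.
apply/eqP; rewrite -subr_eq0 -raddfB; apply/eqP/vdeg_rel.
by rewrite Quotient.idealrBE reprK.
Qed.

Lemma ldegB : {morph ldeg : x y / x - y}.
Proof.
move=> x y; rewrite -[x]reprK -[y]reprK -(raddfB (\pi_(Lgrp X))).
by rewrite !ldeg_pi raddfB.
Qed.

HB.instance Definition _ := GRing.isZmodMorphism.Build _ _ ldeg ldegB.

Lemma ldeg_gen i : ldeg (Lgen i) = (gen_deg i)%:Z.
Proof. by rewrite /Lgen ldeg_pi vdeg_delta. Qed.

Lemma ldeg_gen_gt0 i : 0 < ldeg (Lgen i).
Proof. by rewrite ldeg_gen ltz_nat gen_deg_gt0. Qed.

Lemma ldeg_mdegL m : ldeg (@mdegL F X m) = (\sum_i m i * gen_deg i)%N%:Z.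
Proof.
rewrite /mdegL raddf_sum /= (big_morph Posz PoszD (erefl _)).
by apply: eq_bigr => i _; rewrite raddfMn /= ldeg_gen -mulr_natr mulnC PoszM natz.
Qed.

(* Objects and morphisms of [coh X] only depend on the modules in large degree,
   so every statement about them is tested along this filter. *)
Definition large_degree : set_system L :=
  filter_from [set: int] (fun d => [set x | d <= ldeg x]).

Global Instance large_degree_filter : Filter large_degree.
Proof.
apply: filter_fromT_filter; first by exists 0.
by move=> d e; exists (Num.max d e) => x; rewrite /= ge_max => /andP[].
Qed.

Lemma large_degreeP (P : L -> Prop) :
  (\forall x \near large_degree, P x) <-> exists d, forall x, d <= ldeg x -> P x.
Proof. by split=> [[d _ dP]|[d dP]]; exists d. Qed.

Lemma near_ldeg_ge d : \forall x \near large_degree, d <= ldeg x.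
Proof. by exists d. Qed.

Lemma near_shift (P : L -> Prop) y : (\forall x \near large_degree, P x) ->
  \forall x \near large_degree, P (x + y).
Proof.
move=> /large_degreeP[d dP]; apply/large_degreeP; exists (d - ldeg y) => x dx.
by apply: dP; rewrite raddfD /=; lia.
Qed.

Lemma near_mulrn (P : L -> Prop) x y : 0 < ldeg y ->
  (\forall z \near large_degree, P z) -> \forall n \near \oo, P (x + y *+ n).
Proof.
move=> y_gt0 /large_degreeP[d dP]; exists `|d - ldeg x|%N => // n /= le_n.
apply: dP; rewrite raddfD raddfMn /= -mulr_natr natz.
have : n%:Z <= ldeg y * n%:Z by rewrite ler_peMl //; lia.
by lia.
Qed.

Lemma near_forall (n : nat) (P : 'I_n -> L -> Prop) :
  (forall i, \forall x \near large_degree, P i x) ->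
  \forall x \near large_degree, forall i, P i x.
Proof.
move=> PP; have /choice[d dP] := fun i => proj1 (large_degreeP _) (PP i).
exists (\sum_i `|d i|) => // x dx i; apply: dP.
apply: le_trans dx; rewrite (bigD1 i) //=; apply: le_trans (ler_norm _) _.
by rewrite lerDl sumr_ge0.
Qed.

Lemma not_near_ex (P : L -> Prop) d : ~ (\forall x \near large_degree, P x) ->
  exists2 x, d <= ldeg x & ~ P x.
Proof.
move=> nP; apply: contrapT => no; apply: nP; apply/large_degreeP; exists d => x dx.
by apply: contrapT => nPx; apply: no; exists x.
Qed.

End Degree.

Arguments wt_prod {F} X.
Arguments gen_deg {F} X i.
Arguments large_degree {F} X.

(** * Homogeneous elements *)

Section HomogeneousScalars.
Variables (F : fieldType) (X : wpl F).
Local Notation t := (wt_n X).+2.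
Local Notation A := (Aalg X).
Local Notation L := (Lgrp X).

Definition Avar (i : 'I_t) : A := \pi_(Aalg X) 'X_i.
Definition Amon (m : 'X_{1..t}) : A := \pi_(Aalg X) 'X_[m].
Definition Aconst (c : F) : A := \pi_(Aalg X) c%:MP.

HB.instance Definition _ := GRing.RMorphism.copy Aconst
  ((\pi_(Aalg X) : {rmorphism {mpoly F[t]} -> A}) \o @mpolyC t F).

Lemma AhomogP (y : L) (a : A) : Ahomog y a <-> Apr y a = a.
Proof.
split=> [[p hp ->]|<-].
  rewrite AprE; congr (\pi_(Aalg X) _); apply/mpolyP => m; rewrite hpartE.
  case: eqP => // ne; apply/esym/eqP; rewrite mcoeff_eq0; apply/negP => /hp.
  exact: ne.
have [p ->] := Apr_lift a; rewrite AprE; exists (hpart y p) => // m.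
by rewrite mcoeff_msupp hpartE; case: ifP => [/eqP//|_]; rewrite eqxx.
Qed.

Lemma Ahomog_Apr y (a : A) : Ahomog y (Apr y a).
Proof. by apply/AhomogP; rewrite Apr_idem eqxx. Qed.

Lemma Apr0 (y : L) : Apr y (0 : A) = 0.
Proof. exact: (@gpr0 _ _ (Amod X)). Qed.

Lemma AprD (y : L) : {morph @Apr F X y : a b / a + b}.
Proof. exact: (@gprD _ _ (Amod X)). Qed.

Lemma Ahomog0 y : Ahomog y (0 : A).
Proof. by apply/AhomogP; apply: Apr0. Qed.

Lemma AhomogB y (a b : A) : Ahomog y a -> Ahomog y b -> Ahomog y (a - b).
Proof. by move=> /AhomogP ha /AhomogP hb; apply/AhomogP; rewrite AprB ha hb. Qed.

Lemma AhomogD y (a b : A) : Ahomog y a -> Ahomog y b -> Ahomog y (a + b).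
Proof. by move=> /AhomogP ha /AhomogP hb; apply/AhomogP; rewrite AprD ha hb. Qed.

Lemma AhomogM y z (a b : A) : Ahomog y a -> Ahomog z b -> Ahomog (y + z) (a * b).
Proof.
move=> ha /AhomogP hb; apply/AhomogP.
by rewrite addrC -[a * b]/(a *: (b : A^o)) Apr_act // hb.
Qed.

Lemma mdegL1 i : mdegL U_(i) = Lgen i :> L.
Proof.
rewrite /mdegL (bigD1 i) //= mnm1E eqxx mulr1n big1 ?addr0 // => j ji.
by rewrite mnm1E eq_sym (negbTE ji) mulr0n.
Qed.

Lemma mdegL0 : mdegL 0%MM = 0 :> L.
Proof. by rewrite /mdegL big1 // => i _; rewrite mnm0E mulr0n. Qed.

Lemma mdegLn (m : 'X_{1..t}) n : mdegL (m *+ n)%MM = mdegL m *+ n :> L.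
Proof.
by rewrite /mdegL -sumrMnl; apply: eq_bigr => i _; rewrite mulmnE mulrnA.
Qed.

Lemma Ahomog_mon m : Ahomog (mdegL m) (Amon m).
Proof. by exists 'X_[m] => // k; rewrite msuppX inE => /eqP ->. Qed.

Lemma Ahomog_var i : Ahomog (Lgen i) (Avar i).
Proof. by rewrite -mdegL1; apply: Ahomog_mon. Qed.

Lemma Ahomog_const c : Ahomog 0 (Aconst c).
Proof.
exists c%:MP => // m; rewrite msuppC; case: ifP => // _.
by rewrite inE => /eqP ->; apply: mdegL0.
Qed.

Lemma AhomogZ y c (a : A) : Ahomog y a -> Ahomog y (Aconst c * a).
Proof. by move=> ha; rewrite -[y]add0r; apply: AhomogM => //; apply: Ahomog_const. Qed.

Lemma Ahomog1 : Ahomog 0 (1 : A).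
Proof. by rewrite -(rmorph1 Aconst); apply: Ahomog_const. Qed.

Lemma AhomogX y (a : A) n : Ahomog y a -> Ahomog (y *+ n) (a ^+ n).
Proof.
move=> ha; elim: n => [|n ih]; first exact: Ahomog1.
by rewrite exprS mulrS; apply: AhomogM.
Qed.

Lemma Ahomog_varX i n : Ahomog (Lgen i *+ n) (Avar i ^+ n).
Proof. exact/AhomogX/Ahomog_var. Qed.

Lemma Ahomog_sum y (I : Type) (r : seq I) (f : I -> A) :
  (forall i, Ahomog y (f i)) -> Ahomog y (\sum_(i <- r) f i).
Proof.
by move=> hf; elim/big_ind: _ => //; [apply: Ahomog0|apply: AhomogD].
Qed.

Lemma AmonD m n : Amon (m + n)%MM = Amon m * Amon n.
Proof. by rewrite /Amon mpolyXD rmorphM. Qed.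

Lemma Amon0 : Amon 0%MM = 1. Proof. by rewrite /Amon mpolyX0 rmorph1. Qed.

Lemma Amon_varX i n : Amon (U_(i) *+ n)%MM = Avar i ^+ n.
Proof. by rewrite /Amon -mpolyXn rmorphXn. Qed.

Lemma AmonE m : Amon m = \prod_i Avar i ^+ m i.
Proof.
by rewrite /Amon mpolyXE_id rmorph_prod; apply: eq_bigr => i _; rewrite rmorphXn.
Qed.

Lemma Ahomog_ind y (P : A -> Prop) : P 0 ->
  (forall a b, P a -> P b -> P (a + b)) ->
  (forall c m, mdegL m = y -> P (Aconst c * Amon m)) ->
  forall a, Ahomog y a -> P a.
Proof.
move=> P0 PD Pm a [p hp ->]; rewrite [p]mpolyE rmorph_sum /= big_seq_cond.
elim/big_rec: _ => // m b; rewrite andbT => mp Pb; apply: PD => //.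
by rewrite -mul_mpolyC rmorphM; apply: Pm; apply: hp.
Qed.

Lemma Ahomog_neg y (a : A) : ldeg y < 0 -> Ahomog y a -> a = 0.
Proof.
move=> y_lt0; move: a; apply: Ahomog_ind => // [a b -> ->|c m mE].
  by rewrite addr0.
by move: y_lt0; rewrite -mE ldeg_mdegL.
Qed.

Lemma Apr_ind (P : A -> Prop) : P 0 ->
  (forall a b, P a -> P b -> P (a + b)) ->
  (forall y a, Ahomog y a -> P a) -> forall a, P a.
Proof.
move=> P0 PD Ph a; have [s [_ _ ->]] := Apr_sum a.
by elim/big_rec: _ => // x b _ Pb; apply: PD => //; apply: Ph (Ahomog_Apr x _).
Qed.

End HomogeneousScalars.

Section HomogeneousElements.
Variables (F : fieldType) (X : wpl F) (M : gmod X).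
Local Notation A := (Aalg X).
Local Notation L := (Lgrp X).
Implicit Types (m n : M) (x y : L) (a : A) (U V : set M).

HB.instance Definition _ (x : L) :=
  GRing.isZmodMorphism.Build M M (@gpr F X M x) (@gprB F X M x).

Definition of_deg (x : L) (m : M) : Prop := gpr x m = m.

Lemma of_deg_gpr x m : of_deg x (gpr x m).
Proof. by rewrite /of_deg gpr_idem eqxx. Qed.

Lemma of_deg0 x : of_deg x 0. Proof. exact: gpr0. Qed.

Lemma of_degB x m n : of_deg x m -> of_deg x n -> of_deg x (m - n).
Proof. by move=> hm hn; rewrite /of_deg raddfB /= hm hn. Qed.

Lemma of_degN x m : of_deg x m -> of_deg x (- m).
Proof. by move=> hm; rewrite /of_deg raddfN /= hm. Qed.

Lemma of_degD x m n : of_deg x m -> of_deg x n -> of_deg x (m + n).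
Proof. by move=> hm hn; rewrite /of_deg raddfD /= hm hn. Qed.

Lemma of_degZ x y a m : Ahomog y a -> of_deg x m -> of_deg (x + y) (a *: m).
Proof. by move=> ha hm; rewrite /of_deg gpr_act // hm. Qed.

Lemma of_degZX x y a k m : Ahomog y a -> of_deg x m -> of_deg (x + y *+ k) (a ^+ k *: m).
Proof. by move=> ha; apply: of_degZ; apply: AhomogX. Qed.

Lemma gpr_of_deg x y m : of_deg y m -> gpr x m = if x == y then m else 0.
Proof. by move=> hm; rewrite -hm gpr_idem. Qed.

Lemma gpr_act_sub x y a m : Ahomog y a -> gpr x (a *: m) = a *: gpr (x - y) m.
Proof. by move=> ha; rewrite -(gpr_act _ _ ha) subrK. Qed.

Lemma gpr_ext m n : (forall x, gpr x m = gpr x n) -> m = n.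
Proof.
move=> eq_mn; apply/eqP; rewrite -subr_eq0; have [s [_ _ ->]] := gpr_sum (m - n).
by rewrite big1 // => x _; rewrite raddfB /= eq_mn subrr.
Qed.

Lemma gpr_scale d m x a : of_deg d m -> gpr x (a *: m) = Apr (x - d) a *: m.
Proof.
move=> hm; move: a; apply: Apr_ind => [|a b Ea Eb|z a ha].
- by rewrite scale0r gpr0 Apr0 scale0r.
- by rewrite scalerDl raddfD /= Ea Eb -scalerDl AprD.
rewrite (gpr_of_deg x (of_degZ ha hm)) addrC -subr_eq; have /AhomogP aE := ha.
by rewrite -{2}aE Apr_idem aE; case: ifP => // _; rewrite scale0r.
Qed.

Lemma gsub_gpr U m : gsub U -> (forall x, U (gpr x m)) -> U m.
Proof.
move=> gU Um; have [s [_ _ ->]] := gpr_sum m.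
by apply: (submodule_sum _ (gsub_submodule gU)).
Qed.

Lemma gsubZ U a m : gsub U -> U m -> U (a *: m).
Proof. by move=> /gsub_submodule; apply: submoduleZ. Qed.

Lemma gsub_im y a : Ahomog y a -> gsub [set m | exists n, m = a *: n].
Proof.
move=> ha; split; first by exists 0; rewrite scaler0.
  move=> b m n [m' ->] [n' ->]; exists (b *: m' + n').
  by rewrite scalerDr !scalerA mulrC.
by move=> x m [n ->]; exists (gpr (x - y) n); rewrite (gpr_act_sub _ _ ha).
Qed.

Lemma gsub_colon U y a : gsub U -> Ahomog y a -> gsub [set m | U (a *: m)].
Proof.
move=> [U0 UD Ug] ha; split; first by rewrite /= scaler0.
  move=> b m n /= Um Un; rewrite scalerDr scalerA mulrC -scalerA.
  exact: UD.
by move=> x m /= Um; rewrite -(gpr_act _ _ ha); apply: Ug.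
Qed.

Lemma gsub_cyclic d m : of_deg d m -> gsub [set n | exists a, n = a *: m].
Proof.
move=> hm; split; first by exists 0; rewrite scale0r.
  by move=> b n1 n2 [a ->] [c ->]; exists (b * a + c); rewrite scalerDl scalerA.
by move=> x n [a ->]; exists (Apr (x - d) a); rewrite (gpr_scale _ _ hm).
Qed.

Lemma homogeneous_generators V : gsub V ->
  exists (n : nat) (d : 'I_n -> L) (e : 'I_n -> M),
    (forall j, V (e j) /\ of_deg (d j) (e j)) /\
    forall x v, V v -> of_deg x v -> exists a : 'I_n -> A,
      (forall j, Ahomog (x - d j) (a j)) /\ v = \sum_j a j *: e j.
Proof.
move=> gV; have [_ _ Vg] := gV; have [g [gV' V_span]] := gsub_fingen gV.
have /choice[s sP] := fun m => gpr_sum m.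
pose parts := [seq (x, gpr x e) | e <- g, x <- s e]; pose gens := map snd parts.
have gens_span : V `<=` span gens.
  move=> v /V_span; apply=> [|e eg]; first exact: submodule_span.
  have [_ _ ->] := sP e; rewrite big_seq.
  apply: (submodule_sum _ (submodule_span gens)) => x xs; apply: mem_span.
  by apply/mapP; exists (x, gpr x e) => //; apply/allpairsPdep; exists e, x.
have size_gens : size gens = size parts by rewrite size_map.
pose q (j : 'I_(size gens)) := nth (0, 0) parts j.
have qE (j : 'I_(size gens)) : gens`_j = (q j).2 by rewrite (nth_map (0, 0)) // -size_gens.
have qP j : V (q j).2 /\ of_deg (q j).1 (q j).2.
  have : q j \in parts by rewrite mem_nth // -size_gens.
  move=> /allpairsPdep[e [x [eg _ ->]]] /=; split; last exact: of_deg_gpr.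
  exact/Vg/gV'.
exists (size gens), (fun j => (q j).1), (fun j => (q j).2); split=> // x v Vv hv.
have [c vE] := span_coef (gens_span v Vv).
exists (fun j => Apr (x - (q j).1) (c j)); split=> [j|]; first exact: Ahomog_Apr.
rewrite -{1}hv vE raddf_sum; apply: eq_bigr => j _ /=.
by rewrite qE (gpr_scale _ _ (proj2 (qP j))).
Qed.

End HomogeneousElements.

(** * Finite length and large degree *)

Section FiniteLengthLargeDegree.
Variables (F : fieldType) (X : wpl F).
Local Notation t := (wt_n X).+2.
Local Notation A := (Aalg X).
Local Notation L := (Lgrp X).
Local Notation large := (large_degree X).

Lemma near_mdegL_large (K : nat) :
  \forall x \near large, forall m : 'X_{1..t}, mdegL m = x -> exists i, (K <= m i)%N.
Proof.
exists (\sum_(i < t) K * gen_deg X i)%N%:Z => // x /= dx m mx.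
apply: contrapT => no; have lt_mK i : (m i < K)%N.
  by rewrite ltnNge; apply/negP => le_Km; apply: no; exists i.
move: dx; rewrite -mx ldeg_mdegL lez_nat leqNgt => /negP[].
rewrite (bigD1 ord0) //= [ltnRHS](bigD1 ord0) //= -addSn leq_add //.
  by rewrite ltn_pmul2r ?gen_deg_gt0.
by apply: leq_sum => i _; rewrite leq_pmul2r ?gen_deg_gt0 // ltnW.
Qed.

Lemma Amon_divX (m : 'X_{1..t}) i : exists m', Amon m = Amon m' * Avar i ^+ m i :> A.
Proof.
exists (m - U_(i) *+ m i)%MM; rewrite -Amon_varX -AmonD submK //.
apply/mnm_lepP => j; rewrite mulmnE mnm1E.
by case: eqP => [->|_]; rewrite ?mul1n // mul0n.
Qed.

Lemma fin_len_varX (M : gmod X) (U V : set M) (d : L) (e : M) i :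
  gsub U -> gsub V -> U `<=` V -> fin_len U V -> V e -> of_deg d e ->
  exists k, U (Avar i ^+ k *: e).
Proof.
move=> gU gV UV [n finUV] Ve de; pose pow j := Avar i ^+ (n - j) *: e.
have pow_deg j : of_deg (d + Lgen i *+ (n - j)) (pow j).
  by apply: of_degZX => //; apply: Ahomog_var.
pose chain j := gadd U [set m | exists a, m = a *: pow j].
have [j|j m [u [_ [Uu [a ->] ->]]]|j jn] := finUV chain.
- split=> [||m [u [_ [Uu [a ->] ->]]]].
  + exact: gsubA gU (gsub_cyclic (pow_deg j)).
  + exact: gaddl (gsub_cyclic (pow_deg j)).
  + by apply: gsubD => //; [exact: UV|do 2!apply: gsubZ => //].
- exists u; have [jn|nj] := ltnP j n.
    exists (a * Avar i *: pow j.+1); split=> //; first by exists (a * Avar i).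
    by rewrite /pow -(subnSK jn) exprS !scalerA mulrA.
  have jn : (n - j = n - j.+1)%N by lia.
  by exists (a *: pow j); split=> //; exists a; rewrite /pow jn.
move=> /(_ (pow j.+1))[|u [_ [Uu [a ->] powE]]].
  by apply: gaddr => //; exists 1; rewrite scale1r.
exists (n - j.+1)%N; have [_ _ Ug] := gU.
rewrite -[_ *: e]/(pow j.+1) -(pow_deg j.+1) powE raddfD /=.
rewrite (gpr_scale _ _ (pow_deg j)) (_ : Apr _ a = 0) ?scale0r ?addr0; first exact: Ug.
apply: Ahomog_neg (Ahomog_Apr _ a); rewrite -(subnSK jn) mulrSr.
by rewrite addrA [- (_ + Lgen i)]opprD addrA subrr sub0r raddfN oppr_lt0 ldeg_gen_gt0.
Qed.

Lemma fin_len_near (M : gmod X) (U V : set M) :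
  gsub U -> gsub V -> U `<=` V -> fin_len U V ->
  \forall x \near large, forall m, of_deg x m -> V m -> U m.
Proof.
move=> gU gV UV finUV; have [n [d [e [eP e_gen]]]] := homogeneous_generators gV.
have /choice[k kP] : forall q : 'I_n * 'I_t, exists k, U (Avar q.2 ^+ k *: e q.1).
  by move=> [j i] /=; have [Ve de] := eP j; exact: (fin_len_varX i gU gV UV finUV Ve de).
pose K := (\max_q k q)%N.
have UK j i q : (K <= q)%N -> U (Avar i ^+ q *: e j).
  move=> Kq; have kq : (k (j, i) <= q)%N by apply: leq_trans Kq; apply: leq_bigmax.
  by rewrite -(subnK kq) exprD -scalerA; apply: gsubZ => //; apply: (kP (j, i)).
have gens_U : \forall x \near large, forall j a, Ahomog (x - d j) a -> U (a *: e j).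
  apply: near_forall => j; near=> x; apply: Ahomog_ind.
  - by rewrite scale0r; case: gU.
  - by move=> a b Ua Ub; rewrite scalerDl; apply: gsubD.
  move=> c m mx; have [//|i Ki] := near (near_shift (- d j) (near_mdegL_large K)) x _ m mx.
  have [m' ->] := Amon_divX m i; rewrite mulrA -scalerA.
  by apply: gsubZ => //; apply: UK.
near=> x => m dm Vm; have [a [ha ->]] := e_gen x m Vm dm.
apply: (submodule_sum _ (gsub_submodule gU)) => j _.
exact: (near gens_U x).
Unshelve. all: by end_near. Qed.

End FiniteLengthLargeDegree.

Section LowDegree.
Variables (F : finFieldType) (X : wpl F).
Local Notation t := (wt_n X).+2.
Local Notation A := (Aalg X).
Local Notation large := (large_degree X).

Lemma Ahomog_low_finite (d : int) :
  exists s : seq A, forall y a, ldeg y < d -> Ahomog y a -> a \in s.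
Proof.
pose B := `|d|.+1%N.
exists (codom (fun f : {ffun 'X_{1..t < B} -> F} =>
                 \pi_(Aalg X) (\sum_m f m *: 'X_[m] : {mpoly F[t]}))) => y a yd [p hp ->].
apply/codomP; exists [ffun m : 'X_{1..t < B} => p@_m].
rewrite {1}(@mpolywE _ _ B p).
  by congr (\pi_(Aalg X) _); apply: eq_bigr => m _; rewrite ffunE.
rewrite msizeE; apply/bigmax_leqP_seq => m mp _.
move: yd; rewrite -(hp m mp) ldeg_mdegL /B.
have : (mdeg m <= \sum_i m i * gen_deg X i)%N.
  by rewrite mdegE; apply: leq_sum => i _; rewrite leq_pmulr ?gen_deg_gt0.
by lia.
Qed.

Lemma low_degree_finite (M : gmod X) (d : int) :
  exists s : seq M, forall x m, ldeg x < d -> of_deg x m -> m \in s.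
Proof.
have [n [g [e [_ e_gen]]]] := homogeneous_generators (gsubT M).
have [s sP] := Ahomog_low_finite (d + \sum_j `|ldeg (g j)|).
exists (codom (fun f : {ffun 'I_n -> 'I_(size s)} => \sum_j s`_(f j) *: e j)).
move=> x m xd dm; have [a [ha ->]] := e_gen x m I dm.
have a_s j : (index (a j) s < size s)%N.
  rewrite index_mem; apply: sP (ha j); rewrite raddfB /= (bigD1 j) //=.
  have := ler_norm (- ldeg (g j)); rewrite normrN.
  by set S := (X in _ < d + (_ + X)); have : 0 <= S by [apply: sumr_ge0]; lia.
apply/codomP; exists [ffun j => Ordinal (a_s j)].
by apply: eq_bigr => j _; rewrite ffunE /= nth_index // -index_mem.
Qed.

Lemma ltn_count (T : eqType) (a b : pred T) (s : seq T) x :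
  subpred a b -> x \in s -> ~~ a x -> b x -> (count a s < count b s)%N.
Proof.
move=> ab + /negbTE ax bx; elim: s => //= y s ih; rewrite inE => /orP[/eqP <-|/ih].
  by rewrite ax bx add0n add1n ltnS; apply: sub_count.
have /implyP := ab y; case: (a y); case: (b y) => //= _; lia.
Qed.

Lemma near_fin_len (M : gmod X) (U V : set M) :
  (\forall x \near large, forall m, of_deg x m -> V m -> U m) -> fin_len U V.
Proof.
move=> /large_degreeP[d VU]; have [s low_s] := low_degree_finite M d.
apply: (@rank_fin_len _ _ _ _ _ (size s) (fun W => count (fun m => `[< W m >]) s)).
  by move=> W _; apply: count_size.
move=> W1 W2 [g1 UW1 _] [[_ _ W2g] _ W2V] W12 count_le m W2m.
apply: gsub_gpr => // x; have [dx|xd] := leP d (ldeg x).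
  by apply/UW1/(VU x dx); [apply: of_deg_gpr|apply/W2V/W2g].
apply: contrapT => nW1; move: count_le; rewrite leqNgt => /negP; apply.
apply: (@ltn_count _ _ _ _ (gpr x m)).
- by move=> n /asboolP/W12/asboolP.
- exact: low_s xd (of_deg_gpr x m).
- by apply/negP => /asboolP.
- exact/asboolP/W2g.
Qed.

End LowDegree.

(** * Morphisms as maps in large degree *)

Section Truncation.
Variables (F : finFieldType) (X : wpl F) (M : gmod X).
Implicit Types (m n : M) (d : int).

Definition truncation d : set M := [set m | forall x, ldeg x < d -> gpr x m = 0].

Lemma truncation_of_deg d x m : d <= ldeg x -> of_deg x m -> truncation d m.
Proof.
move=> dx dm z zd; rewrite (gpr_of_deg z dm); case: eqP => // zx.
by move: zd; rewrite zx ltNge dx.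
Qed.

Lemma truncation_ind d (P : M -> Prop) : P 0 ->
  (forall m n, P m -> P n -> P (m + n)) ->
  (forall x m, d <= ldeg x -> of_deg x m -> P m) -> forall m, truncation d m -> P m.
Proof.
move=> P0 PD Ph m trunc_m; have [s [_ _ ->]] := gpr_sum m.
elim/big_rec: _ => // x n _ Pn; apply: PD => //.
have [/trunc_m ->//|dx] := ltP (ldeg x) d.
exact: Ph dx (of_deg_gpr x m).
Qed.

Lemma gsub_truncation d : gsub (truncation d).
Proof.
have closedD m n : truncation d m -> truncation d n -> truncation d (m + n).
  by move=> tm tn x xd; rewrite raddfD /= tm // tn // addr0.
have closed0 : truncation d 0 by move=> x _; rewrite gpr0.
split=> // [a m n tm tn|x m tm z zd]; last first.
  by rewrite gpr_idem; case: eqP => // <-; rewrite tm.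
apply: (closedD _ _) => //; move: m tm; apply: truncation_ind => [|m m' tm tm'|x m dx dm].
- by rewrite scaler0.
- by rewrite scalerDr; apply: (closedD _ _ tm).
move: a; apply: Apr_ind => [|a b ta tb|y a ha]; first by rewrite scale0r.
  by rewrite scalerDl; apply: (closedD _ _ ta).
have [y_lt0|y_ge0] := ltP (ldeg y) 0; first by rewrite (Ahomog_neg y_lt0 ha) scale0r.
by apply: (@truncation_of_deg _ (x + y)); [rewrite raddfD /=; lia|apply: of_degZ].
Qed.

Lemma cofin_truncation d : fin_len (truncation d) setT.
Proof. by apply: near_fin_len; exists d => // x dx m dm _; apply: truncation_of_deg dm. Qed.

End Truncation.

Section TailMaps.
Variables (F : finFieldType) (X : wpl F).
Local Notation L := (Lgrp X).
Local Notation large := (large_degree X).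

Section FixedModules.
Variables M N : gmod X.
Implicit Types (m : M) (n : N).

Definition tail_map (phi : M -> N) : Prop :=
  [/\ {morph phi : m m' / m - m'}, forall x m, phi (gpr x m) = gpr x (phi m)
    & \forall x \near large, forall y a m, Ahomog y a -> of_deg x m ->
        phi (a *: m) = a *: phi m].

Lemma degreewise_map (phi : L -> M -> N) :
  (forall x m, of_deg x (phi x m)) -> (forall x, phi x 0 = 0) ->
  exists psi, forall x m, gpr x (psi m) = phi x (gpr x m).
Proof.
move=> phi_deg phi0; have /choice[s sP] := fun m => gpr_sum m.
exists (fun m => \sum_(z <- s m) phi z (gpr z m)) => x m; have [s_uniq s0 _] := sP m.
rewrite raddf_sum; under eq_bigr => z _ do rewrite /= (gpr_of_deg x (phi_deg z _)).
have [xs|xs] := boolP (x \in s m).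
  rewrite (bigD1_seq x) //= eqxx big1 ?addr0 // => z.
  by rewrite eq_sym => /negbTE ->.
rewrite (s0 x xs) phi0 big1_seq // => z /andP[_ zs].
by case: eqP xs => // ->; rewrite zs.
Qed.

Lemma degreewise_choice (R : L -> M -> N -> Prop) d :
  (forall x m, d <= ldeg x -> of_deg x m -> exists2 n, of_deg x n & R x m n) ->
  exists phi : L -> M -> N, [/\ forall x m, of_deg x (phi x m),
    forall x m, d <= ldeg x -> of_deg x m -> R x m (phi x m)
    & forall x m, ldeg x < d -> phi x m = 0].
Proof.
move=> Rtot; have /choice[phi phiP] : forall q : L * M, exists n, of_deg q.1 n /\
    if d <= ldeg q.1 then of_deg q.1 q.2 -> R q.1 q.2 n else n = 0.
  move=> [x m] /=; have of_deg0 := @of_deg0 _ _ N x.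
  case dx: (d <= ldeg x); last by exists 0.
  have [dm|ndm] := pselect (of_deg x m); last by exists 0.
  by have [n dn r] := Rtot x m dx dm; exists n.
exists (fun x m => phi (x, m)); split=> x m; first by case: (phiP (x, m)).
  by have [_ /=] := phiP (x, m); case: ifP.
by rewrite ltNge => /negbTE xd; have [_ /=] := phiP (x, m); rewrite xd.
Qed.

Lemma tail_map_of_rel (R : L -> M -> N -> Prop) :
  (forall x m n m' n', R x m n -> R x m' n' -> R x (m - m') (n - n')) ->
  (\forall x \near large, forall m, of_deg x m -> exists2 n, of_deg x n & R x m n) ->
  (\forall x \near large, forall n, of_deg x n -> R x 0 n -> n = 0) ->
  (\forall x \near large, forall y a m n, Ahomog y a -> of_deg x m -> of_deg x n ->
     R x m n -> R (x + y) (a *: m) (a *: n)) ->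
  exists phi, tail_map phi /\ \forall x \near large, forall m, of_deg x m -> R x m (phi m).
Proof.
move=> RB tot0 uniq0 lin0.
have [d dP] : exists d, forall x, d <= ldeg x -> [/\
    forall m, of_deg x m -> exists2 n, of_deg x n & R x m n,
    forall n, of_deg x n -> R x 0 n -> n = 0
  & forall y a m n, Ahomog y a -> of_deg x m -> of_deg x n -> R x m n ->
      R (x + y) (a *: m) (a *: n)].
  by apply/large_degreeP; near=> x; split; near: x.
have Runiq x m n n' : d <= ldeg x -> of_deg x n -> of_deg x n' ->
    R x m n -> R x m n' -> n = n'.
  move=> dx dn dn' r r'; apply/eqP; rewrite -subr_eq0; apply/eqP.
  have [_ R0 _] := dP x dx.
  by apply: R0; [apply: of_degB|rewrite -(subrr m); apply: RB].
have [|phi [phi_deg phiR phi_low]] := @degreewise_choice R d.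
  by move=> x m dx; have [Rtot _ _] := dP x dx; apply: Rtot.
have phiB x m m' : of_deg x m -> of_deg x m' -> phi x (m - m') = phi x m - phi x m'.
  move=> dm dm'; have [dx|xd] := leP d (ldeg x); last by rewrite !phi_low // subrr.
  apply: (Runiq x (m - m')) => //; first exact: of_degB.
    by apply: phiR => //; apply: of_degB.
  by apply: RB; apply: phiR.
have phi0 x : phi x 0 = 0.
  by rewrite -[X in phi x X](subrr 0) phiB ?subrr //; apply: of_deg0.
have [psi psiP] := degreewise_map phi_deg phi0.
have psiE x m : of_deg x m -> psi m = phi x m.
  move=> dm; apply: gpr_ext => z; rewrite psiP (gpr_of_deg z dm).
  by rewrite (gpr_of_deg z (phi_deg x m)); case: eqP => [->|].
exists psi; split; last by exists d => // x dx m dm; rewrite (psiE x) //; apply: phiR.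
split=> [m m'|z m|].
- by apply: gpr_ext => x; rewrite raddfB /= !psiP raddfB /= phiB //; apply: of_deg_gpr.
- by apply: gpr_ext => x; rewrite psiP !gpr_idem; case: eqP => [->|]; rewrite ?psiP.
exists d => // x /= dx y a m ha dm; have dam := of_degZ ha dm.
have [y_lt0|y_ge0] := ltP (ldeg y) 0.
  by rewrite (Ahomog_neg y_lt0 ha) !scale0r (psiE 0) //; apply: of_deg0.
have dxy : d <= ldeg (x + y) by rewrite raddfD /=; lia.
rewrite (psiE x m dm) (psiE _ _ dam); have [_ _ RZ] := dP x dx.
apply: (Runiq (x + y) (a *: m)) => //; [exact: of_degZ|exact: phiR|].
by apply: RZ => //; apply: phiR.
Unshelve. all: by end_near. Qed.

Section TailMapTheory.
Variable phi : M -> N.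
Hypothesis tail_phi : tail_map phi.

Lemma tail_map0 : phi 0 = 0.
Proof. by case: tail_phi => phiB _ _; rewrite -(subrr 0) phiB subrr. Qed.

Lemma tail_mapD : {morph phi : m m' / m + m'}.
Proof.
have [phiB _ _] := tail_phi => m m'.
by rewrite -[m' in LHS]opprK phiB -[- m']sub0r phiB tail_map0 sub0r opprK.
Qed.

Lemma tail_map_of_deg x m : of_deg x m -> of_deg x (phi m).
Proof. by move=> dm; rewrite /of_deg; case: tail_phi => _ phi_gpr _; rewrite -phi_gpr dm. Qed.

Lemma tail_map_linear :
  exists d, forall a m, truncation d m -> phi (a *: m) = a *: phi m.
Proof.
have [_ _ /large_degreeP[d phiZ]] := tail_phi; exists d => a m; move: m.
apply: truncation_ind => [|m m' E E'|x m dx dm].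
- by rewrite scaler0 tail_map0 scaler0.
- by rewrite scalerDr !tail_mapD E E' scalerDr.
move: a; apply: Apr_ind => [|a b E E'|y a ha].
- by rewrite !scale0r tail_map0.
- by rewrite !scalerDl tail_mapD E E'.
- exact: (phiZ x dx y).
Qed.

Lemma tail_map_frac : exists d, frac (fun m n => truncation d m /\ n = phi m).
Proof.
have [d phiZ] := tail_map_linear; exists d.
have [_ phi_gpr _] := tail_phi; have [t0 tD tg] := gsub_truncation M d.
split=> [|a m n m' n' [tm ->] [tm' ->]|x m n [tm ->]||].
- by split=> //; rewrite tail_map0.
- by split; [exact: tD|rewrite tail_mapD phiZ].
- by split; [exact: tg|rewrite phi_gpr].
- apply: near_fin_len; exists d => // x dx m dm _; exists (phi m); split=> //.
  exact: truncation_of_deg dm.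
- by apply: near_fin_len; apply: nearW => x m _ [_ ->]; rewrite tail_map0.
Qed.

End TailMapTheory.

Lemma frac_total (R : M -> N -> Prop) : frac R ->
  \forall x \near large, forall m, of_deg x m -> exists2 n, of_deg x n & R m n.
Proof.
move=> fR; have lR := frac_rlin fR; have [_ _ Rg fin_dom _] := fR.
have dom_near := fin_len_near (gsub_rdom lR) (gsubT _) (fun _ _ => I) fin_dom.
near=> x => m dm; have [//|n r] := near dom_near x _ m dm I.
by exists (gpr x n); [exact: of_deg_gpr|rewrite -dm; exact: Rg].
Unshelve. all: by end_near. Qed.

Lemma frac_functional (R : M -> N -> Prop) : frac R ->
  \forall x \near large, forall n, of_deg x n -> R 0 n -> n = 0.
Proof.
move=> fR; have lR := frac_rlin fR; have [R0 _ _ _ fin_ind] := fR.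
by apply: fin_len_near (gsub0 _) (gsub_rind lR) _ fin_ind => n ->.
Qed.

Lemma frac_eq_near (R R' : M -> N -> Prop) : frac_eq R R' ->
  \forall x \near large, forall m n n', of_deg x m -> of_deg x n -> of_deg x n' ->
    R m n -> R' m n' -> n = n'.
Proof.
move=> [M' [N' [[gM fM] [gN fN] _ RR']]].
have M'_near := fin_len_near gM (gsubT _) (fun _ _ => I) fM.
have N'0 : [set 0] `<=` N' by move=> n ->; case: gN.
have N'_near := fin_len_near (gsub0 _) gN N'0 fN.
near=> x => m n n' dm dn dn' r r'; apply/eqP; rewrite -subr_eq0; apply/eqP.
apply: (near N'_near x) => //; first exact: of_degB.
by apply: (RR' m) => //; apply: (near M'_near x).
Unshelve. all: by end_near. Qed.

Lemma cohom_tail_map (f : cohom M N) : exists phi : M -> N, tail_map phi /\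
  \forall x \near large, forall m, of_deg x m -> coh_rep f m (phi m).
Proof.
have fR := coh_repP f; have lR := frac_rlin fR; have [R0 RD _ _ _] := fR.
apply: (tail_map_of_rel (R := fun=> coh_rep f)).
- by move=> _ m n m' n'; apply: rlinB.
- exact: frac_total.
- exact: frac_functional.
- apply: nearW => x y a m n _ _ _ r; have := RD a _ _ _ _ r R0.
  by rewrite !addr0.
Qed.

Definition hfun (f : cohom M N) : M -> N := sval (cid (cohom_tail_map f)).

Lemma hfun_tail_map f : tail_map (hfun f).
Proof. by case: (svalP (cid (cohom_tail_map f))). Qed.

Lemma hfun_of_deg f x m : of_deg x m -> of_deg x (hfun f m).
Proof. by move=> dm; apply: tail_map_of_deg dm; apply: hfun_tail_map. Qed.

Lemma hfun_rep f :
  \forall x \near large, forall m, of_deg x m -> coh_rep f m (hfun f m).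
Proof. by case: (svalP (cid (cohom_tail_map f))). Qed.

Lemma hfun_cls (R : M -> N -> Prop) (fR : frac R) (phi : M -> N) : tail_map phi ->
  (\forall x \near large, forall m, of_deg x m -> R m (phi m)) ->
  \forall x \near large, forall m, of_deg x m -> hfun (cls fR) m = phi m.
Proof.
move=> tail_phi Rphi; have clsR := frac_eq_near (coh_rep_cls fR).
have rep := hfun_rep (cls fR); near=> x => m dm; apply: (near clsR x _ m) => //.
- exact: hfun_of_deg.
- exact: (tail_map_of_deg tail_phi).
- exact: (near rep x).
- exact: (near Rphi x).
Unshelve. all: by end_near. Qed.

Lemma tail_map_hom (phi : M -> N) : tail_map phi ->
  exists f : cohom M N, \forall x \near large, forall m, of_deg x m -> hfun f m = phi m.
Proof.
move=> tail_phi; have [d fr] := tail_map_frac tail_phi; exists (cls fr).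
by apply: hfun_cls => //; exists d => // x dx m dm; split=> //; exact: truncation_of_deg dm.
Qed.

Lemma rlin_truncation (R : M -> N -> Prop) (phi : M -> N) d :
  rlin R -> tail_map phi -> (forall x m, d <= ldeg x -> of_deg x m -> R m (phi m)) ->
  forall m, truncation d m -> R m (phi m).
Proof.
move=> [R0 RD _] tail_phi Rphi; apply: truncation_ind => [|m m' r r'|x m dx dm].
- by rewrite tail_map0.
- by rewrite tail_mapD //; have := RD 1 _ _ _ _ r r'; rewrite !scale1r.
- exact: Rphi dx dm.
Qed.

Lemma hom_ext (f g : cohom M N) :
  (\forall x \near large, forall m, of_deg x m -> hfun f m = hfun g m) -> f = g.
Proof.
move=> fg; rewrite -[f]coh_repK -[g]coh_repK; apply: cls_eq.
have [frep grep] := (hfun_rep f, hfun_rep g).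
have [d dP] : exists d, forall x, d <= ldeg x -> forall m, of_deg x m ->
    [/\ hfun f m = hfun g m, coh_rep f m (hfun f m) & coh_rep g m (hfun g m)].
  apply/large_degreeP; near=> x => m dm.
  by split; [apply: (near fg x)|apply: (near frep x)|apply: (near grep x)].
have [fR gR] := (coh_repP f, coh_repP g); have [lf lg] := (frac_rlin fR, frac_rlin gR).
have f_trunc : forall m, truncation d m -> coh_rep f m (hfun f m).
  by apply: (rlin_truncation lf (hfun_tail_map f)) => x m dx /(dP x dx)[].
have g_trunc : forall m, truncation d m -> coh_rep g m (hfun f m).
  by apply: (rlin_truncation lg (hfun_tail_map f)) => x m dx /(dP x dx)[-> _].
have [[_ _ _ _ f_ind] [_ _ _ _ g_ind]] := (fR, gR).
have [gf gg] := (gsub_rind lf, gsub_rind lg).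
exists (truncation d), (gadd (rind (coh_rep f)) (rind (coh_rep g))); split.
- by split; [apply: gsub_truncation|apply: cofin_truncation].
- by split; [apply: gsubA|apply: fin_len_add].
- by split=> m tm; exists (hfun f m); [apply: f_trunc|apply: g_trunc].
- move=> m n n' tm r r'; exists (n - hfun f m), (hfun f m - n'); split.
  + by rewrite /rind /= -(subrr m); apply: rlinB => //; apply: f_trunc.
  + by rewrite /rind /= -(subrr m); apply: rlinB => //; apply: g_trunc.
  + by rewrite addrA subrK.
Unshelve. all: by end_near. Qed.

End FixedModules.

Lemma hfun_comp (M N P : gmod X) (g : cohom N P) (f : cohom M N) :
  \forall x \near large, forall m, of_deg x m -> hfun (coh_comp g f) m = hfun g (hfun f m).
Proof.
have [frep grep] := (hfun_rep f, hfun_rep g).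
have [[fB f_gpr fZ] [gB g_gpr gZ]] := (hfun_tail_map f, hfun_tail_map g).
apply: (@hfun_cls M P _ _ (fun m => hfun g (hfun f m))); last first.
  near=> x => m dm; exists (hfun f m); first exact: (near frep x).
  by apply: (near grep x) => //; apply: hfun_of_deg.
split=> [m m'|x m|]; first by rewrite fB gB.
  by rewrite f_gpr g_gpr.
by near=> x => y a m ha dm; rewrite (near fZ x _ y) ?(near gZ x _ y) //; apply: hfun_of_deg.
Unshelve. all: by end_near. Qed.

Lemma hfun_id (M : gmod X) :
  \forall x \near large, forall m, of_deg x m -> hfun (cls (frac_id M)) m = m.
Proof.
apply: (@hfun_cls M M _ _ id); last exact: nearW.
by split=> //; apply: nearW.
Qed.

End TailMaps.

(** * Subobjects and quotients *)

Record gsubobj (F : fieldType) (X : wpl F) (M : gmod X) :=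
  GSubObj { gset : set M; gsetP : gsub gset }.

Section Subquotients.
Variables (F : fieldType) (X : wpl F) (M : gmod X) (U : gsubobj M).
Local Notation A := (Aalg X).
Local Notation L := (Lgrp X).

Definition gset_pred : {pred M} := fun m => `[< gset U m >].

Lemma gset_closed : submod_closed gset_pred.
Proof.
have [u0 ul _] := gsetP U; split; first exact/asboolP.
by move=> a m n /asboolP hx /asboolP hy; apply/asboolP; apply: ul.
Qed.

HB.instance Definition _ := GRing.isSubmodClosed.Build A M gset_pred gset_closed.

Record gsub_car := GSubCar { gsub_val : M; _ : gsub_val \in gset_pred }.

HB.instance Definition _ := [isSub for gsub_val].
HB.instance Definition _ := [Choice of gsub_car by <:].
HB.instance Definition _ := [SubChoice_isSubLmodule of gsub_car by <:].

Lemma gsub_pr_subproof x (m : gsub_car) : gpr x (val m) \in gset_pred.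
Proof.
by apply/asboolP; have [_ _ ug] := gsetP U; apply: ug; apply/asboolP; apply: valP m.
Qed.

Definition gsub_pr x (m : gsub_car) : gsub_car := GSubCar (gsub_pr_subproof x m).

Lemma gsub_prB x : {morph gsub_pr x : m n / m - n}.
Proof. by move=> m n; apply: val_inj; rewrite /= !raddfB. Qed.

Lemma gsub_pr_idem x y m : gsub_pr x (gsub_pr y m) = if x == y then gsub_pr y m else 0.
Proof. by apply: val_inj; rewrite /= gpr_idem; case: eqP. Qed.

Lemma gsub_pr_sum m : exists s : seq L,
  [/\ uniq s, forall x, x \notin s -> gsub_pr x m = 0 & m = \sum_(x <- s) gsub_pr x m].
Proof.
have [s [su s0 sE]] := gpr_sum (val m); exists s; split=> //.
  by move=> x /s0 h; apply: val_inj.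
by apply: val_inj; rewrite raddf_sum.
Qed.

Lemma gsub_pr_act x y a m : Ahomog y a ->
  gsub_pr (x + y) (a *: m) = a *: gsub_pr x m.
Proof. by move=> h; apply: val_inj; exact: gpr_act. Qed.

Lemma gsub_fg : exists (n : nat) (e : 'I_n -> gsub_car),
  forall m, exists c : 'I_n -> A, m = \sum_i c i *: e i.
Proof.
have [s [sU U_span]] := gsub_fingen (gsetP U).
have eP (i : 'I_(size s)) : s`_i \in gset_pred by apply/asboolP/sU/mem_nth.
exists (size s), (fun i => GSubCar (eP i)) => m.
have [c cE] := span_coef (U_span (val m) ltac:(by apply/asboolP; exact: valP m)).
by exists c; apply: val_inj; rewrite raddf_sum.
Qed.

Definition gsub_mod : gmod X :=
  GMod gsub_prB gsub_pr_idem gsub_pr_sum gsub_pr_act gsub_fg.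

Definition gquo := Quotient.quot (gset_pred : zmodClosed M).
HB.instance Definition _ := GRing.Zmodule.on gquo.

Definition gquo_scale (a : A) (q : gquo) : gquo := \pi_gquo (a *: repr q).

Lemma gquo_piP (m n : M) : \pi_gquo m = \pi_gquo n <-> gset U (m - n).
Proof.
split=> [/eqP|h]; first by rewrite -Quotient.idealrBE => /asboolP.
by apply/eqP; rewrite -Quotient.idealrBE; apply/asboolP.
Qed.

Lemma gquo_scaleE a m : gquo_scale a (\pi_gquo m) = \pi_gquo (a *: m).
Proof.
apply/gquo_piP; rewrite -scalerBr; apply: gsubZ; first exact: gsetP.
by apply/gquo_piP; rewrite reprK.
Qed.

Lemma gquo_lift (q : gquo) : exists m, q = \pi_gquo m.
Proof. by exists (repr q); rewrite reprK. Qed.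

Lemma gquo_scaleA a b q : gquo_scale a (gquo_scale b q) = gquo_scale (a * b) q.
Proof. by have [m ->] := gquo_lift q; rewrite !gquo_scaleE scalerA. Qed.

Lemma gquo_scale1 : left_id 1 gquo_scale.
Proof. by move=> q; have [m ->] := gquo_lift q; rewrite gquo_scaleE scale1r. Qed.

Lemma gquo_scaleDr : right_distributive gquo_scale +%R.
Proof.
move=> a q r; have [m ->] := gquo_lift q; have [n ->] := gquo_lift r.
by rewrite -[_ + _](raddfD (\pi_gquo)) !gquo_scaleE scalerDr raddfD.
Qed.

Lemma gquo_scaleDl q : {morph gquo_scale^~ q : a b / a + b}.
Proof.
move=> a b; have [m ->] := gquo_lift q; rewrite !gquo_scaleE scalerDl.
by rewrite raddfD.
Qed.

HB.instance Definition _ := GRing.Zmodule_isLmodule.Build A gquo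
  gquo_scaleA gquo_scale1 gquo_scaleDr gquo_scaleDl.

Definition gquo_pr x (q : gquo) : gquo := \pi_gquo (gpr x (repr q)).

Lemma gquo_prE x m : gquo_pr x (\pi_gquo m) = \pi_gquo (gpr x m).
Proof.
apply/gquo_piP; rewrite -gprB; have [_ _ ug] := gsetP U; apply: ug.
by apply/gquo_piP; rewrite reprK.
Qed.

Lemma gquo_prB x : {morph gquo_pr x : m n / m - n}.
Proof.
move=> q r; have [m ->] := gquo_lift q; have [n ->] := gquo_lift r.
by rewrite -[_ - _](raddfB (\pi_gquo)) !gquo_prE gprB raddfB.
Qed.

Lemma gquo_pr_idem x y q : gquo_pr x (gquo_pr y q) = if x == y then gquo_pr y q else 0.
Proof.
have [m ->] := gquo_lift q; rewrite !gquo_prE gpr_idem.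
by case: eqP => // _; rewrite raddf0.
Qed.

Lemma gquo_pr_sum q : exists s : seq L,
  [/\ uniq s, forall x, x \notin s -> gquo_pr x q = 0 & q = \sum_(x <- s) gquo_pr x q].
Proof.
have [m ->] := gquo_lift q; have [s [su s0 sE]] := gpr_sum m; exists s; split=> //.
  by move=> x /s0 h; rewrite gquo_prE h raddf0.
under eq_bigr do rewrite gquo_prE.
by rewrite {1}sE raddf_sum.
Qed.

Lemma gquo_pr_act x y a (q : gquo) : Ahomog y a ->
  gquo_pr (x + y) (a *: q) = a *: gquo_pr x q.
Proof.
have [m ->] := gquo_lift q => h.
by rewrite -[LHS]/(gquo_pr _ (gquo_scale _ _)) -[RHS]/(gquo_scale _ _)
           gquo_scaleE !gquo_prE gquo_scaleE gpr_act.
Qed.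

Lemma gquo_fg : exists (n : nat) (e : 'I_n -> gquo),
  forall m, exists c : 'I_n -> A, m = \sum_i c i *: e i.
Proof.
have [n [e eP]] := gmod_fg M; exists n, (fun i => \pi_gquo (e i)) => q.
have [m ->] := gquo_lift q; have [c ->] := eP m; exists c.
rewrite raddf_sum; apply: eq_bigr => i _; exact: esym (gquo_scaleE _ _).
Qed.

Definition gquo_mod : gmod X :=
  GMod gquo_prB gquo_pr_idem gquo_pr_sum gquo_pr_act gquo_fg.

End Subquotients.

(** * Groups of morphisms *)

Section Isomorphisms.
Variable C : category.
Implicit Types M N P : C.

Lemma is_iso_id M : is_iso (idm M).
Proof. by exists (idm M); rewrite comp_idl. Qed.

Lemma is_iso_comp M N P (g : hom N P) (f : hom M N) :
  is_iso g -> is_iso f -> is_iso (comp g f).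
Proof.
move=> [g' [g'g gg']] [f' [f'f ff']]; exists (comp f' g'); split.
  by rewrite -comp_assoc [comp g' _]comp_assoc g'g comp_idl f'f.
by rewrite -comp_assoc [comp f _]comp_assoc ff' comp_idl gg'.
Qed.

Lemma isomorphic_refl M : isomorphic M M.
Proof. by exists (idm M); apply: is_iso_id. Qed.

Lemma isomorphic_sym M N : isomorphic M N -> isomorphic N M.
Proof. by move=> [f [g [gf fg]]]; exists g, f. Qed.

Lemma isomorphic_trans M N P : isomorphic M N -> isomorphic N P -> isomorphic M P.
Proof. by move=> [f fI] [g gI]; exists (comp g f); apply: is_iso_comp. Qed.

Lemma sub_classP M N P (k : hom M P) (k' : hom N P) :
  sub_class k = sub_class k' <-> exists2 u : hom M N, is_iso u & comp k' u = k.
Proof.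
split=> [kk'|[u uI uE]].
  have : sub_class k' (existT _ N k').
    by exists (idm N); [apply: is_iso_id|rewrite comp_idr].
  by rewrite -kk'.
have [v [vu uv]] := uI; have vI : is_iso v by exists u.
have vE : comp k v = k' by rewrite -uE -comp_assoc uv comp_idr.
apply: funext => -[Z j]; apply: propext; split=> -[w wI /= wE].
  by exists (comp w v); rewrite /= ?comp_assoc ?wE //; apply: is_iso_comp.
by exists (comp w u); rewrite /= ?comp_assoc ?wE //; apply: is_iso_comp.
Qed.

End Isomorphisms.

Section HomGroups.
Variables (F : finFieldType) (X : wpl F).
Local Notation C := (coh X).
Local Notation large := (large_degree X).

Lemma hfunB (M N : gmod X) (f : cohom M N) : {morph hfun f : m m' / m - m'}.
Proof. by case: (hfun_tail_map f). Qed.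

HB.instance Definition _ (M N : gmod X) (f : cohom M N) :=
  GRing.isZmodMorphism.Build M N (hfun f) (hfunB f).

Lemma hfun_gpr (M N : gmod X) (f : cohom M N) x m : hfun f (gpr x m) = gpr x (hfun f m).
Proof. by case: (hfun_tail_map f). Qed.

Lemma hfunZ (M N : gmod X) (f : cohom M N) :
  \forall x \near large, forall y a m, Ahomog y a -> of_deg x m ->
    hfun f (a *: m) = a *: hfun f m.
Proof. by case: (hfun_tail_map f). Qed.

Section ZmoduleStructure.
Variables M N : gmod X.
Implicit Types f g h : cohom M N.

Lemma tail_map_zero : tail_map (fun=> 0 : N) (M := M).
Proof.
split=> [m m'|x m|]; rewrite ?subr0 ?gpr0 //.
by apply: nearW => x y a m _ _; rewrite scaler0.
Qed.

Lemma tail_map_add f g : tail_map (fun m => hfun f m + hfun g m).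
Proof.
split=> [m m'|x m|]; first by rewrite !raddfB opprD addrACA.
  by rewrite !hfun_gpr raddfD.
near=> x => y a m ha dm.
by rewrite (near (hfunZ f) x _ y) // (near (hfunZ g) x _ y) // scalerDr.
Unshelve. all: by end_near. Qed.

Lemma tail_map_opp f : tail_map (fun m => - hfun f m).
Proof.
split=> [m m'|x m|]; first by rewrite raddfB opprD.
  by rewrite hfun_gpr raddfN.
near=> x => y a m ha dm.
by rewrite (near (hfunZ f) x _ y) // scalerN.
Unshelve. all: by end_near. Qed.

Definition cohom_zero : cohom M N := sval (cid (tail_map_hom tail_map_zero)).
Definition cohom_add f g : cohom M N := sval (cid (tail_map_hom (tail_map_add f g))).
Definition cohom_opp f : cohom M N := sval (cid (tail_map_hom (tail_map_opp f))).

Lemma cohom_zeroE :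
  \forall x \near large, forall m, of_deg x m -> hfun cohom_zero m = 0.
Proof. exact: (svalP (cid (tail_map_hom tail_map_zero))). Qed.

Lemma cohom_addE f g : \forall x \near large, forall m, of_deg x m ->
  hfun (cohom_add f g) m = hfun f m + hfun g m.
Proof. exact: (svalP (cid (tail_map_hom (tail_map_add f g)))). Qed.

Lemma cohom_oppE f :
  \forall x \near large, forall m, of_deg x m -> hfun (cohom_opp f) m = - hfun f m.
Proof. exact: (svalP (cid (tail_map_hom (tail_map_opp f)))). Qed.

Lemma cohom_addA : associative cohom_add.
Proof.
move=> f g h; apply: hom_ext; near=> x => m dm.
by rewrite !(near (cohom_addE _ _) x) // addrA.
Unshelve. all: by end_near. Qed.

Lemma cohom_addC : commutative cohom_add.
Proof.
move=> f g; apply: hom_ext; near=> x => m dm.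
by rewrite !(near (cohom_addE _ _) x) // addrC.
Unshelve. all: by end_near. Qed.

Lemma cohom_add0 : left_id cohom_zero cohom_add.
Proof.
move=> f; apply: hom_ext; near=> x => m dm.
by rewrite (near (cohom_addE _ _) x) // (near cohom_zeroE x) // add0r.
Unshelve. all: by end_near. Qed.

Lemma cohom_addN : left_inverse cohom_zero cohom_opp cohom_add.
Proof.
move=> f; apply: hom_ext; near=> x => m dm.
rewrite (near (cohom_addE _ _) x) // (near (cohom_oppE _) x) // addNr.
by rewrite (near cohom_zeroE x).
Unshelve. all: by end_near. Qed.

End ZmoduleStructure.

HB.instance Definition _ (M N : C) := gen_eqMixin (@hom C M N).
HB.instance Definition _ (M N : C) := gen_choiceMixin (@hom C M N).
HB.instance Definition _ (M N : C) := GRing.isZmodule.Build (@hom C M N)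
  (@cohom_addA M N) (@cohom_addC M N) (@cohom_add0 M N) (@cohom_addN M N).

Implicit Types M N P : C.

Lemma hom_eqP M N (f g : hom M N) : f = g <->
  \forall x \near large, forall m, of_deg x m -> hfun f m = hfun g m.
Proof. by split=> [->|]; [apply: nearW|apply: hom_ext]. Qed.

Lemma hfun0 M N : \forall x \near large, forall m, of_deg x m ->
  hfun (0 : hom M N) m = 0.
Proof. exact: cohom_zeroE. Qed.

Lemma hom_eq0P M N (f : hom M N) : f = 0 <->
  \forall x \near large, forall m, of_deg x m -> hfun f m = 0.
Proof.
split=> [->|f0]; first exact: hfun0.
by apply/hom_eqP; near=> x => m dm; rewrite (near f0 x) // (near (hfun0 _ _) x).
Unshelve. all: by end_near. Qed.

Lemma hfunD M N (f g : hom M N) : \forall x \near large, forall m, of_deg x m ->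
  hfun (f + g) m = hfun f m + hfun g m.
Proof. exact: cohom_addE. Qed.

Lemma hfunM M N P (g : hom N P) (f : hom M N) :
  \forall x \near large, forall m, of_deg x m -> hfun (comp g f) m = hfun g (hfun f m).
Proof. exact: hfun_comp. Qed.

Lemma hfun1 M : \forall x \near large, forall m, of_deg x m -> hfun (idm M) m = m.
Proof. exact: hfun_id. Qed.

Lemma hfun_comp_eq M N P (g : hom N P) (f : hom M N) (h : hom M P) : comp g f = h ->
  \forall x \near large, forall m, of_deg x m -> hfun g (hfun f m) = hfun h m.
Proof.
by move=> <-; near=> x => m dm; rewrite (near (hfunM _ _) x).
Unshelve. all: by end_near. Qed.

Lemma hfun_comp_id M N (g : hom N M) (f : hom M N) : comp g f = idm M ->
  \forall x \near large, forall m, of_deg x m -> hfun g (hfun f m) = m.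
Proof.
move=> /hfun_comp_eq gf; near=> x => m dm.
by rewrite (near gf x) // (near (hfun1 _) x).
Unshelve. all: by end_near. Qed.

Lemma hfun_comp_eq0 M N P (g : hom N P) (f : hom M N) : comp g f = 0 ->
  \forall x \near large, forall m, of_deg x m -> hfun g (hfun f m) = 0.
Proof.
move=> /hfun_comp_eq gf; near=> x => m dm.
by rewrite (near gf x) // (near (hfun0 _ _) x).
Unshelve. all: by end_near. Qed.

Lemma compDr M N P (f : hom N P) (g h : hom M N) : comp f (g + h) = comp f g + comp f h.
Proof.
apply/hom_eqP; near=> x => m dm; rewrite (near (hfunM _ _) x) //.
by rewrite !(near (hfunD _ _) x) // raddfD !(near (hfunM _ _) x).
Unshelve. all: by end_near. Qed.

Lemma compDl M N P (f g : hom N P) (h : hom M N) : comp (f + g) h = comp f h + comp g h.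
Proof.
apply/hom_eqP; near=> x => m dm; rewrite (near (hfunM _ _) x) //.
rewrite !(near (hfunD _ _) x) //; last exact: hfun_of_deg.
by rewrite !(near (hfunM _ _) x).
Unshelve. all: by end_near. Qed.

Lemma comp0r M N P (f : hom N P) : comp f (0 : hom M N) = 0.
Proof. by apply: (addrI (comp f 0)); rewrite -compDr !addr0. Qed.

Lemma comp0l M N P (f : hom M N) : comp (0 : hom N P) f = 0.
Proof. by apply: (addrI (comp 0 f)); rewrite -compDl !addr0. Qed.

Lemma compNr M N P (f : hom N P) (g : hom M N) : comp f (- g) = - comp f g.
Proof. by apply/eqP; rewrite -addr_eq0 -compDr addNr comp0r. Qed.

Lemma compBl M N P (f g : hom N P) (h : hom M N) : comp (f - g) h = comp f h - comp g h.
Proof. by apply: (addIr (comp g h)); rewrite -compDl !subrK. Qed.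

Lemma compBr M N P (f : hom N P) (g h : hom M N) : comp f (g - h) = comp f g - comp f h.
Proof. by rewrite compDr compNr. Qed.

End HomGroups.

(** * Exactness in large degree *)

Section Exactness.
Variables (F : finFieldType) (X : wpl F).
Local Notation L := (Lgrp X).
Local Notation C := (coh X).
Local Notation large := (large_degree X).
Implicit Types M N P Q K : C.

Definition tail_inj M N (f : hom M N) : Prop :=
  \forall x \near large, forall m, of_deg x m -> hfun f m = 0 -> m = 0.

Definition tail_surj M N (f : hom M N) : Prop :=
  \forall x \near large, forall n, of_deg x n -> exists2 m, of_deg x m & hfun f m = n.

Definition tail_image M N (U : set (car N)) (f : hom M N) : Prop :=
  \forall x \near large, forall n, of_deg x n ->
    U n <-> exists2 m, of_deg x m & hfun f m = n.

Definition tail_kernel M N (U : set (car M)) (f : hom M N) : Prop :=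
  \forall x \near large, forall m, of_deg x m -> hfun f m = 0 <-> U m.

Definition tail_exact M N P (f : hom M N) (g : hom N P) : Prop :=
  \forall x \near large, forall n, of_deg x n ->
    hfun g n = 0 <-> exists2 m, of_deg x m & hfun f m = n.

Definition tail_null M : Prop :=
  \forall x \near large, forall m : car M, of_deg x m -> m = 0.

Definition short_exact M N P (f : hom M N) (g : hom N P) : Prop :=
  [/\ tail_inj f, tail_surj g & tail_exact f g].

Lemma tail_inj_eq M N (f : hom M N) : tail_inj f ->
  \forall x \near large, forall m m', of_deg x m -> of_deg x m' ->
    hfun f m = hfun f m' -> m = m'.
Proof.
move=> f_inj; near=> x => m m' dm dm' E; apply/eqP; rewrite -subr_eq0; apply/eqP.
by apply: (near f_inj x) => //; [apply: of_degB|rewrite raddfB /= E subrr].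
Unshelve. all: by end_near. Qed.

Lemma subobject M (U : set (car M)) : gsub U ->
  exists (K : C) (i : hom K M), tail_inj i /\ tail_image U i.
Proof.
move=> gU; pose W := GSubObj gU; exists (gsub_mod W).
have [|i iE] := @tail_map_hom F X (gsub_mod W) M (@gsub_val _ _ _ W).
  by split=> [m n|x m|]; rewrite ?raddfB //; apply: nearW.
exists i; split; near=> x => m dm.
  by rewrite (near iE x) // => m0; apply: val_inj.
split=> [Um|[k dk <-]]; last first.
  by rewrite (near iE x) //; apply/asboolP; apply: (valP k).
have Wm : m \in gset_pred W by apply/asboolP.
have dk : of_deg (M := gsub_mod W) x (GSubCar Wm) by apply: val_inj.
by exists (GSubCar Wm) => //; rewrite (near iE x).
Unshelve. all: by end_near. Qed.

Lemma quotient_object M (U : set (car M)) : gsub U ->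
  exists (Q : C) (p : hom M Q), tail_surj p /\ tail_kernel U p.
Proof.
move=> gU; pose W := GSubObj gU; exists (gquo_mod W).
have [|p pE] := @tail_map_hom F X M (gquo_mod W) (\pi_(gquo W)).
  split=> [m n|x m|]; rewrite ?raddfB //; first by rewrite [RHS]gquo_prE.
  by apply: nearW => x y a m _ _; apply/esym; exact: (gquo_scaleE W a m).
exists p; split; near=> x => m dm.
  have [n mE] := gquo_lift m; have dn := of_deg_gpr x n; exists (gpr x n) => //.
  by rewrite (near pE x) // -gquo_prE -mE.
rewrite (near pE x) // -(raddf0 (\pi_(gquo W))).
by split=> [/gquo_piP|Um]; [|apply/gquo_piP]; rewrite subr0.
Unshelve. all: by end_near. Qed.

Lemma is_zeroP Z : is_zero Z <-> tail_null Z.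
Proof.
split=> [Z0|Z0 M].
  have [[f [_ fU]] _] := Z0 Z; have id0 : idm Z = 0 by rewrite -[LHS](fU _ I) -[RHS](fU _ I).
  near=> x => m dm; rewrite -[m](near (hfun1 Z) x) //.
  by rewrite id0 (near (hfun0 Z Z) x).
split; exists 0; split=> // g _; apply/esym/hom_eq0P; near=> x => m dm.
  by apply: (near Z0 x) => //; apply: hfun_of_deg.
by rewrite (near Z0 x _ m dm) // raddf0.
Unshelve. all: by end_near. Qed.

Lemma zero_object : exists Z : C, is_zero Z.
Proof.
have [K [i [i_inj i_im]]] := subobject (gsub0 (Osh (0 : L))).
exists K; apply/is_zeroP; near=> x => k dk; apply: (near i_inj x) => //.
by apply/(near i_im x) => //; [apply: hfun_of_deg|exists k].
Unshelve. all: by end_near. Qed.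

Lemma zero_morP M N (f : hom M N) : zero_mor f <-> f = 0.
Proof.
split=> [[Z [/is_zeroP Z0 [g [h ->]]]]|->].
  have -> : g = 0; last by rewrite comp0r.
  by apply/hom_eq0P; near=> x => m dm; apply: (near Z0 x) => //; apply: hfun_of_deg.
by have [Z Z0] := zero_object; exists Z; split=> //; exists 0, 0; rewrite comp0r.
Unshelve. all: by end_near. Qed.

Lemma hom_of_rel M N (R : L -> car M -> car N -> Prop) :
  (forall x m n m' n', R x m n -> R x m' n' -> R x (m - m') (n - n')) ->
  (\forall x \near large, forall m, of_deg x m -> exists2 n, of_deg x n & R x m n) ->
  (\forall x \near large, forall n, of_deg x n -> R x 0 n -> n = 0) ->
  (\forall x \near large, forall y a m n, Ahomog y a -> of_deg x m -> of_deg x n ->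
     R x m n -> R (x + y) (a *: m) (a *: n)) ->
  exists f : hom M N, \forall x \near large, forall m n, of_deg x m -> of_deg x n ->
    R x m n -> hfun f m = n.
Proof.
move=> RB Rtot R0 RZ; have [phi [/tail_map_hom[f fE] Rphi]] := tail_map_of_rel RB Rtot R0 RZ.
exists f; near=> x => m n dm dn r; apply/eqP; rewrite -subr_eq0; apply/eqP.
apply: (near R0 x) => //; first by apply: of_degB => //; apply: hfun_of_deg.
by rewrite -(subrr m); apply: RB => //; rewrite (near fE x) //; apply: (near Rphi x).
Unshelve. all: by end_near. Qed.

Lemma tail_inj_lift M N K (i : hom K N) (g : hom M N) : tail_inj i ->
  (\forall x \near large, forall m, of_deg x m -> exists2 k, of_deg x k & hfun i k = hfun g m) ->
  exists u : hom M K, comp i u = g.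
Proof.
move=> i_inj g_im; pose R (x : L) m k := hfun i k = hfun g m.
have [||||u uE] := @hom_of_rel M K R.
- by move=> x m k m' k'; rewrite /R !raddfB /= => -> ->.
- exact: g_im.
- by near=> x => k dk; rewrite /R raddf0 /=; apply: (near i_inj x).
- near=> x => y a m k ha dm dk r.
  by rewrite /R (near (hfunZ i) x _ y) // (near (hfunZ g) x _ y) // r.
exists u; apply/hom_eqP; near=> x => m dm; rewrite (near (hfunM _ _) x) //.
by have [//|k dk r] := near g_im x _ m dm; rewrite (near uE x _ m k).
Unshelve. all: by end_near. Qed.

Lemma tail_surj_lift M N K (p : hom M K) (g : hom M N) : tail_surj p ->
  (\forall x \near large, forall m, of_deg x m -> hfun p m = 0 -> hfun g m = 0) ->
  exists u : hom K N, comp u p = g.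
Proof.
move=> p_surj g_ker.
pose R x k n := exists m, [/\ of_deg x m, hfun p m = k & hfun g m = n].
have [||||u uE] := @hom_of_rel K N R.
- move=> x k n k' n' [m [dm <- <-]] [m' [dm' <- <-]]; exists (m - m').
  by rewrite !raddfB; split=> //; apply: of_degB.
- near=> x => k dk; have [//|m dm mk] := near p_surj x _ k dk.
  by exists (hfun g m); [apply: hfun_of_deg|exists m].
- by near=> x => n dn [m [dm m0 <-]]; apply: (near g_ker x).
- near=> x => y a k n ha dk dn [m [dm <- <-]]; exists (a *: m).
  by rewrite (near (hfunZ p) x _ y) // (near (hfunZ g) x _ y) //; split=> //; apply: of_degZ.
exists u; apply/hom_eqP; near=> x => m dm; rewrite (near (hfunM _ _) x) //.
by apply: (near uE x) => //; [apply: hfun_of_deg|apply: hfun_of_deg|exists m].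
Unshelve. all: by end_near. Qed.

Lemma tail_inj_cancel M N P (i : hom N P) (f g : hom M N) : tail_inj i ->
  comp i f = comp i g -> f = g.
Proof.
move=> /tail_inj_eq i_inj /hfun_comp_eq E; apply/hom_eqP; near=> x => m dm.
apply: (near i_inj x) => //; try exact: hfun_of_deg.
by rewrite (near E x) // (near (hfunM _ _) x).
Unshelve. all: by end_near. Qed.

Lemma tail_surj_cancel M N P (p : hom M N) (f g : hom N P) : tail_surj p ->
  comp f p = comp g p -> f = g.
Proof.
move=> p_surj /hfun_comp_eq E; apply/hom_eqP; near=> x => n dn.
have [//|m dm <-] := near p_surj x _ n dn.
by rewrite (near E x) // (near (hfunM _ _) x).
Unshelve. all: by end_near. Qed.

Lemma tail_inj_id M : tail_inj (idm M).
Proof. by near=> x => m dm; rewrite (near (hfun1 _) x). Unshelve. all: by end_near. Qed.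

Lemma tail_inj_comp M P K (i : hom P K) (j : hom M P) :
  tail_inj i -> tail_inj j -> tail_inj (comp i j).
Proof.
move=> i_inj j_inj; near=> x => m dm; rewrite (near (hfunM _ _) x) // => ij0.
by apply: (near j_inj x) => //; apply: (near i_inj x) => //; apply: hfun_of_deg.
Unshelve. all: by end_near. Qed.

Lemma tail_inj_comp_r M P K (i : hom P K) (j : hom M P) : tail_inj (comp i j) -> tail_inj j.
Proof.
move=> ij_inj; near=> x => m dm j0; apply: (near ij_inj x) => //.
by rewrite (near (hfunM _ _) x) // j0 raddf0.
Unshelve. all: by end_near. Qed.

Lemma tail_inj_retract M P (g : hom P M) (f : hom M P) : comp g f = idm M -> tail_inj f.
Proof. by move=> gf; apply: (@tail_inj_comp_r _ _ _ g); rewrite gf; apply: tail_inj_id. Qed.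

Lemma tail_surj_comp M P K (i : hom P K) (j : hom M P) :
  tail_surj i -> tail_surj j -> tail_surj (comp i j).
Proof.
move=> i_surj j_surj; near=> x => k dk; have [//|p dp <-] := near i_surj x _ k dk.
have [//|m dm <-] := near j_surj x _ p dp.
by exists m => //; rewrite (near (hfunM _ _) x).
Unshelve. all: by end_near. Qed.

Lemma tail_surj_comp_l M P K (i : hom P K) (j : hom M P) :
  tail_surj (comp i j) -> tail_surj i.
Proof.
move=> ij_surj; near=> x => k dk; have [//|m dm <-] := near ij_surj x _ k dk.
by exists (hfun j m); [apply: hfun_of_deg|rewrite (near (hfunM _ _) x)].
Unshelve. all: by end_near. Qed.

Lemma tail_exact_comp_inj M P K B (a : hom M P) (p : hom P K) (j : hom K B) :
  tail_inj j -> tail_exact a (comp j p) <-> tail_exact a p.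
Proof.
move=> j_inj.
have jp0 : \forall x \near large, forall n, of_deg x n ->
    hfun (comp j p) n = 0 <-> hfun p n = 0.
  near=> x => n dn; rewrite (near (hfunM _ _) x) //.
  by split=> [|->]; [apply: (near j_inj x) => //; apply: hfun_of_deg|rewrite raddf0].
split=> e; near=> x => n dn; last first.
  by apply: iff_trans (near e x _ n dn) => //; apply: (near jp0 x).
by apply: iff_trans (near e x _ n dn) => //; apply: iff_sym; apply: (near jp0 x).
Unshelve. all: by end_near. Qed.

Lemma tail_exact_comp_surj M P K B (p : hom M P) (j : hom P K) (c : hom K B) :
  tail_surj p -> tail_exact (comp j p) c <-> tail_exact j c.
Proof.
move=> p_surj.
have jp_im : \forall x \near large, forall n, of_deg x n ->
    (exists2 m, of_deg x m & hfun (comp j p) m = n) <->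
    (exists2 m, of_deg x m & hfun j m = n).
  near=> x => n dn; split=> -[m dm <-].
    by exists (hfun p m); [apply: hfun_of_deg|rewrite (near (hfunM _ _) x)].
  have [//|m' dm' <-] := near p_surj x _ m dm.
  by exists m' => //; rewrite (near (hfunM _ _) x).
split=> e; near=> x => n dn; apply: (iff_trans (near e x _ n dn)) => //.
  exact: (near jp_im x).
by apply: iff_sym; apply: (near jp_im x).
Unshelve. all: by end_near. Qed.

End Exactness.

Section AbelianStructure.
Variables (F : finFieldType) (X : wpl F).
Local Notation C := (coh X).
Local Notation large := (large_degree X).
Implicit Types M N P Q K : C.

Lemma kernel_exists M N (f : hom M N) :
  exists (K : C) (i : hom K M), tail_inj i /\ tail_exact i f.
Proof.
have [d fZ] := tail_map_linear (hfun_tail_map f).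
have [t0 tD tg] := @gsub_truncation F X M d.
have [|K [i [i_inj i_im]]] := @subobject F X M [set m | truncation d m /\ hfun f m = 0].
  split=> [|a m n [tm m0] [tn n0]|x m [tm m0]]; first by rewrite /= raddf0.
    by split; [apply: tD|rewrite raddfD /= fZ // m0 n0 scaler0 addr0].
  by split; [apply: tg|rewrite hfun_gpr m0 gpr0].
exists K, i; split=> //; near=> x => m dm; rewrite -(near i_im x) //.
split=> [m0|[]//]; split=> //; apply: truncation_of_deg dm.
by near: x; apply: near_ldeg_ge.
Unshelve. all: by end_near. Qed.

Lemma image_gsub M N (f : hom M N) : exists U, gsub U /\ tail_image U f.
Proof.
have [d fZ] := tail_map_linear (hfun_tail_map f).
have [t0 tD tg] := @gsub_truncation F X M d.
exists [set n | exists2 m, truncation d m & hfun f m = n]; split.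
  split=> [|a n n' [m tm <-] [m' tm' <-]|x n [m tm <-]].
  - by exists 0; rewrite ?raddf0.
  - by exists (a *: m + m'); [apply: tD|rewrite raddfD /= fZ].
  - by exists (gpr x m); [apply: tg|rewrite hfun_gpr].
near=> x => n dn; split=> [[m tm E]|[m dm <-]].
  by exists (gpr x m); [apply: of_deg_gpr|rewrite hfun_gpr E].
by exists m => //; apply: truncation_of_deg dm; near: x; apply: near_ldeg_ge.
Unshelve. all: by end_near. Qed.

Lemma cokernel_exists M N (f : hom M N) :
  exists (Q : C) (p : hom N Q), tail_surj p /\ tail_exact f p.
Proof.
have [U [gU U_im]] := image_gsub f; have [Q [p [p_surj U_ker]]] := quotient_object gU.
exists Q, p; split=> //; near=> x => n dn.
by rewrite (near U_ker x) // (near U_im x).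
Unshelve. all: by end_near. Qed.

Lemma image_exists M P (h : hom M P) : exists (T : C) (p : hom M T) (j : hom T P),
  [/\ tail_surj p, tail_inj j & comp j p = h].
Proof.
have [U [gU U_im]] := image_gsub h; have [T [j [j_inj U_j]]] := subobject gU.
have [|p pE] := @tail_inj_lift F X M P T j h j_inj.
  near=> x => m dm; have dh := hfun_of_deg h dm.
  by apply/(near U_j x) => //; apply/(near U_im x) => //; exists m.
exists T, p, j; split=> //; near=> x => n dn; have dj := hfun_of_deg j dn.
have [m dm mE] : exists2 m, of_deg x m & hfun h m = hfun j n.
  by apply/(near U_im x) => //; apply/(near U_j x) => //; exists n.
exists m => //; apply: (near (tail_inj_eq j_inj) x) => //; first exact: hfun_of_deg.
by rewrite (near (hfun_comp_eq pE) x).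
Unshelve. all: by end_near. Qed.

Lemma tail_exact_comp0 M N P (f : hom M N) (g : hom N P) : tail_exact f g -> comp g f = 0.
Proof.
move=> e; apply/hom_eq0P; near=> x => m dm; rewrite (near (hfunM _ _) x) //.
by apply/(near e x) => //; [apply: hfun_of_deg|exists m].
Unshelve. all: by end_near. Qed.

Lemma kernel_lift K M N P (i : hom K M) (f : hom M N) (g : hom P M) :
  tail_inj i -> tail_exact i f -> comp f g = 0 -> exists u : hom P K, comp i u = g.
Proof.
move=> i_inj e /hfun_comp_eq0 fg0; apply: tail_inj_lift => //; near=> x => m dm.
by apply/(near e x) => //; [apply: hfun_of_deg|apply: (near fg0 x)].
Unshelve. all: by end_near. Qed.

Lemma cokernel_lift Q M N P (p : hom N Q) (f : hom M N) (g : hom N P) :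
  tail_surj p -> tail_exact f p -> comp g f = 0 -> exists u : hom Q P, comp u p = g.
Proof.
move=> p_surj e /hfun_comp_eq0 gf0; apply: tail_surj_lift => //; near=> x => n dn.
by rewrite (near e x) // => -[m dm <-]; apply: (near gf0 x).
Unshelve. all: by end_near. Qed.

Lemma is_monoP M N (i : hom M N) : is_mono i <-> tail_inj i.
Proof.
split=> [i_mono|i_inj P f g]; last exact: tail_inj_cancel.
have [K [k [k_inj e]]] := kernel_exists i.
have k0 : k = 0 by apply: i_mono; rewrite (tail_exact_comp0 e) comp0r.
near=> x => m dm /(near e x _ m dm)[//|l dl <-].
by rewrite k0 (near (hfun0 _ _) x).
Unshelve. all: by end_near. Qed.

Lemma is_isoP M N (f : hom M N) : is_iso f <-> tail_inj f /\ tail_surj f.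
Proof.
split=> [[g [gf fg]]|[f_inj f_surj]].
  split; first exact: tail_inj_retract gf.
  near=> x => n dn; exists (hfun g n); first exact: hfun_of_deg.
  exact: (near (hfun_comp_id fg) x).
have [|g fg] := @tail_inj_lift F X N N M f (idm N) f_inj.
  by near=> x => n dn; rewrite (near (hfun1 _) x) //; apply: (near f_surj x).
exists g; split=> //; apply: (tail_inj_cancel f_inj).
by rewrite comp_assoc fg comp_idl comp_idr.
Unshelve. all: by end_near. Qed.

Lemma kernel_unique M M' P K (k : hom M P) (k' : hom M' P) (p : hom P K) :
  tail_inj k -> tail_exact k p -> tail_inj k' -> tail_exact k' p ->
  exists2 u : hom M M', is_iso u & comp k' u = k.
Proof.
move=> k_inj e k'_inj e'.
have [u uE] := kernel_lift k'_inj e' (tail_exact_comp0 e).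
have [v vE] := kernel_lift k_inj e (tail_exact_comp0 e').
exists u => //; exists v; split.
  by apply: (tail_inj_cancel k_inj); rewrite comp_assoc vE uE comp_idr.
by apply: (tail_inj_cancel k'_inj); rewrite comp_assoc uE vE comp_idr.
Qed.

Lemma cokernel_unique M P K K' (k : hom M P) (p : hom P K) (p' : hom P K') :
  tail_surj p -> tail_exact k p -> tail_surj p' -> tail_exact k p' ->
  exists2 u : hom K K', is_iso u & comp u p = p'.
Proof.
move=> p_surj e p'_surj e'.
have [u uE] := cokernel_lift p_surj e (tail_exact_comp0 e').
have [v vE] := cokernel_lift p'_surj e' (tail_exact_comp0 e).
exists u => //; exists v; split.
  by apply: (tail_surj_cancel p_surj); rewrite -comp_assoc uE vE comp_idl.
by apply: (tail_surj_cancel p'_surj); rewrite -comp_assoc vE uE comp_idl.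
Qed.

Lemma is_kernelP K M N (i : hom K M) (f : hom M N) :
  is_kernel i f <-> tail_inj i /\ tail_exact i f.
Proof.
split=> [[/zero_morP fi0 i_univ]|[i_inj e]].
  have [K' [k [k_inj e]]] := kernel_exists f.
  have [v vE] := kernel_lift k_inj e fi0.
  have /i_univ[u [uE _]] : zero_mor (comp f k) by apply/zero_morP/tail_exact_comp0.
  have vu : comp v u = idm K'.
    by apply: (tail_inj_cancel k_inj); rewrite comp_assoc vE uE comp_idr.
  have uv : comp u v = idm K.
    have /i_univ[w [_ w_unique]] : zero_mor (comp f i) by apply/zero_morP.
    by rewrite -[RHS]w_unique ?comp_idr // -[LHS]w_unique // comp_assoc uE.
  have /is_isoP[v_inj v_surj] : is_iso v by exists u.
  by rewrite -vE; split; [apply: tail_inj_comp|apply/tail_exact_comp_surj].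
split; first by apply/zero_morP/tail_exact_comp0.
move=> P g /zero_morP fg0; have [u uE] := kernel_lift i_inj e fg0.
by exists u; split=> // v vE; apply: (tail_inj_cancel i_inj); rewrite uE vE.
Qed.

Lemma is_cokernelP Q M N (p : hom N Q) (f : hom M N) :
  is_cokernel p f <-> tail_surj p /\ tail_exact f p.
Proof.
split=> [[/zero_morP pf0 p_univ]|[p_surj e]].
  have [Q' [q [q_surj e]]] := cokernel_exists f.
  have [v vE] := cokernel_lift q_surj e pf0.
  have /p_univ[u [uE _]] : zero_mor (comp q f) by apply/zero_morP/tail_exact_comp0.
  have uv : comp u v = idm Q'.
    by apply: (tail_surj_cancel q_surj); rewrite -comp_assoc vE uE comp_idl.
  have vu : comp v u = idm Q.
    have /p_univ[w [_ w_unique]] : zero_mor (comp p f) by apply/zero_morP.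
    by rewrite -[RHS]w_unique ?comp_idl // -[LHS]w_unique // -comp_assoc uE.
  have /is_isoP[v_inj v_surj] : is_iso v by exists u.
  by rewrite -vE; split; [apply: tail_surj_comp|apply/tail_exact_comp_inj].
split; first by apply/zero_morP/tail_exact_comp0.
move=> P g /zero_morP gf0; have [u uE] := cokernel_lift p_surj e gf0.
by exists u; split=> // v vE; apply: (tail_surj_cancel p_surj); rewrite uE vE.
Qed.

Lemma sesP M N P :
  @ses C M N P <-> exists (i : hom M N) (p : hom N P), short_exact i p.
Proof.
split=> [[i [p [/is_kernelP[i_inj e] /is_cokernelP[p_surj _]]]]|[i [p [i_inj p_surj e]]]].
  by exists i, p.
by exists i, p; split; [apply/is_kernelP|apply/is_cokernelP].
Qed.

Lemma factorization_unique M P T T' (p : hom M T) (j : hom T P) (p' : hom M T')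
    (j' : hom T' P) : tail_surj p -> tail_inj j -> tail_surj p' -> tail_inj j' ->
  comp j p = comp j' p' -> exists u : hom T T', [/\ is_iso u, comp u p = p' & comp j' u = j].
Proof.
move=> p_surj j_inj p'_surj j'_inj E; have [K [k [_ e]]] := kernel_exists (comp j p).
have kp : tail_exact k p by apply/(tail_exact_comp_inj _ _ j_inj).
have kp' : tail_exact k p' by rewrite E in e; apply/(tail_exact_comp_inj _ _ j'_inj).
have [u u_iso uE] := cokernel_unique p_surj kp p'_surj kp'; exists u; split=> //.
by apply: (tail_surj_cancel p_surj); rewrite -comp_assoc uE.
Qed.

Lemma short_exact_iso M N P M' N' P' (i : hom M N) (p : hom N P) (a : hom M' M)
    (b : hom N N') (b' : hom N' N) (c : hom P P') : short_exact i p -> is_iso a ->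
  comp b b' = idm N' -> comp b' b = idm N -> is_iso c ->
  short_exact (comp b (comp i a)) (comp c (comp p b')).
Proof.
move=> [i_inj p_surj e] /is_isoP[a_inj a_surj] bb' b'b /is_isoP[c_inj c_surj].
have /is_isoP[b_inj _] : is_iso b by exists b'.
have /is_isoP[_ b'_surj] : is_iso b' by exists b.
split; [exact: tail_inj_comp b_inj (tail_inj_comp i_inj a_inj)
       |exact: tail_surj_comp c_surj (tail_surj_comp p_surj b'_surj)|].
apply/tail_exact_comp_inj => //; rewrite comp_assoc; apply/tail_exact_comp_surj => //.
near=> x => n dn; have db'n := hfun_of_deg b' dn.
rewrite (near (hfunM _ _) x) // (near e x) //; split=> -[m dm mE]; exists m => //.
  by rewrite (near (hfunM _ _) x) // mE (near (hfun_comp_id bb') x).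
rewrite -mE (near (hfunM _ _) x) // (near (hfun_comp_id b'b) x) //.
exact: hfun_of_deg.
Unshelve. all: by end_near. Qed.

Lemma short_exact_difference M K B D (i : hom K B) (p : hom B D) (g g' : hom M B) :
  short_exact i p -> comp p g = comp p g' -> exists w : hom M K, g' + comp i w = g.
Proof.
move=> [i_inj _ e] E; have [|w wE] := @kernel_lift K B D M i p (g - g') i_inj e.
  by rewrite compBr E subrr.
by exists w; rewrite wE addrC subrK.
Qed.

Lemma cokernel_comp_short_exact M P K Q Y R (u : hom M P) (w : hom P K) (q : hom P Q)
    (r : hom K R) (p : hom K Y) : tail_inj w -> tail_surj q -> tail_exact u q ->
  tail_surj r -> tail_exact w r -> tail_surj p -> tail_exact (comp w u) p ->
  exists (j : hom Q Y) (s : hom Y R), short_exact j s.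
Proof.
move=> w_inj q_surj uq r_surj wr p_surj wup.
have [|j jE] := @cokernel_lift Q M P Y q u (comp p w) q_surj uq.
  by rewrite -comp_assoc (tail_exact_comp0 wup).
have [|s sE] := @cokernel_lift Y M K R p (comp w u) r p_surj wup.
  by rewrite comp_assoc (tail_exact_comp0 wr) comp0l.
have jq : \forall x \near large, forall m, of_deg x m ->
    hfun j (hfun q m) = hfun p (hfun w m).
  by near=> x => m dm; rewrite (near (hfun_comp_eq jE) x) // (near (hfunM _ _) x).
exists j, s; split.
- near=> x => n dn; have [//|m dm <-] := near q_surj x _ n dn.
  rewrite (near jq x) // => /(near wup x _ _ (hfun_of_deg w dm))[//|a da].
  rewrite (near (hfunM _ _) x) // => /(near (tail_inj_eq w_inj) x) am.
  by apply/(near uq x) => //; exists a => //; apply: am => //; apply: hfun_of_deg.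
- by apply: (@tail_surj_comp_l _ _ _ _ _ s p); rewrite sE.
near=> x => n dn; have [//|k dk <-] := near p_surj x _ n dn.
rewrite (near (hfun_comp_eq sE) x) // (near wr x) //; split=> [[m dm <-]|[l dl lE]].
  by exists (hfun q m); [apply: hfun_of_deg|apply: (near jq x)].
have [//|m dm mE] := near q_surj x _ l dl; apply/(near wr x) => //.
rewrite -(near (hfun_comp_eq sE) x) // -lE -mE (near jq x) //.
rewrite (near (hfun_comp_eq sE) x); [|by []|exact: hfun_of_deg].
by apply/(near wr x); [by []|exact: hfun_of_deg|exists m].
Unshelve. all: by end_near. Qed.

End AbelianStructure.

Section Biproducts.
Variables (F : finFieldType) (X : wpl F).
Local Notation C := (coh X).
Local Notation large := (large_degree X).
Implicit Types M P K : C.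

Definition biproduct_maps M P K (i1 : hom M K) (i2 : hom P K) (p1 : hom K M)
    (p2 : hom K P) : Prop :=
  [/\ comp p1 i1 = idm M, comp p2 i2 = idm P, comp p1 i2 = 0, comp p2 i1 = 0
    & comp i1 p1 + comp i2 p2 = idm K].

Section BiproductTheory.
Variables (M P K : C) (i1 : hom M K) (i2 : hom P K) (p1 : hom K M) (p2 : hom K P).
Hypothesis K_bip : biproduct_maps i1 i2 p1 p2.

Lemma copair_inl D (f : hom M D) (g : hom P D) : comp (comp f p1 + comp g p2) i1 = f.
Proof.
have [e1 _ _ e4 _] := K_bip.
by rewrite compDl -!comp_assoc e1 e4 comp0r addr0 comp_idr.
Qed.

Lemma copair_inr D (f : hom M D) (g : hom P D) : comp (comp f p1 + comp g p2) i2 = g.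
Proof.
have [_ e2 e3 _ _] := K_bip.
by rewrite compDl -!comp_assoc e2 e3 comp0r add0r comp_idr.
Qed.

Lemma pair_fst D (f : hom D M) (g : hom D P) : comp p1 (comp i1 f + comp i2 g) = f.
Proof.
have [e1 _ e3 _ _] := K_bip.
by rewrite compDr !comp_assoc e1 e3 comp0l addr0 comp_idl.
Qed.

Lemma pair_snd D (f : hom D M) (g : hom D P) : comp p2 (comp i1 f + comp i2 g) = g.
Proof.
have [_ e2 _ e4 _] := K_bip.
by rewrite compDr !comp_assoc e2 e4 comp0l add0r comp_idl.
Qed.

Lemma copair_eta D (f : hom K D) : comp (comp f i1) p1 + comp (comp f i2) p2 = f.
Proof.
by have [_ _ _ _ e5] := K_bip; rewrite -!comp_assoc -compDr e5 comp_idr.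
Qed.

Lemma pair_eta D (f : hom D K) : comp i1 (comp p1 f) + comp i2 (comp p2 f) = f.
Proof.
by have [_ _ _ _ e5] := K_bip; rewrite !comp_assoc -compDl e5 comp_idl.
Qed.

End BiproductTheory.

Lemma biproductP M P K : @is_biproduct C M P K <->
  exists (i1 : hom M K) (i2 : hom P K) (p1 : hom K M) (p2 : hom K P),
    biproduct_maps i1 i2 p1 p2.
Proof.
split=> [[i1 [i2 [p1 [p2 [[e1 e2] [/zero_morP e3 /zero_morP e4] pairing _]]]]]|].
  exists i1, i2, p1, p2; split=> //; have [u [_ u_unique]] := pairing K p1 p2.
  rewrite -[RHS]u_unique ?comp_idr // -[LHS]u_unique //.
  by rewrite !compDr !comp_assoc e1 e2 e3 e4 !comp_idl !comp0l addr0 add0r.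
move=> [i1 [i2 [p1 [p2 K_bip]]]]; have [e1 e2 e3 e4 _] := K_bip.
exists i1, i2, p1, p2; split; rewrite ?e1 ?e2 ?e3 ?e4 //.
- by split; apply/zero_morP.
- move=> D f g; exists (comp i1 f + comp i2 g).
  split; first by rewrite (pair_fst K_bip) (pair_snd K_bip).
  by move=> u [<- <-]; apply: pair_eta.
- move=> D f g; exists (comp f p1 + comp g p2).
  split; first by rewrite (copair_inl K_bip) (copair_inr K_bip).
  by move=> u [<- <-]; apply: copair_eta.
Qed.

Lemma complement_projection M P K (i : hom M K) (j : hom P K) :
  (\forall x \near large, forall m p, of_deg x m -> of_deg x p ->
     hfun i m + hfun j p = 0 -> m = 0) ->
  (\forall x \near large, forall k, of_deg x k -> exists m p,
     [/\ of_deg x m, of_deg x p & k = hfun i m + hfun j p]) ->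
  exists q : hom K M, comp q i = idm M /\ comp q j = 0.
Proof.
move=> indep span_ij.
pose R x k m := exists p, of_deg x p /\ k = hfun i m + hfun j p.
have [||||q qE] := @hom_of_rel _ _ K M R.
- move=> x k m k' m' [p [dp ->]] [p' [dp' ->]]; exists (p - p').
  by split; [apply: of_degB|rewrite !raddfB opprD addrACA].
- near=> x => k dk; have [//|m [p [dm dp kE]]] := near span_ij x _ k dk.
  by exists m => //; exists p.
- near=> x => m dm [p [dp /esym mp0]].
  exact: (near indep x _ m p).
- near=> x => y a k m ha dk dm [p [dp ->]]; exists (a *: p); split; first exact: of_degZ.
  by rewrite scalerDr (near (hfunZ i) x _ y) // (near (hfunZ j) x _ y).
exists q; split; [apply/hom_eqP|apply/hom_eq0P]; near=> x => m dm.
  rewrite (near (hfunM _ _) x) // (near (hfun1 _) x) //.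
  apply: (near qE x) => //; first exact: hfun_of_deg.
  by exists 0; split; [apply: of_deg0|rewrite raddf0 addr0].
rewrite (near (hfunM _ _) x) //.
apply: (near qE x) => //; [exact: hfun_of_deg|exact: of_deg0|].
by exists m; rewrite raddf0 add0r.
Unshelve. all: by end_near. Qed.

Lemma complement_biproduct M P K (i : hom M K) (j : hom P K) :
  (\forall x \near large, forall m p, of_deg x m -> of_deg x p ->
     hfun i m + hfun j p = 0 -> m = 0 /\ p = 0) ->
  (\forall x \near large, forall k, of_deg x k -> exists m p,
     [/\ of_deg x m, of_deg x p & k = hfun i m + hfun j p]) ->
  @is_biproduct C M P K.
Proof.
move=> indep span_ij.
have [|q [qi qj]] := @complement_projection M P K i j _ span_ij.
  by near=> x => m p dm dp /(near indep x _ m p dm dp)[].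
have [||r [rj ri]] := @complement_projection P M K j i.
- near=> x => p m dp dm; rewrite addrC.
  by move=> /(near indep x _ m p dm dp)[].
- near=> x => k /(near span_ij x)[//|m [p [dm dp ->]]].
  by exists p, m; rewrite addrC.
apply/biproductP; exists i, j, q, r; split=> //; apply/hom_eqP; near=> x => k dk.
rewrite (near (hfunD _ _) x) // !(near (hfunM _ _) x) // (near (hfun1 _) x) //.
have [//|m [p [dm dp ->]]] := near span_ij x _ k dk; rewrite !raddfD /=.
rewrite (near (hfun_comp_id qi) x) // (near (hfun_comp_eq0 qj) x) //.
rewrite (near (hfun_comp_eq0 ri) x) // (near (hfun_comp_id rj) x) //.
by rewrite !raddf0 addr0 add0r.
Unshelve. all: by end_near. Qed.

Lemma indecomposable_complement (S : C) (U V : set (car S)) : gsub U -> gsub V ->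
  (\forall x \near large, forall s : car S, of_deg x s -> U s -> V s -> s = 0) ->
  (\forall x \near large, forall s : car S, of_deg x s -> gadd U V s) ->
  indecomposable S ->
  (\forall x \near large, forall s : car S, of_deg x s -> U s -> s = 0) \/
  (\forall x \near large, forall s : car S, of_deg x s -> V s -> s = 0).
Proof.
move=> gU gV UV0 UVT [_ indec]; have [[_ _ Ug] [_ _ Vg]] := (gU, gV).
have [K [i [i_inj U_i]]] := subobject gU; have [K' [j [j_inj V_j]]] := subobject gV.
have im0 M (k : hom M S) (W : set (car S)) : tail_image W k -> tail_null M ->
    \forall x \near large, forall s, of_deg x s -> W s -> s = 0.
  move=> W_k M0; near=> x => s ds /(near W_k x _ s ds)[//|m dm <-].
  by rewrite (near M0 x _ m dm) // raddf0.
suff /indec[/is_zeroP K0|/is_zeroP K'0] : @is_biproduct C K K' S.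
- by left; exact: (im0 _ _ _ U_i K0).
- by right; exact: (im0 _ _ _ V_j K'0).
have UV x s : of_deg x s -> gadd U V s ->
    exists u v, [/\ of_deg x u, of_deg x v, U u, V v & s = u + v].
  move=> ds [u [v [Uu Vv sE]]]; exists (gpr x u), (gpr x v).
  split; [exact: of_deg_gpr|exact: of_deg_gpr|exact: Ug|exact: Vg|].
  by rewrite -raddfD /= -sE ds.
apply: (@complement_biproduct _ _ _ i j).
  near=> x => m p dm dp mp0.
  have im_j : hfun i m = hfun j (- p) by apply/eqP; rewrite raddfN -addr_eq0 mp0.
  have i0 : hfun i m = 0.
    apply: (near UV0 x) => //; first exact: hfun_of_deg.
      by apply/(near U_i x) => //; [apply: hfun_of_deg|exists m].
    rewrite im_j; apply/(near V_j x) => //; first exact/hfun_of_deg/of_degN.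
    by exists (- p) => //; apply: of_degN.
  split; first exact: (near i_inj x).
  by apply: (near j_inj x) => //; rewrite i0 add0r in mp0.
near=> x => s ds.
have [|u [v [du dv Uu Vv ->]]] := UV x s ds; first exact: (near UVT x).
have [//|m dm <-] := proj1 (near U_i x _ u du) Uu.
have [//|p dp <-] := proj1 (near V_j x _ v dv) Vv.
by exists m, p.
Unshelve. all: by end_near. Qed.

End Biproducts.

(** * Counting up to an equivalence *)

Section CardMod.

Definition card_mod (T : Type) (E : T -> T -> Prop) (A : T -> Prop) (n : nat) : Prop :=
  exists f : 'I_n -> T, [/\ forall i, A (f i), forall i j, E (f i) (f j) -> i = j
    & forall x, A x -> exists i, E x (f i)].

Definition finite_mod (T : Type) (E : T -> T -> Prop) (A : T -> Prop) : Prop :=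
  exists n, card_mod E A n.

Definition has_card (T : Type) (A : T -> Prop) (n : nat) : Prop := card_mod eq A n.

Lemma card_mod_finType (T : Type) (E : T -> T -> Prop) (A : T -> Prop) (I : finType)
    (f : I -> T) : (forall i, A (f i)) -> (forall i j, E (f i) (f j) -> i = j) ->
  (forall x, A x -> exists i, E x (f i)) -> card_mod E A #|I|.
Proof.
move=> fA f_inj f_surj; exists (fun i => f (enum_val i)).
split=> // [i j /f_inj/enum_val_inj//|x].
by move=> /f_surj[i Ei]; exists (enum_rank i); rewrite enum_rankK.
Qed.

Lemma card_mod_gt0 (T : Type) (E : T -> T -> Prop) (A : T -> Prop) n x :
  A x -> card_mod E A n -> (0 < n)%N.
Proof.
move=> Ax [f [_ _ f_surj]]; have [i _] := f_surj x Ax.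
exact: leq_ltn_trans (ltn_ord i).
Qed.

Lemma card_mod_unique (T : Type) (E : T -> T -> Prop) (A : T -> Prop) n m :
  Equivalence E -> card_mod E A n -> card_mod E A m -> n = m.
Proof.
move=> [_ symE transE].
have le a b : card_mod E A a -> card_mod E A b -> (a <= b)%N.
  move=> [f [fA f_inj _]] [g [_ _ g_surj]].
  have /choice[r rP] := fun i => g_surj _ (fA i).
  rewrite -[a]card_ord -[b]card_ord; apply: (leq_card r) => i j rE.
  by apply: f_inj; apply: transE (rP i) _; apply: symE; rewrite rE.
by move=> cn cm; apply/eqP; rewrite eqn_leq !le.
Qed.

Lemma has_card_unique (T : Type) (A : T -> Prop) n m :
  has_card A n -> has_card A m -> n = m.
Proof. exact: card_mod_unique eq_equivalence. Qed.

Lemma ncard_has_card (T : Type) (A : T -> Prop) n : has_card A n -> ncard A = n.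
Proof.
move=> cA; have [f [fA f_inj f_surj]] := cA; rewrite /ncard.
case: xgetP => [k _ [g [g_inj gA]]|/(_ n) []].
  apply: has_card_unique cA; exists g; split=> [i|//|x /gA[i <-]]; last by exists i.
  by apply/gA; exists i.
by exists f; split=> // x; split=> [/f_surj[i ->]|[i <-]//]; exists i.
Qed.

Lemma finite_mod_classify (T : Type) (I : finType) (E : T -> T -> Prop) (A : T -> Prop)
    (R : T -> I -> Prop) : Equivalence E -> (forall x, A x -> exists i, R x i) ->
  (forall x y i, A x -> A y -> R x i -> R y i -> E x y) -> finite_mod E A.
Proof.
move=> [reflE symE transE] R_total R_inj; pose J := {i | `[< exists x, A x /\ R x i >]}.
have /choice[rep repP] : forall i : J, exists x, A x /\ R x (val i).
  by move=> [i /= /asboolP].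
pose class x := [pick i : J | `[< E x (rep i) >]].
have classP x : A x -> exists2 i, class x = Some i & E x (rep i).
  move=> Ax; rewrite /class; case: pickP => [i /asboolP Ei|no]; first by exists i.
  have [i Ri] := R_total x Ax; have Ji : `[< exists x, A x /\ R x i >] by apply/asboolP; exists x.
  have [Arep Rrep] := repP (exist _ i Ji); have /asboolP[] := no (exist _ i Ji).
  exact: R_inj Ri Rrep.
have class_eq x y : E x y -> class x = class y.
  move=> Exy; apply: eq_pick => i; apply: asbool_equiv_eq.
  by split=> Ei; [apply: transE Ei; apply: symE|apply: transE Ei].
pose K := {i : J | class (rep i) == Some i}; exists #|{: K}|.
apply: (@card_mod_finType _ E A _ (fun i : K => rep (val i))) => [i|i j Eij|x Ax].
- by case: (repP (val i)).
- apply/val_inj/Some_inj; rewrite -(eqP (valP i)) -(eqP (valP j)).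
  exact: class_eq.
- have [i xi Exi] := classP x Ax.
  have Ki : class (rep i) == Some i by rewrite -(class_eq _ _ Exi) xi.
  by exists (exist _ i Ki).
Qed.

Lemma finite_mod_sub (T : Type) (E : T -> T -> Prop) (A B : T -> Prop) :
  Equivalence E -> (forall x, B x -> A x) -> finite_mod E A -> finite_mod E B.
Proof.
move=> eqE BA [n [f [_ _ f_surj]]]; have [_ symE transE] := eqE.
apply: (finite_mod_classify (R := fun x i => E x (f i)) eqE) => [x /BA/f_surj//|].
by move=> x y i _ _ Ex Ey; apply: transE Ex _; apply: symE.
Qed.

Lemma card_mod_bij (T U : Type) (E : T -> T -> Prop) (E' : U -> U -> Prop)
    (A : T -> Prop) (B : U -> Prop) (f : U -> T) n :
  (forall u, B u -> A (f u)) -> (forall x, A x -> exists2 u, B u & E x (f u)) ->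
  (forall u v, B u -> B v -> E (f u) (f v) <-> E' u v) -> Equivalence E ->
  card_mod E' B n -> card_mod E A n.
Proof.
move=> fA f_surj f_eq [_ _ transE] [g [gB g_inj g_surj]].
exists (f \o g); split=> [i|i j Eij|x Ax]; first exact/fA/gB.
  by apply: g_inj; apply/f_eq.
have [u Bu Exu] := f_surj x Ax; have [i Eui] := g_surj u Bu; exists i.
by apply: transE Exu _; apply/f_eq.
Qed.

Lemma has_card_bij (T U : Type) (A : T -> Prop) (B : U -> Prop) (f : U -> T) n :
  (forall u, B u -> A (f u)) -> (forall x, A x -> exists2 u, B u & x = f u) ->
  (forall u v, B u -> B v -> f u = f v -> u = v) -> has_card B n -> has_card A n.
Proof.
move=> fA f_surj f_inj; apply: card_mod_bij (fA) (f_surj) _ eq_equivalence.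
by move=> u v Bu Bv; split=> [|->//]; apply: f_inj.
Qed.

Lemma has_card_ext (T : Type) (A B : T -> Prop) n :
  (forall x, A x <-> B x) -> has_card A n -> has_card B n.
Proof.
by move=> AB; apply: (@has_card_bij _ _ _ _ id) => // x /AB; last exists x.
Qed.

Lemma card_mod_sum (T U : Type) (E : T -> T -> Prop) (E' : U -> U -> Prop)
    (A : T -> Prop) (B : U -> Prop) (f : T -> U) n (e : 'I_n -> U) (k : 'I_n -> nat) :
  Equivalence E' -> (forall i j, E' (e i) (e j) -> i = j) ->
  (forall u, B u -> exists i, E' u (e i)) ->
  (forall x, A x -> B (f x)) -> (forall x y, A x -> A y -> E x y -> E' (f x) (f y)) ->
  (forall i, card_mod E (fun x => A x /\ E' (f x) (e i)) (k i)) ->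
  card_mod E A (\sum_i k i).
Proof.
move=> [_ symE' transE'] e_inj e_surj fB f_eq fib.
pose g i := sval (cid (fib i)); have gP i := svalP (cid (fib i)).
have <- : #|{: {i : 'I_n & 'I_(k i)}}| = (\sum_i k i)%N.
  rewrite card_tagged sumnE big_map big_enum /=; apply: eq_bigr => i _.
  by rewrite card_ord.
apply: (@card_mod_finType _ E A _ (fun p : {i : 'I_n & 'I_(k i)} => g (tag p) (tagged p))).
- by move=> [i j] /=; have [gA _ _] := gP i; case: (gA j).
- move=> [i j] [i' j'] /= Eg.
  have [gA g_inj _] := gP i; have [gA' _ _] := gP i'.
  have [[Aj fj] [Aj' fj']] := (gA j, gA' j').
  have ii' : i = i'.
    apply: e_inj; apply: (transE' _ _ _ (symE' _ _ fj)).
    by apply: transE' fj'; apply: f_eq.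
  by case: _ / ii' in j' Eg Aj' fj' gA' *; rewrite (g_inj j j').
- move=> x Ax; have [i Ei] := e_surj _ (fB x Ax).
  have [_ _ g_surj] := gP i; have [//|j Ej] := g_surj x.
  by exists (Tagged (fun i => 'I_(k i)) j).
Qed.

Lemma card_mod_mul (T U : Type) (E : T -> T -> Prop) (E' : U -> U -> Prop)
    (A : T -> Prop) (B : U -> Prop) (f : T -> U) n k :
  Equivalence E' -> card_mod E' B n ->
  (forall x, A x -> B (f x)) -> (forall x y, A x -> A y -> E x y -> E' (f x) (f y)) ->
  (forall u, B u -> card_mod E (fun x => A x /\ E' (f x) u) k) ->
  card_mod E A (n * k)%N.
Proof.
move=> eqE' [e [eB e_inj e_surj]] fB f_eq fib.
have -> : (n * k)%N = (\sum_(i < n) k)%N by rewrite sum_nat_const card_ord.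
by apply: (card_mod_sum eqE' e_inj e_surj fB f_eq) => i; apply: fib.
Qed.

Lemma has_card_mul (T U : Type) (A : T -> Prop) (B : U -> Prop) (f : T -> U) n k :
  has_card B n -> (forall x, A x -> B (f x)) ->
  (forall u, B u -> has_card (fun x => A x /\ f x = u) k) -> has_card A (n * k)%N.
Proof.
move=> cB fB; apply: card_mod_mul eq_equivalence cB fB _.
by move=> x y _ _ ->.
Qed.

Lemma has_card_prod (T U : Type) (A : T -> Prop) (B : U -> Prop) n m :
  has_card A n -> has_card B m -> has_card (fun p : T * U => A p.1 /\ B p.2) (n * m)%N.
Proof.
move=> [f [fA f_inj f_surj]] [g [gB g_inj g_surj]].
have <- : #|{: 'I_n * 'I_m}| = (n * m)%N by rewrite card_prod !card_ord.
apply: (@card_mod_finType _ _ _ _ (fun p => (f p.1, g p.2))).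
- by move=> [i j] /=; split.
- by move=> [i j] [i' j'] [] /f_inj -> /g_inj ->.
- by move=> [x u] /= [/f_surj[i ->] /g_surj[j ->]]; exists (i, j).
Qed.

Lemma finite_pigeonhole (T : Type) (u : nat -> T) :
  finite_mod eq (fun _ : T => True) -> exists i j, (i < j)%N /\ u i = u j.
Proof.
move=> [n [f [_ _ f_surj]]].
have /choice[r rP] : forall k : 'I_n.+1, exists i, u k = f i by move=> k; apply: f_surj.
have /injectivePn[i [j ij E]] : ~~ injectiveb r.
  by apply/negP => /injectiveP/leq_card; rewrite !card_ord ltnn.
wlog lt_ij : i j ij E / (i < j)%N => [th|].
  case: (ltngtP i j) => [lt|lt|/val_inj eq_ij]; first exact: (th i j).
    by apply: (th j i) => //; rewrite eq_sym.
  by rewrite eq_ij eqxx in ij.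
by exists i, j; split=> //; rewrite rP E -rP.
Qed.

Lemma ncard_bij (T U : Type) (A : T -> Prop) (B : U -> Prop) (f : T -> U) (g : U -> T) :
  cancel f g -> cancel g f -> (forall x, A x <-> B (f x)) -> ncard A = ncard B.
Proof.
move=> fK gK AB; rewrite /ncard; congr (xget _ _); apply: funext => n.
apply: propext; split=> -[e [e_inj eP]].
  exists (f \o e); split=> [i j /(can_inj fK)/e_inj//|u].
  rewrite -(gK u) -AB eP; split=> -[i E]; exists i; first by rewrite /= E.
  exact: (can_inj fK).
exists (g \o e); split=> [i j /(can_inj gK)/e_inj//|x].
rewrite AB eP; split=> -[i E]; exists i; first by rewrite /= E.
by rewrite -E /= gK.
Qed.

Lemma ncard_neq0 (T : Type) (A : T -> Prop) : ncard A <> 0%N -> exists x, A x.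
Proof.
rewrite /ncard; case: xgetP => [n _ [f [_ fA]] n0|//].
have n_gt0 : (0 < n)%N by rewrite lt0n; apply/eqP.
by exists (f (Ordinal n_gt0)); apply/fA; exists (Ordinal n_gt0).
Qed.

End CardMod.

Section CategoryCounting.
Variable C : category.
Implicit Types A B M N P : C.

Lemma isomorphic_equiv : Equivalence (@isomorphic C).
Proof.
by split=> [A|A B|A B M]; [exact: isomorphic_refl|exact: isomorphic_sym|exact: isomorphic_trans].
Qed.

(* The powers of an injective endomorphism repeat, so it is a root of the identity. *)
Lemma mono_end_iso M (f : hom M M) :
  finite_mod eq (fun _ : hom M M => True) -> is_mono f -> is_iso f.
Proof.
move=> finM f_mono; pose u k := iter k (fun h : hom M M => comp f h) (idm M).
have uD k l : u (k + l)%N = comp (u k) (u l).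
  elim: k => [|k ih]; first by rewrite comp_idl.
  by rewrite addSn -[LHS]/(comp f (u (k + l)%N)) ih comp_assoc.
have u_mono k : is_mono (u k).
  elim: k => [|k ih] P g h; first by rewrite !comp_idl.
  by rewrite -[u k.+1]/(comp f (u k)) -!comp_assoc => /f_mono/ih.
have [i [j [ij uij]]] := finite_pigeonhole u finM.
have [k jiE] : exists k, (j = i + k.+1)%N by exists (j - i).-1; lia.
have uk : u k.+1 = idm M by apply: (u_mono i); rewrite -uD -jiE -uij comp_idr.
exists (u k); split; last by rewrite -uk.
by rewrite -uk -addn1 uD -[u 1%N]/(comp f _) comp_idr.
Qed.

Lemma hom_card_iso M M' P P' : isomorphic M M' -> isomorphic P P' ->
  hom_card M P = hom_card M' P'.
Proof.
move=> [f [f' [f'f ff']]] [g [g' [g'g gg']]].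
apply: (ncard_bij (f := fun u => comp g (comp u f')) (g := fun v => comp g' (comp v f))) => //.
- by move=> u; rewrite !comp_assoc g'g comp_idl -comp_assoc f'f comp_idr.
- by move=> u; rewrite !comp_assoc gg' comp_idl -comp_assoc ff' comp_idr.
Qed.

Lemma aut_card_iso M P : isomorphic M P -> aut_card M = aut_card P.
Proof.
move=> [f f_iso]; have [g [gf fg]] := f_iso; have g_iso : is_iso g by exists f.
have fK : cancel (fun u => comp f (comp u g)) (fun v => comp g (comp v f)).
  by move=> u; rewrite !comp_assoc gf comp_idl -comp_assoc gf comp_idr.
apply: (ncard_bij fK) => [v|u].
  by rewrite !comp_assoc fg comp_idl -comp_assoc fg comp_idr.
split=> u_iso; first exact: is_iso_comp f_iso (is_iso_comp u_iso g_iso).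
by rewrite -[u]fK; exact: is_iso_comp g_iso (is_iso_comp u_iso f_iso).
Qed.

Lemma is_cokernel_iso A A' B M (i : hom B M) (p : hom M A) (u : hom A A') :
  is_iso u -> is_cokernel p i -> is_cokernel (comp u p) i.
Proof.
move=> [v [vu uv]] [[Z [Z0 [g [h pi_gh]]]] p_univ]; split.
  by exists Z; split=> //; exists g, (comp u h); rewrite -comp_assoc pi_gh comp_assoc.
move=> X q /p_univ[w [wp w_unique]]; exists (comp w v); split.
  by rewrite -comp_assoc [comp v _]comp_assoc vu comp_idl.
move=> w'; rewrite comp_assoc => /w_unique ->.
by rewrite -comp_assoc uv comp_idr.
Qed.

Lemma hall_iso A A' B B' M : isomorphic A A' -> isomorphic B B' -> hall A B M = hall A' B' M.
Proof.
have sub A1 A2 B1 B2 K : isomorphic A1 A2 -> isomorphic B1 B2 ->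
    (exists P (i : hom P M), [/\ is_mono i, isomorphic P B1,
       exists p : hom M A1, is_cokernel p i & K = sub_class i]) ->
    exists P (i : hom P M), [/\ is_mono i, isomorphic P B2,
       exists p : hom M A2, is_cokernel p i & K = sub_class i].
  move=> [u u_iso] B12 [P [i [i_mono PB1 [p p_coker] KE]]]; exists P, i; split=> //.
    exact: isomorphic_trans PB1 B12.
  by exists (comp u p); apply: is_cokernel_iso.
move=> AA' BB'; congr (ncard _); apply: funext => K; apply: propext.
by split; apply: sub => //; apply: isomorphic_sym.
Qed.

Lemma sum_iso_eq (f : C -> rat) n (e : 'I_n -> C) :
  (forall M P, isomorphic M P -> f M = f P) ->
  (forall i j, isomorphic (e i) (e j) -> i = j) ->
  (forall M, f M <> 0 -> exists i, isomorphic M (e i)) -> sum_iso f = \sum_i f (e i).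
Proof.
move=> f_iso e_inj e_supp; have [_ symC transC] := isomorphic_equiv.
have double m (e1 : 'I_m -> C) m' (e2 : 'I_m' -> C) :
    (forall i j, isomorphic (e2 i) (e2 j) -> i = j) ->
    (forall M, f M <> 0 -> exists i, isomorphic M (e2 i)) ->
    \sum_i f (e1 i) = \sum_i \sum_j if `[< isomorphic (e1 i) (e2 j) >] then f (e1 i) else 0.
  move=> e2_inj e2_supp; apply: eq_bigr => i _.
  have [f0|/eqP f0] := eqVneq (f (e1 i)) 0.
    by rewrite big1 // => j _; rewrite f0 if_same.
  have [j ij] := e2_supp _ f0; rewrite (bigD1 j) //= (asboolT ij) big1 ?addr0 // => l lj.
  case: asboolP => // il; case/eqP: lj; apply: e2_inj.
  exact: transC (symC _ _ il) ij.
rewrite /sum_iso; case: xgetP => [v _ [m [e' [e'_inj e'_supp ->]]]|no]; last first.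
  by case: (no (\sum_i f (e i))); exists n, e.
rewrite (double _ _ _ _ e_inj e_supp) [RHS](double _ _ _ _ e'_inj e'_supp) exchange_big /=.
apply: eq_bigr => i _; apply: eq_bigr => j _.
have -> : `[< isomorphic (e i) (e' j) >] = `[< isomorphic (e' j) (e i) >].
  by apply: asbool_equiv_eq; split; apply: symC.
by case: asboolP => // ij; apply: f_iso.
Qed.

End CategoryCounting.

(** * Normal forms in the coordinate algebra *)

Section Dehomogenisation.
Variables (F : fieldType) (X : wpl F).
Local Notation t := (wt_n X).+2.
Local Notation A := (Aalg X).
Local Notation poly := {mpoly F[t]}.
Local Notation o1 := (lift ord0 ord0 : 'I_t).
Implicit Types (i : 'I_t) (m : 'X_{1..t}) (p q : {poly F}) (a b : A).

Definition pt_coord i : F := odflt 0 (pt X i).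
Definition linform i : {poly F} := if i == ord0 then 1 else 'X - (pt_coord i)%:P.
Definition dehom_mon m : {poly F} := \prod_i linform i ^+ (m i %/ wt X i).

(* The power X_i ^ p_i is sent to [linform i], its value in the affine coordinate
   of P^1, and the part of a monomial not divisible by these powers to 1; this is
   not multiplicative. *)
Definition dehom_poly (f : poly) : {poly F} := \sum_(m <- msupp f) f@_m *: dehom_mon m.

Lemma dehom_polyE (f : poly) k : (msize f <= k)%N ->
  dehom_poly f = \sum_(m : 'X_{1..t < k}) f@_m *: dehom_mon m.
Proof.
move=> le_fk; set I : subFinType _ := 'X_{1..t < k}.
rewrite /dehom_poly (big_mksub I) ?msupp_uniq //=; first last.
  by move=> m /msize_mdeg_lt /leq_trans; apply.
by rewrite big_rmcond //= => m /memN_msupp_eq0 ->; rewrite scale0r.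
Qed.

Lemma dehom_polyB : {morph dehom_poly : f g / f - g}.
Proof.
move=> f g; pose k := maxn (msize (f - g)) (maxn (msize f) (msize g)).
rewrite !(@dehom_polyE _ k) ?leq_max ?leqnn ?orbT // -sumrB; apply: eq_bigr => m _.
by rewrite mcoeffB scalerBl.
Qed.

HB.instance Definition _ :=
  GRing.isZmodMorphism.Build poly {poly F} dehom_poly dehom_polyB.

Lemma dehom_polyZ c f : dehom_poly (c *: f) = c *: dehom_poly f.
Proof.
rewrite (@dehom_polyE _ (msize f)) ?msizeZ_le // (@dehom_polyE f (msize f)) //.
by rewrite scaler_sumr; apply: eq_bigr => m _; rewrite mcoeffZ scalerA.
Qed.

Lemma dehom_polyX m : dehom_poly 'X_[m] = dehom_mon m.
Proof. by rewrite /dehom_poly msuppX big_seq1 mcoeffX eqxx scale1r. Qed.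

Lemma dehom_mon_wt i m : dehom_mon (U_(i) *+ wt X i + m)%MM = linform i * dehom_mon m.
Proof.
rewrite /dehom_mon (bigD1 i) //= [in RHS](bigD1 i) //= mulrA; congr (_ * _).
  rewrite mnmDE mulmnE mnm1E eqxx mul1n divnDl ?dvdnn // divnn wt_gt0.
  by rewrite exprD expr1.
by apply: eq_bigr => j ji; rewrite mnmDE mulmnE mnm1E eq_sym (negbTE ji) mul0n add0n.
Qed.

Lemma dehom_poly_wt i f : dehom_poly ('X_i ^+ wt X i * f) = linform i * dehom_poly f.
Proof.
rewrite {1}[f]mpolyE mulr_sumr raddf_sum /= [in RHS]/dehom_poly mulr_sumr.
apply: eq_bigr => m _.
by rewrite -!scalerAr dehom_polyZ mpolyXn -mpolyXD dehom_polyX dehom_mon_wt.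
Qed.

Lemma pt_coord1 : pt_coord o1 = 0. Proof. by rewrite /pt_coord (pt1 X). Qed.

Lemma linform0 : linform ord0 = 1. Proof. by rewrite /linform eqxx. Qed.

Lemma linformE i : i != ord0 -> linform i = 'X - (pt_coord i)%:P.
Proof. by rewrite /linform => /negbTE ->. Qed.

Lemma linform1 : linform o1 = 'X. Proof. by rewrite linformE // pt_coord1 subr0. Qed.

Lemma linform_neq0 i : linform i != 0.
Proof. by rewrite /linform; case: ifP => _; rewrite ?oner_eq0 ?polyXsubC_eq0. Qed.

Lemma size_linformM i n p : (size p <= n.+1)%N -> (size (linform i * p)%R <= n.+2)%N.
Proof.
move=> sp; apply: leq_trans (size_polyMleq _ _) _.
have : (size (linform i) <= 2)%N.
  by rewrite /linform; case: ifP => _; rewrite ?size_polyC ?oner_eq0 // size_XsubC.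
by lia.
Qed.

Lemma dehom_mon_neq0 m : dehom_mon m != 0.
Proof. by apply/prodf_neq0 => i _; rewrite expf_neq0 ?linform_neq0. Qed.

Lemma dehom_poly_ideal f : f \in @Aideal F X -> dehom_poly f = 0.
Proof.
move=> /asboolP[g ->]; rewrite raddf_sum big1 //= => i i2.
have i0 : i != ord0 by apply: contraTneq i2 => ->.
rewrite mulrC /frel mulrDl mulrBl raddfD raddfB /= -mulrA mul_mpolyC dehom_polyZ.
rewrite !dehom_poly_wt (linformE i0) linform1 linform0 mul1r -/(pt_coord i).
by rewrite -mul_polyC; ring.
Qed.

Definition dehom a : {poly F} := dehom_poly (repr a).

Lemma dehom_pi f : dehom (\pi_(Aalg X) f) = dehom_poly f.
Proof.
apply/eqP; rewrite -subr_eq0 -raddfB; apply/eqP/dehom_poly_ideal.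
by rewrite Quotient.idealrBE reprK.
Qed.

Lemma dehomB : {morph dehom : a b / a - b}.
Proof.
move=> a b; have [f ->] := Apr_lift a; have [g ->] := Apr_lift b.
by rewrite -[_ - _](raddfB (\pi_(Aalg X))) !dehom_pi raddfB.
Qed.

HB.instance Definition _ := GRing.isZmodMorphism.Build A {poly F} dehom dehomB.

Lemma dehomZ c a : dehom (Aconst X c * a) = c *: dehom a.
Proof.
have [f ->] := Apr_lift a.
by rewrite -[_ * _](rmorphM (\pi_(Aalg X))) !dehom_pi mul_mpolyC dehom_polyZ.
Qed.

Lemma dehom_Amon m : dehom (Amon m) = dehom_mon m.
Proof. by rewrite /Amon dehom_pi dehom_polyX. Qed.

Lemma dehom1 : dehom 1 = 1.
Proof.
by rewrite -Amon0 dehom_Amon /dehom_mon big1 // => i _; rewrite mnm0E div0n.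
Qed.

Definition Tvar i : A := Avar i ^+ wt X i.

Lemma dehom_Tvar i a : dehom (Tvar i * a) = linform i * dehom a.
Proof.
have [f ->] := Apr_lift a; rewrite /Tvar /Avar -rmorphXn.
by rewrite -[_ * _](rmorphM (\pi_(Aalg X))) !dehom_pi dehom_poly_wt.
Qed.

Lemma dehom_TvarX i k a : dehom (Tvar i ^+ k * a) = linform i ^+ k * dehom a.
Proof.
by elim: k => [|k ih]; rewrite ?mul1r // !exprS -!mulrA dehom_Tvar ih.
Qed.

Lemma TvarE i : i != ord0 -> Tvar i = Tvar o1 - Aconst X (pt_coord i) * Tvar ord0.
Proof.
move=> i0; have [i2|i2] := ltnP 1 i.
  apply/eqP; rewrite -subr_eq0; apply/eqP.
  rewrite /Tvar /Avar /Aconst -!rmorphXn -rmorphM -!rmorphB.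
  rewrite -(rmorph0 (\pi_(Aalg X))); apply/eqP; rewrite -Quotient.idealrBE subr0.
  apply/asboolP; exists (fun j => (j == i)%:R).
  rewrite (bigD1 i) //= eqxx mul1r big1 ?addr0 => [|j /andP[_ /negbTE ->]]; last exact: mul0r.
  by rewrite /frel opprB addrCA addrC -addrA [- _ + _]addrC.
have -> : i = o1.
  by apply: val_inj; move: i0 i2; rewrite -(inj_eq val_inj) /=; case: (nat_of_ord i) => [|[]].
by rewrite pt_coord1 rmorph0 mul0r subr0.
Qed.

Definition homogenize n p : A :=
  \sum_(j < n.+1) Aconst X p`_j * (Tvar o1 ^+ j * Tvar ord0 ^+ (n - j)).

Lemma homogenizeB n : {morph homogenize n : p q / p - q}.
Proof.
move=> p q; rewrite /homogenize -sumrB; apply: eq_bigr => j _.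
by rewrite coefB rmorphB mulrBl.
Qed.

HB.instance Definition _ n :=
  GRing.isZmodMorphism.Build {poly F} A (homogenize n) (homogenizeB n).

Lemma homogenizeZ n c p : homogenize n (c *: p) = Aconst X c * homogenize n p.
Proof.
by rewrite /homogenize mulr_sumr; apply: eq_bigr => j _; rewrite coefZ rmorphM -mulrA.
Qed.

Lemma homogenize1 : homogenize 0 1 = 1.
Proof. by rewrite /homogenize big_ord1 coef1 eqxx rmorph1 !expr0 !mulr1. Qed.

Lemma Tvar0_homogenize n p : (size p <= n.+1)%N ->
  Tvar ord0 * homogenize n p = homogenize n.+1 p.
Proof.
move=> sp; rewrite {2}/homogenize big_ord_recr /= nth_default // rmorph0 mul0r addr0.
rewrite /homogenize mulr_sumr; apply: eq_bigr => j _.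
by rewrite subSn -1?ltnS // exprS; ring.
Qed.

Lemma Tvar1_homogenize n p : Tvar o1 * homogenize n p = homogenize n.+1 ('X * p).
Proof.
rewrite {2}/homogenize big_ord_recl /= coefXM /= rmorph0 mul0r add0r.
rewrite /homogenize mulr_sumr; apply: eq_bigr => j _.
by rewrite coefXM /= /bump /= add1n subSS exprS; ring.
Qed.

Lemma Tvar_homogenize i n p : (size p <= n.+1)%N ->
  Tvar i * homogenize n p = homogenize n.+1 (linform i * p).
Proof.
move=> sp; have [->|i0] := eqVneq i ord0; first by rewrite linform0 mul1r Tvar0_homogenize.
rewrite TvarE // linformE // mulrBl -mulrA Tvar0_homogenize // Tvar1_homogenize.
by rewrite mulrBl raddfB /= mul_polyC homogenizeZ.
Qed.

Lemma prod_TvarX (r : seq 'I_t) (e : 'I_t -> nat) :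
  (size (\prod_(i <- r) linform i ^+ e i)%R <= (\sum_(i <- r) e i).+1)%N /\
  \prod_(i <- r) Tvar i ^+ e i =
    homogenize (\sum_(i <- r) e i) (\prod_(i <- r) linform i ^+ e i).
Proof.
elim: r => [|i r [sz ih]]; first by rewrite !big_nil homogenize1 size_polyC oner_eq0.
rewrite !big_cons ih.
elim: (e i) => [|k [sk ihk]]; first by rewrite !expr0 !mul1r add0n.
by rewrite !exprS addSn -!mulrA; split; rewrite ?size_linformM // ihk Tvar_homogenize.
Qed.

Lemma dehom_homogenize n p a : (size p <= n.+1)%N ->
  dehom (homogenize n p * a) = p * dehom a.
Proof.
move=> sp; rewrite /homogenize mulr_suml raddf_sum /=.
under eq_bigr do
  rewrite -!mulrA dehomZ !dehom_TvarX linform0 linform1 expr1n mul1r scalerAl.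
rewrite -mulr_suml -(poly_def n.+1 (fun j => p`_j)); congr (_ * _).
apply/polyP => j; rewrite coef_poly; case: ltnP => // le.
by rewrite nth_default // (leq_trans sp).
Qed.

Lemma homogenizeK n p : (size p <= n.+1)%N -> dehom (homogenize n p) = p.
Proof. by move=> sp; rewrite -[homogenize n p]mulr1 dehom_homogenize // dehom1 mulr1. Qed.

End Dehomogenisation.

Arguments Tvar {F X} i.
Arguments homogenize {F} X n p.

Section NormalForm.
Variables (F : fieldType) (X : wpl F).
Local Notation t := (wt_n X).+2.
Local Notation A := (Aalg X).
Local Notation L := (Lgrp X).
Local Notation o1 := (lift ord0 ord0 : 'I_t).
Local Notation large := (large_degree X).
Implicit Types (i : 'I_t) (y z : L) (a b : A) (m : 'X_{1..t}).

Definition row_coord i (v : 'rV[int]_t) : int := v 0 i.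

Lemma row_coordB i : {morph row_coord i : u v / u - v}.
Proof. by move=> u v; rewrite /row_coord !mxE. Qed.

HB.instance Definition _ i := GRing.isZmodMorphism.Build _ _ (row_coord i) (row_coordB i).

Lemma row_coord_delta i j : row_coord i (delta_mx 0 j) = (i == j)%:R.
Proof. by rewrite /row_coord mxE. Qed.

Lemma row_coord_Lrel v i : v \in @Lrel F X -> ((wt X i)%:Z %| row_coord i v)%Z.
Proof.
move=> /asboolP[c ->]; rewrite raddf_sum; apply: rpred_sum => j _.
rewrite raddf_sum; apply: rpred_sum => k _.
have dv l : row_coord i (delta_mx 0 l *+ wt X l) \in dvdz (wt X i)%:Z.
  rewrite raddfMn /= row_coord_delta; case: eqP => [->|_]; last by rewrite mul0rn dvdz0.
  by rewrite mulr1n natz dvdzz.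
by rewrite raddfMz /= raddfB; apply: rpredMz; apply: rpredB; apply: dv.
Qed.

Definition Lcan : L := Lgen (ord0 : 'I_t) *+ wt X ord0.

(* With c = [Lcan], every y in L is uniquely l_1 x_1 + ... + l_t x_t + l c with
   0 <= l_i < p_i; here l_i = [nf_coef y i] and l = [nf_mult y]. *)
Definition nf_coef y i : nat := `|(row_coord i (repr y) %% (wt X i)%:Z)%Z|%N.
Definition nf_mult y : int := \sum_i (row_coord i (repr y) %/ (wt X i)%:Z)%Z.
Definition nf_mnm y : 'X_{1..t} := [multinom nf_coef y i | i < t].

Lemma Lgen_wt i : Lgen i *+ wt X i = Lcan. Proof. exact: Lgen_rel. Qed.

Lemma ldeg_can : ldeg Lcan = (wt_prod X)%:Z.
Proof.
by rewrite /Lcan raddfMn /= ldeg_gen -mulr_natr natz -PoszM gen_deg_wt.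
Qed.

Lemma nf_coef_lt y i : (nf_coef y i < wt X i)%N.
Proof.
rewrite -ltz_nat /nf_coef gez0_abs ?ltz_pmod ?modz_ge0 ?ltz_nat ?wt_gt0 //.
by have := wt_gt0 X i; lia.
Qed.

Lemma nf_coefE y i : row_coord i (repr y) =
  (nf_coef y i)%:Z + (wt X i)%:Z * (row_coord i (repr y) %/ (wt X i)%:Z)%Z.
Proof.
rewrite /nf_coef gez0_abs ?modz_ge0 //; last by have := wt_gt0 X i; lia.
by rewrite addrC mulrC -divz_eq.
Qed.

Lemma ldeg_nf y :
  ldeg y = (\sum_i nf_coef y i * gen_deg X i)%N%:Z + nf_mult y * (wt_prod X)%:Z.
Proof.
rewrite /ldeg /vdeg (big_morph Posz PoszD (erefl _)) /nf_mult mulr_suml -big_split /=.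
apply: eq_bigr => i _; rewrite -[repr y 0 i]/(row_coord i (repr y)).
by rewrite [X in X * _ = _]nf_coefE -(gen_deg_wt i) !PoszM; ring.
Qed.

Lemma nf_eq y : y = mdegL (nf_mnm y) + Lcan *~ nf_mult y.
Proof.
have E : y = \sum_i Lgen i *~ (row_coord i (repr y)).
  rewrite -{1}[y]reprK /Lgen; set v := repr y.
  rewrite {1}[v]matrix_sum_delta big_ord1 raddf_sum /=; apply: eq_bigr => i _.
  by rewrite -[_ *: _]/(v 0 i *: delta_mx 0 i) -{1}[v 0 i]intz scaler_int raddfMz.
rewrite {1}E /mdegL /nf_mult mulrz_sumr -big_split /=; apply: eq_bigr => i _.
rewrite [X in _ *~ X = _]nf_coefE mnmE mulrzDr; congr (_ + _).
by rewrite mulrzA -pmulrn Lgen_wt.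
Qed.

Lemma nf_coef_unique y m (k : int) i : y = mdegL m + Lcan *~ k ->
  nf_coef y i = (m i %% wt X i)%N.
Proof.
move=> yE; pose v : 'rV[int]_t := \row_i (m i)%:Z + (delta_mx 0 ord0 *+ wt X ord0) *~ k.
have vE : y = \pi_(Lgrp X) v.
  rewrite yE raddfD raddfMz raddfMn /=; congr (_ + _).
  rewrite /mdegL [\row_i _ in RHS]matrix_sum_delta big_ord1 raddf_sum /=.
  by apply: eq_bigr => j _; rewrite mxE -[(m j)%:Z]intz scaler_int raddfMz.
have : repr y - v \in @Lrel F X by rewrite Quotient.idealrBE reprK vE.
move=> /(row_coord_Lrel i); rewrite raddfB /= raddfD /= raddfMz raddfMn /= row_coord_delta.
rewrite [row_coord i (\row_i _)]mxE => dvd_v.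
have dvd0 : ((i == ord0)%:R *+ wt X ord0) *~ k \in dvdz (wt X i)%:Z.
  apply: rpredMz; case: eqP => [->|_]; last by rewrite mul0rn dvdz0.
  by rewrite mulr1n natz dvdzz.
have := rpredD dvd_v dvd0; rewrite opprD addrA subrK.
by rewrite -[_ \in _]eqz_mod_dvd => /eqP E; rewrite /nf_coef E modz_nat.
Qed.

Lemma nf_mult_unique y m (k : int) : y = mdegL m + Lcan *~ k ->
  nf_mult y = (\sum_i m i %/ wt X i)%N%:Z + k.
Proof.
move=> yE; have : ldeg y = (\sum_i (m i %% wt X i) * gen_deg X i)%N%:Z +
    ((\sum_i m i %/ wt X i)%N%:Z + k) * (wt_prod X)%:Z.
  rewrite yE raddfD raddfMz /= ldeg_can ldeg_mdegL mulrDl addrA.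
  rewrite -[_ *~ k]mulrzl intz; congr (_ + _).
  rewrite -PoszM -PoszD big_distrl -big_split /=; congr Posz.
  apply: eq_bigr => i _; rewrite {1}(divn_eq (m i) (wt X i)) mulnDl -mulnA addnC.
  by rewrite [(wt X i * _)%N]mulnC gen_deg_wt.
rewrite ldeg_nf (eq_bigr (fun i => m i %% wt X i * gen_deg X i)%N) => [|i _].
  by move=> /addrI /mulIf; apply; have := wt_prod_gt0 X; lia.
by rewrite (nf_coef_unique i yE).
Qed.

Lemma Amon_nf m : Amon m = Amon [multinom m i %% wt X i | i < t] *
  \prod_i Tvar i ^+ (m i %/ wt X i) :> A.
Proof.
rewrite !AmonE -big_split /=; apply: eq_bigr => i _.
by rewrite mnmE /Tvar -exprM -exprD mulnC addnC -divn_eq.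
Qed.

Lemma normal_form y a : Ahomog y a ->
  (size (dehom a) <= `|nf_mult y|.+1)%N /\
  a = Amon (nf_mnm y) * homogenize X `|nf_mult y| (dehom a).
Proof.
move: a; apply: Ahomog_ind.
- by rewrite raddf0 size_poly0 raddf0 mulr0.
- move=> a b [sa ea] [sb eb]; rewrite !raddfD /= mulrDr -ea -eb; split=> //.
  by apply: leq_trans (size_polyD _ _) _; rewrite geq_max sa.
move=> c m my; have yE : y = mdegL m + Lcan *~ 0 by rewrite mulr0z addr0.
rewrite (nf_mult_unique yE) addr0 absz_nat.
have [sz prodE] := prod_TvarX (index_enum _) (fun i => m i %/ wt X i)%N.
rewrite dehomZ dehom_Amon homogenizeZ; split; first exact: leq_trans (size_scale_leq _ _) _.
rewrite mulrCA; congr (_ * _); rewrite Amon_nf prodE; congr (Amon _ * _).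
by apply/mnmP => i; rewrite !mnmE (nf_coef_unique i yE).
Qed.

Lemma Ahomog_nf_neg y a : nf_mult y < 0 -> Ahomog y a -> a = 0.
Proof.
move=> y_lt0; move: a; apply: Ahomog_ind => // [a b -> ->|c m my]; first by rewrite addr0.
have yE : y = mdegL m + Lcan *~ 0 by rewrite mulr0z addr0.
by move: y_lt0; rewrite (nf_mult_unique yE); lia.
Qed.

Lemma dehom_inj y a b : Ahomog y a -> Ahomog y b -> dehom a = dehom b -> a = b.
Proof. by move=> /normal_form[_ {2}->] /normal_form[_ {2}->] ->. Qed.

Lemma dehom_eq0 y a : Ahomog y a -> dehom a = 0 -> a = 0.
Proof. by move=> ha a0; apply: (dehom_inj ha (Ahomog0 y)); rewrite a0 raddf0. Qed.

Lemma Ahomog_Tvar i : Ahomog Lcan (Tvar i).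
Proof. by rewrite -(Lgen_wt i); apply: Ahomog_varX. Qed.

Lemma Ahomog_homogenize n p : Ahomog (Lcan *+ n) (homogenize X n p).
Proof.
apply: Ahomog_sum => j; apply: AhomogZ.
have -> : Lcan *+ n = Lcan *+ j + Lcan *+ (n - j) by rewrite -mulrnDr subnKC // -ltnS.
by apply: AhomogM; apply: AhomogX; apply: Ahomog_Tvar.
Qed.

Lemma homogenizeM n k (p q : {poly F}) : (size p <= n.+1)%N -> (size q <= k.+1)%N ->
  homogenize X n p * homogenize X k q = homogenize X (n + k) (p * q).
Proof.
move=> sp sq; apply: (@dehom_inj (Lcan *+ (n + k))).
- by rewrite mulrnDr; apply: AhomogM; apply: Ahomog_homogenize.
- exact: Ahomog_homogenize.
rewrite dehom_homogenize // !homogenizeK //.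
by apply: leq_trans (size_polyMleq _ _) _; lia.
Qed.

Lemma dehomM y z a b : Ahomog y a -> Ahomog z b ->
  dehom (a * b) = dehom a * dehom b * dehom_mon (nf_mnm y + nf_mnm z).
Proof.
move=> /normal_form[sa {1}->] /normal_form[sb {1}->].
rewrite mulrACA -AmonD homogenizeM // mulrC dehom_homogenize ?dehom_Amon //.
by apply: leq_trans (size_polyMleq _ _) _; lia.
Qed.

Lemma Apr_mul y z a b : Ahomog z a -> Apr y (a * b) = a * Apr (y - z) b.
Proof. exact: (@gpr_act_sub _ _ (Amod X)). Qed.

Lemma Ahomog_mulf_eq0 y a b : Ahomog y a -> a * b = 0 -> a = 0 \/ b = 0.
Proof.
move=> ha ab0; have [|a0] := pselect (a = 0); [by left|right].
apply: (@gpr_ext _ _ (Amod X)) => z; rewrite raddf0.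
have hb := Ahomog_Apr z b; apply: (dehom_eq0 hb); apply/eqP.
have : dehom (a * Apr z b) == 0.
  by rewrite -[z](addrK y) -(Apr_mul _ _ ha) ab0 Apr0 raddf0.
rewrite (dehomM ha hb) !mulf_eq0 (negbTE (dehom_mon_neq0 _)) orbF => /orP[|//].
by move=> /eqP/(dehom_eq0 ha).
Qed.

Lemma Ahomog_mulfI y a b b' : Ahomog y a -> a <> 0 -> a * b = a * b' -> b = b'.
Proof.
move=> ha a0 E; apply/eqP; rewrite -subr_eq0; apply/eqP.
by have [|//|//] := Ahomog_mulf_eq0 (b := b - b') ha; rewrite mulrBr E subrr.
Qed.

Lemma Avar_neq0 i : Avar i <> 0 :> A.
Proof.
move=> E; have : dehom (Tvar i * 1 : A) = 0.
  by rewrite /Tvar -(prednK (wt_gt0 X i)) exprS E !mul0r raddf0.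
by rewrite dehom_Tvar dehom1 mulr1; apply/eqP/linform_neq0.
Qed.

Lemma Ahomog_expf_neq0 y a n : Ahomog y a -> a <> 0 -> a ^+ n <> 0.
Proof.
move=> ha a0; elim: n => [|n ih]; first by move/eqP; rewrite expr0 oner_eq0.
by rewrite exprS => /(Ahomog_mulf_eq0 ha) [].
Qed.

Lemma dehom_varXM y a i N : Ahomog y a ->
  dehom (Avar i ^+ N * a) = linform i ^+ ((nf_coef y i + N) %/ wt X i) * dehom a.
Proof.
move=> /normal_form[sa {1}->]; rewrite mulrA -Amon_varX -AmonD mulrC dehom_homogenize //.
rewrite dehom_Amon mulrC; congr (_ * _); rewrite /dehom_mon (bigD1 i) //= big1 ?mulr1.
  by rewrite mnmDE mulmnE mnm1E eqxx mul1n mnmE addnC.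
move=> j ji; rewrite mnmDE mulmnE mnm1E eq_sym (negbTE ji) mul0n add0n mnmE.
by rewrite divn_small ?nf_coef_lt // expr0.
Qed.

Lemma nf_genMn_decomp y i N :
  y + Lgen i *+ N = mdegL (nf_mnm y + U_(i) *+ N)%MM + Lcan *~ nf_mult y.
Proof. by rewrite mdegLD mdegLn mdegL1 {1}[y]nf_eq addrAC. Qed.

Lemma nf_coef_genMn y i N j :
  nf_coef (y + Lgen i *+ N) j = ((nf_coef y j + (i == j) * N) %% wt X j)%N.
Proof.
by rewrite (nf_coef_unique j (nf_genMn_decomp y i N)) mnmDE mulmnE mnmE mnm1E.
Qed.

Lemma nf_mult_genMn y i N :
  nf_mult (y + Lgen i *+ N) = nf_mult y + ((nf_coef y i + N) %/ wt X i)%N%:Z.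
Proof.
rewrite (nf_mult_unique (nf_genMn_decomp y i N)) addrC; congr (_ + Posz _).
rewrite (bigD1 i) //= big1 ?addn0; first by rewrite mnmDE mulmnE mnm1E eqxx mul1n mnmE.
move=> j ji; rewrite mnmDE mulmnE mnm1E eq_sym (negbTE ji) mul0n addn0 mnmE.
by rewrite divn_small ?nf_coef_lt.
Qed.

Lemma Avar_dvd y a i : Ahomog y a -> (0 < nf_coef y i)%N -> exists b, a = Avar i * b.
Proof.
move=> /normal_form[_ ->] yi; have yE : nf_mnm y = (U_(i) + (nf_mnm y - U_(i)))%MM.
  by rewrite addmC submK //; apply/mnm_lepP => j; rewrite mnm1E mnmE; case: eqP => [<-|].
by rewrite yE AmonD -[U_(i)%MM]mulm1n Amon_varX expr1 -mulrA; eexists.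
Qed.

Lemma Avar0_dvd y a : Ahomog y a -> (size (dehom a) <= `|nf_mult y|)%N ->
  exists b, a = Avar ord0 * b.
Proof.
move=> ha; have [_ {2}->] := normal_form ha; case: `|_|%N => [|n] sz.
  by exists 0; rewrite (dehom_eq0 ha) ?raddf0 ?mulr0 //; apply/eqP; rewrite -size_poly_leq0.
rewrite -Tvar0_homogenize // /Tvar -(prednK (wt_gt0 X ord0)) exprS mulrCA -mulrA.
by eexists.
Qed.

Lemma size_dehom_Avar0M y b : Ahomog y b -> nf_coef (y + Lgen ord0) ord0 = 0%N ->
  (size (dehom (Avar ord0 * b)%R) <= `|nf_mult (y + Lgen ord0)%R|)%N.
Proof.
move=> hb; have := nf_coef_genMn y ord0 1 ord0; have := nf_mult_genMn y ord0 1.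
rewrite mulr1n eqxx mul1n => -> -> y0.
have -> : (nf_coef y ord0 + 1 = wt X ord0)%N.
  have := nf_coef_lt y ord0; have [|lt] := leqP (wt X ord0) (nf_coef y ord0 + 1); first by lia.
  by move: y0; rewrite modn_small // addn1.
rewrite divnn wt_gt0 -[Avar ord0]expr1 (dehom_varXM _ _ hb) linform0 expr1n mul1r.
have [y_lt0|y_ge0] := ltP (nf_mult y) 0.
  by rewrite (Ahomog_nf_neg y_lt0 hb) raddf0 size_poly0.
by have [sb _] := normal_form hb; apply: leq_trans sb _; lia.
Qed.

Lemma Avar0_dvd_of_Avar1XM y a b N : Ahomog y a -> Avar o1 ^+ N * a = Avar ord0 * b ->
  exists a', a = Avar ord0 * a'.
Proof.
move=> ha E; have [a0|a0] := pselect (a = 0); first by exists 0; rewrite mulr0.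
have [y0|y0] := posnP (nf_coef y ord0); last exact: Avar_dvd y0.
pose z := y + Lgen o1 *+ N - Lgen ord0; apply: (Avar0_dvd ha).
have hb := Ahomog_Apr z b; have zE : z + Lgen ord0 = y + Lgen o1 *+ N by rewrite subrK.
have {}E : Avar o1 ^+ N * a = Avar ord0 * Apr z b.
  have /AhomogP <- : Ahomog (y + Lgen o1 *+ N) (Avar o1 ^+ N * a).
    by rewrite addrC; apply: AhomogM => //; apply: Ahomog_varX.
  by rewrite E (Apr_mul _ _ (Ahomog_var _)).
have := size_dehom_Avar0M hb; rewrite zE nf_coef_genMn mul0n addn0 y0 mod0n => /(_ erefl).
rewrite nf_mult_genMn -E (dehom_varXM o1 N ha) linform1 size_monicM ?monicXn //.
  rewrite size_polyXn addSn /=.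
  have [y_lt0|y_ge0] := ltP (nf_mult y) 0; first by case: a0; apply: Ahomog_nf_neg ha.
  by move: (_ %/ _)%N => k; lia.
by apply/eqP => /(dehom_eq0 ha).
Qed.

Lemma Avar01_regular y a b N K : Ahomog y a -> Avar o1 ^+ N * a = Avar ord0 ^+ K * b ->
  exists2 a', Ahomog (y - Lgen ord0 *+ K) a' &
    a = Avar ord0 ^+ K * a' /\ b = Avar o1 ^+ N * a'.
Proof.
elim: K y a => [|K ih] y a ha E.
  by exists a; rewrite ?mulr0n ?subr0 // mul1r; split=> //; rewrite E mul1r.
have [|a' aE] := @Avar0_dvd_of_Avar1XM y a (Avar ord0 ^+ K * b) N ha.
  by rewrite E exprS mulrA.
have {}aE : a = Avar ord0 * Apr (y - Lgen ord0) a'.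
  by rewrite -(Apr_mul _ _ (Ahomog_var _)) -aE; apply/esym/AhomogP.
have [|a2 ha2 [a2E ->]] := ih _ _ (Ahomog_Apr (y - Lgen ord0) a').
  apply: (Ahomog_mulfI (Ahomog_var ord0)); first exact: Avar_neq0.
  by rewrite mulrCA -aE E exprS mulrA.
exists a2; first by rewrite mulrS opprD addrA.
by split=> //; rewrite aE a2E exprS mulrA.
Qed.

Lemma near_nf_mult_ge (n : int) : \forall y \near large, n <= nf_mult y.
Proof.
near=> y; have : (\sum_i wt X i * gen_deg X i)%N%:Z + n * (wt_prod X)%:Z <= ldeg y.
  by near: y; apply: near_ldeg_ge.
rewrite ldeg_nf => le_y.
have : (\sum_i nf_coef y i * gen_deg X i <= \sum_(i < t) wt X i * gen_deg X i)%N.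
  by apply: leq_sum => i _; rewrite leq_mul2r ltnW ?orbT // nf_coef_lt.
rewrite -lez_nat => le_sum; have := le_trans le_y (lerD le_sum (lexx _)).
by rewrite lerD2l ler_pM2r // ltz_nat wt_prod_gt0.
Unshelve. all: by end_near. Qed.

Lemma homogenize_in_chart_ideal N0 N1 n p : (N0 + N1 <= n)%N ->
  exists b b', homogenize X n p = Avar ord0 ^+ N0 * b + Avar o1 ^+ N1 * b'.
Proof.
move=> le_n; rewrite /homogenize; elim/big_rec: _ => [|j c _ [b [b' ->]]].
  by exists 0, 0; rewrite !mulr0 addr0.
have TvarX_dvd i N k : (N <= k)%N -> Tvar i ^+ k = Avar i ^+ N * Avar i ^+ (wt X i * k - N) :> A.
  move=> le_k; rewrite /Tvar -exprM -exprD subnKC // (leq_trans le_k) //.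
  by rewrite leq_pmull ?wt_gt0.
have [le_j|lt_j] := leqP N1 j.
  exists b, (Aconst X p`_j * (Avar o1 ^+ (wt X o1 * j - N1) * Tvar ord0 ^+ (n - j)) + b').
  by rewrite (TvarX_dvd _ _ _ le_j); ring.
exists (Aconst X p`_j * (Tvar o1 ^+ j * Avar ord0 ^+ (wt X ord0 * (n - j) - N0)) + b), b'.
by rewrite (TvarX_dvd _ N0 (n - j)%N); [ring|lia].
Qed.

Lemma near_Ahomog_chart_ideal N0 N1 : \forall y \near large, forall a, Ahomog y a ->
  exists b b', [/\ Ahomog (y - Lgen ord0 *+ N0) b, Ahomog (y - Lgen o1 *+ N1) b'
    & a = Avar ord0 ^+ N0 * b + Avar o1 ^+ N1 * b'].
Proof.
near=> y => a ha; have [_ aE] := normal_form ha.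
have le_y : (N0 + N1)%N%:Z <= nf_mult y by near: y; apply: near_nf_mult_ge.
have [|b [b' E]] := @homogenize_in_chart_ideal N0 N1 `|nf_mult y| (dehom a); first by lia.
exists (Apr (y - Lgen ord0 *+ N0) (Amon (nf_mnm y) * b)).
exists (Apr (y - Lgen o1 *+ N1) (Amon (nf_mnm y) * b')).
split; try exact: Ahomog_Apr.
rewrite -!(Apr_mul _ _ (Ahomog_varX _ _)) -AprD; have /AhomogP <- := ha.
by rewrite [in LHS]aE E; congr (Apr _ _); ring.
Unshelve. all: by end_near. Qed.

End NormalForm.

Arguments Lcan {F} X.

(** * Torsion sheaves *)

Section PowerStability.
Variables (F : finFieldType) (X : wpl F).
Local Notation t := (wt_n X).+2.
Local Notation A := (Aalg X).
Local Notation L := (Lgrp X).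
Local Notation C := (coh X).
Local Notation o1 := (lift ord0 ord0 : 'I_t).
Local Notation X0 := (Avar (ord0 : 'I_t)).
Local Notation X1 := (Avar o1).
Local Notation large := (large_degree X).
Implicit Types (M N P : C) (x y w : L) (g : A).

Lemma colon_powers_stable (M : gmod X) (U : set M) y g : gsub U -> Ahomog y g ->
  exists l, forall k (m : M), U (g ^+ k *: m) -> U (g ^+ l *: m).
Proof.
move=> gU hg; pose V : set M := [set m | exists k, U (g ^+ k *: m)].
have up k l (m : M) : (k <= l)%N -> U (g ^+ k *: m) -> U (g ^+ l *: m).
  by move=> kl Um; rewrite -(subnK kl) exprD -scalerA; apply: gsubZ.
have gV : gsub V.
  split; first by exists 0%N; rewrite scaler0; case: gU.
    move=> b m n [k Um] [l Un]; exists (k + l)%N.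
    have [_ colonD _] := gsub_colon gU (AhomogX (k + l) hg).
    by apply: colonD; [apply: up Um; rewrite leq_addr|apply: up Un; rewrite leq_addl].
  by move=> x m [k Um]; exists k; have [_ _] := gsub_colon gU (AhomogX k hg); apply.
have [s [sV V_span]] := gsub_fingen gV.
have /choice[l lP] : forall j : 'I_(size s), exists l, U (g ^+ l *: s`_j).
  by move=> j; apply/sV/mem_nth.
exists (\max_j l j)%N => k m Um; have [c ->] := span_coef (V_span m (ex_intro _ k Um)).
have colon_sub := gsub_submodule (gsub_colon gU (AhomogX (\max_j l j) hg)).
apply: (submodule_sum _ colon_sub) => j _; apply: (submoduleZ _ colon_sub).
by apply: up (lP j); apply: leq_bigmax.
Qed.

Lemma near_saturated (M : gmod X) (U : set M) : gsub U ->
  \forall x \near large, forall (m : M) k l, of_deg x m ->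
    U (X0 ^+ k *: m) -> U (X1 ^+ l *: m) -> U m.
Proof.
move=> gU; have [l0 l0P] := colon_powers_stable gU (Ahomog_var ord0).
have [l1 l1P] := colon_powers_stable gU (Ahomog_var o1).
have gV := gsubI (gsub_colon gU (Ahomog_varX ord0 l0)) (gsub_colon gU (Ahomog_varX o1 l1)).
have [n [d [e [eP e_gen]]]] := homogeneous_generators gV.
have gen_U : \forall x \near large, forall j a, Ahomog (x - d j) a -> U (a *: e j).
  apply: near_forall => j; have [[U0 U1] _] := eP j.
  have chart_ideal := near_shift (- d j) (near_Ahomog_chart_ideal X l0 l1).
  near=> x => a ha; have [//|b [b' [_ _ ->]]] := near chart_ideal x _ a ha.
  rewrite scalerDl (mulrC _ b) (mulrC _ b') -!scalerA.
  by apply: (submoduleD (gsub_submodule gU)); apply: gsubZ.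
near=> x => m k l dm /l0P Um0 /l1P Um1.
have [a [ha ->]] := e_gen x m (conj Um0 Um1) dm.
apply: (submodule_sum _ (gsub_submodule gU)) => j _.
by apply: (near gen_U x).
Unshelve. all: by end_near. Qed.

(* The chains g^n M are eventually constant: a consequence of finite length that
   passes to subobjects, quotients and extensions, and from which every property
   of torsion sheaves is derived. *)
Definition power_stable M : Prop := forall y g, Ahomog y g ->
  exists n, \forall x \near large, forall m : car M, of_deg x m ->
    exists m' : car M, g ^+ n *: m = g ^+ n.+1 *: m'.

Lemma of_deg_power_divisor (M : gmod X) x y g (m m' : M) n k : Ahomog y g -> of_deg x m ->
  g ^+ n *: m = g ^+ (n + k) *: m' -> g ^+ n *: m = g ^+ (n + k) *: gpr (x - y *+ k) m'.
Proof.
move=> hg dm E; have xE : x - y *+ k = x + y *+ n - y *+ (n + k).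
  by rewrite mulrnDr opprD addrA addrK.
by rewrite xE -(gpr_act_sub _ _ (AhomogX _ hg)) -E; apply/esym/of_degZX.
Qed.

Lemma power_stableX M y g : power_stable M -> Ahomog y g ->
  exists n, forall k, \forall x \near large, forall m : car M, of_deg x m ->
    exists2 m' : car M, of_deg (x - y *+ k) m' & g ^+ n *: m = g ^+ (n + k) *: m'.
Proof.
move=> M_stable hg; have [n nP] := M_stable y g hg; exists n.
suff divisor k : \forall x \near large, forall m : car M, of_deg x m ->
    exists m' : car M, g ^+ n *: m = g ^+ (n + k) *: m'.
  move=> k; near=> x => m dm; have [//|m' E] := near (divisor k) x _ m dm.
  by exists (gpr (x - y *+ k) m'); [apply: of_deg_gpr|apply: of_deg_power_divisor].
elim: k => [|k ih]; first by apply: nearW => x m dm; exists m; rewrite addn0.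
have shift_nP := near_shift (- (y *+ k)) nP; near=> x => m dm.
have [//|m' /(of_deg_power_divisor hg dm)->] := near ih x _ m dm.
have [//||m2 E] := near shift_nP x _ (gpr (x - y *+ k) m'); first exact: of_deg_gpr.
by exists m2; rewrite addnC exprD -scalerA E scalerA -exprD addnS addnC -addnS.
Unshelve. all: by end_near. Qed.

Lemma power_stable_divide M y g y' g' : power_stable M -> Ahomog y g -> Ahomog y' g' ->
  0 < ldeg y' -> exists n, forall k w (m : car M), of_deg w m ->
    \forall l \near \oo, exists2 m' : car M, of_deg (w - y *+ k + y' *+ l) m' &
      g ^+ n *: (g' ^+ l *: m) = g ^+ (n + k) *: m'.
Proof.
move=> M_stable hg hg' y'_gt0; have [n nP] := power_stableX M_stable hg.
exists n => k w m dm; near=> l.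
have nP_l : forall m : car M, of_deg (w + y' *+ l) m ->
    exists2 m' : car M, of_deg (w + y' *+ l - y *+ k) m' & g ^+ n *: m = g ^+ (n + k) *: m'.
  by near: l; apply: (near_mulrn _ y'_gt0 (nP k)).
by have [|m' dm' E] := nP_l (g' ^+ l *: m); [apply: of_degZX|exists m'; rewrite 1?addrAC].
Unshelve. all: by end_near. Qed.

Lemma hfunZX M N (f : hom M N) y g : Ahomog y g ->
  \forall x \near large, forall (m : car M) n, of_deg x m ->
    hfun f (g ^+ n *: m) = g ^+ n *: hfun f m.
Proof.
by move=> hg; near=> x => m n dm; apply: (near (hfunZ f) x _ (y *+ n)) => //; apply: AhomogX.
Unshelve. all: by end_near. Qed.

Lemma power_stable_quotient M N (p : hom M N) :
  tail_surj p -> power_stable M -> power_stable N.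
Proof.
move=> p_surj M_stable y g hg; have [n nP] := power_stableX M_stable hg; exists n.
have pZ' := near_shift (- (y *+ 1)) (hfunZX p hg); near=> x => m dm.
have [//|k dk <-] := near p_surj x _ m dm; have [//|k' dk' E] := near (nP 1%N) x _ k dk.
exists (hfun p k'); rewrite -(near (hfunZX p hg) x) // E addn1.
by rewrite (near pZ' x).
Unshelve. all: by end_near. Qed.

Lemma power_stable_sub M N (i : hom M N) : tail_inj i -> power_stable N -> power_stable M.
Proof.
move=> i_inj N_stable y g hg; have [n nP] := power_stableX N_stable hg.
have [U [gU i_im]] := image_gsub i; have [l lP] := colon_powers_stable gU hg.
exists n; have iZ' := near_shift (- (y *+ 1)) (hfunZX i hg).
have i_inj' := near_shift (y *+ n) (tail_inj_eq i_inj).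
have [i_im' i_im2] := (near_shift (y *+ n) i_im, near_shift (- (y *+ 1)) i_im).
near=> x => m dm; have dim := hfun_of_deg i dm.
have [//|b db E] := near (nP l.+1) x _ _ dim.
have [a da aE] : exists2 a, of_deg (x - y *+ 1) a & hfun i a = g ^+ l *: b.
  apply/(near i_im2 x) => //.
    rewrite -[x - y *+ 1](_ : x - y *+ l.+1 + y *+ l = _); first exact: of_degZX.
    by rewrite mulr1n mulrSr opprD addrA addrAC subrK.
  apply: (lP (n + l.+1)%N); rewrite -E.
  rewrite -(near (hfunZX i hg) x) //; apply/(near i_im' x) => //.
    by apply: hfun_of_deg; apply: of_degZX.
  by exists (g ^+ n *: m) => //; apply: of_degZX.
exists a; apply: (near i_inj' x) => //; first exact: of_degZX.
  rewrite -[x + y *+ n](_ : x - y *+ 1 + y *+ n.+1 = _); first exact: of_degZX.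
  by rewrite mulr1n mulrS addrA subrK.
by rewrite (near (hfunZX i hg) x) // E (near iZ' x) // aE scalerA -exprD addSnnS.
Unshelve. all: by end_near. Qed.

Lemma power_stable_extension M N P (i : hom M N) (p : hom N P) :
  short_exact i p -> power_stable M -> power_stable P -> power_stable N.
Proof.
move=> [_ p_surj e] M_stable P_stable y g hg.
have [k kP] := power_stableX M_stable hg; have [n nP] := power_stableX P_stable hg.
have [p_surj' e'] := (near_shift (- (y *+ 1)) p_surj, near_shift (y *+ n) e).
have pZ' := near_shift (- (y *+ 1)) (hfunZX p hg).
have [iZ' iZ2] := (near_shift (y *+ n) (hfunZX i hg), near_shift (- (y *+ 1)) (hfunZX i hg)).
have kP' := near_shift (y *+ n) (kP n.+1); exists (k + n)%N; near=> x => b db.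
have xE : x + y *+ n - y *+ n.+1 = x - y *+ 1 by rewrite mulrSr opprD addrA addrK mulr1n.
have [//|q dq qE] := near (nP 1%N) x _ _ (hfun_of_deg p db).
have [//|b' db' b'E] := near p_surj' x _ q dq.
have d_diff : of_deg (x + y *+ n) (g ^+ n *: b - g ^+ n.+1 *: b').
  apply: of_degB; first exact: of_degZX.
  by rewrite -[x + y *+ n](subrK (y *+ n.+1)) xE; apply: of_degZX.
have [a da aE] : exists2 a, of_deg (x + y *+ n) a & hfun i a = g ^+ n *: b - g ^+ n.+1 *: b'.
  apply/(near e' x) => //; rewrite raddfB /= (near (hfunZX p hg) x) // (near pZ' x) //.
  by rewrite b'E qE addn1 subrr.
have [//|a' da' a'E] := near kP' x _ a da; rewrite xE in da'.
exists (b' + hfun i a'); have : g ^+ k *: hfun i a = g ^+ (k + n.+1) *: hfun i a'.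
  by rewrite -(near iZ' x) // a'E (near iZ2 x).
rewrite aE scalerBr !scalerA -!exprD => /eqP; rewrite subr_eq => /eqP ->.
by rewrite -scalerDr addrC addnS.
Unshelve. all: by end_near. Qed.

Lemma power_stable_zero M : is_zero M -> power_stable M.
Proof.
move=> /is_zeroP M0 y g hg; exists 0%N; near=> x => m dm.
by exists 0; rewrite (near M0 x _ m) // !scaler0.
Unshelve. all: by end_near. Qed.

Lemma power_stable_simple M : simple M -> power_stable M.
Proof.
move=> [_ M_simple] y g hg; have [K [i [i_inj i_im]]] := subobject (gsub_im M hg).
have /M_simple[/is_zeroP K0|/is_isoP[_ i_surj]] : is_mono i by apply/is_monoP.
  exists 1%N; have [K0' i_im'] := (near_shift y K0, near_shift y i_im).
  near=> x => m dm; exists 0; have dgm := of_degZ hg dm; rewrite scaler0 expr1.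
  have [//|k dk <-] := proj1 (near i_im' x _ _ dgm) (ex_intro _ m erefl).
  by rewrite (near K0' x _ k) // raddf0.
exists 0%N; near=> x => m dm; rewrite scale1r expr1.
by apply/(near i_im x) => //; apply: (near i_surj x).
Unshelve. all: by end_near. Qed.

Lemma torsion_power_stable M : is_torsion M -> power_stable M.
Proof.
elim=> [Z /power_stable_zero//|K N P /sesP[i [p ip_exact]] K_simple _].
exact: power_stable_extension ip_exact (power_stable_simple K_simple).
Qed.

End PowerStability.

(** * Line bundles *)

Section LineBundles.
Variables (F : finFieldType) (X : wpl F).
Local Notation t := (wt_n X).+2.
Local Notation A := (Aalg X).
Local Notation L := (Lgrp X).
Local Notation C := (coh X).
Local Notation o1 := (lift ord0 ord0 : 'I_t).
Local Notation X0 := (Avar (ord0 : 'I_t)).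
Local Notation X1 := (Avar o1).
Local Notation x0 := (Lgen (ord0 : 'I_t) : L).
Local Notation x1 := (Lgen o1 : L).
Local Notation large := (large_degree X).
Implicit Types (M K B D S Y : C) (x y z : L) (a b : A).

Lemma of_deg_Osh z x (a : car (Osh z)) : of_deg x a <-> Ahomog (x + z) a.
Proof. by rewrite AhomogP. Qed.

Lemma OshZ z a b : a *: (b : car (Osh z)) = a * b. Proof. by []. Qed.

Lemma Osh_exp z y g N : Ahomog y g -> of_deg (- z + y *+ N) (g ^+ N : car (Osh z)).
Proof. by move=> hg; apply/of_deg_Osh; rewrite addrAC addNr add0r; apply: AhomogX. Qed.

Lemma Osh_varX z i N : of_deg (- z + Lgen i *+ N) (Avar i ^+ N : car (Osh z)).
Proof. exact: Osh_exp (Ahomog_var i). Qed.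

Lemma Osh_varXM z x i N b : Ahomog (x + z - Lgen i *+ N) b ->
  of_deg x (Avar i ^+ N * b : car (Osh z)).
Proof.
move=> hb; apply/of_deg_Osh; rewrite -[x + z](subrK (Lgen i *+ N)) addrC.
by apply: AhomogM => //; apply: Ahomog_varX.
Qed.

(* A morphism out of O(z) is given on the two charts X_0 <> 0 and X_1 <> 0. *)
Lemma Osh_glue z M N0 N1 (e0 e1 : car M) :
  of_deg (- z + x0 *+ N0) e0 -> of_deg (- z + x1 *+ N1) e1 ->
  X1 ^+ N1 *: e0 = X0 ^+ N0 *: e1 ->
  exists v : hom (Osh z) M, \forall x \near large, forall b b',
    Ahomog (x + z - x0 *+ N0) b -> Ahomog (x + z - x1 *+ N1) b' ->
    hfun v (X0 ^+ N0 * b + X1 ^+ N1 * b' : car (Osh z)) = b *: e0 + b' *: e1.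
Proof.
move=> de0 de1 glue_eq.
pose R x (a : car (Osh z)) m := exists b b', [/\ Ahomog (x + z - x0 *+ N0) b,
  Ahomog (x + z - x1 *+ N1) b', a = X0 ^+ N0 * b + X1 ^+ N1 * b' :> A & m = b *: e0 + b' *: e1].
have degM i N (e : car M) x b : of_deg (- z + Lgen i *+ N) e ->
    Ahomog (x + z - Lgen i *+ N) b -> of_deg x (b *: e).
  move=> de hb; rewrite -[x](_ : - z + Lgen i *+ N + (x + z - Lgen i *+ N) = x).
    exact: of_degZ.
  by rewrite addrC [- z + _]addrC addrA subrK addrK.
have R_deg x a m : R x a m -> of_deg x m.
  by move=> [b [b' [hb hb' _ ->]]]; apply: of_degD; [apply: degM de0 hb|apply: degM de1 hb'].
have chart_ideal := near_shift z (near_Ahomog_chart_ideal X N0 N1).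
have [||||v vE] := @hom_of_rel F X (Osh z) M R.
- move=> x a m a' m' [b [b' [hb hb' -> ->]]] [c [c' [hc hc' -> ->]]].
  exists (b - c), (b' - c'); split; [exact: AhomogB|exact: AhomogB|by ring|].
  by rewrite !scalerBl opprD addrACA.
- near=> x => a /of_deg_Osh ha; have [//|b [b' [hb hb' aE]]] := near chart_ideal x _ a ha.
  exists (b *: e0 + b' *: e1); last by exists b, b'.
  by apply: (R_deg _ a); exists b, b'.
- apply: nearW => x m dm [b [b' [hb hb' E ->]]].
  have [|a' ha' [-> bE]] := @Avar01_regular F X _ b' (- b) N1 N0 hb'.
    by apply/eqP; rewrite mulrN -addr_eq0 addrC -E.
  rewrite -[b]opprK bE scaleNr [X1 ^+ _ * _]mulrC [X0 ^+ _ * _]mulrC -!scalerA glue_eq.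
  exact: addNr.
- apply: nearW => x y a c m ha _ _ [b [b' [hb hb' -> ->]]]; exists (a * b), (a * b').
  have xyE w : x + y + z - w = y + (x + z - w) by rewrite [x + y]addrC -!addrA.
  rewrite !xyE; split; try exact: AhomogM; last by rewrite scalerDr !scalerA.
  by rewrite -[LHS]/(a * (X0 ^+ N0 * b + X1 ^+ N1 * b') : A); ring.
exists v; near=> x => b b' hb hb'; apply: (near vE x) => //; last by exists b, b'.
  by apply: of_degD; apply: Osh_varXM.
by apply: (R_deg x (X0 ^+ N0 * b + X1 ^+ N1 * b')); exists b, b'.
Unshelve. all: by end_near. Qed.

Lemma Osh_hom_ext z M (f g : hom (Osh z) M) N0 N1 :
  (\forall x \near large, forall b, Ahomog (x + z - x0 *+ N0) b ->
    hfun f (X0 ^+ N0 * b : car (Osh z)) = hfun g (X0 ^+ N0 * b : car (Osh z))) ->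
  (\forall x \near large, forall b, Ahomog (x + z - x1 *+ N1) b ->
    hfun f (X1 ^+ N1 * b : car (Osh z)) = hfun g (X1 ^+ N1 * b : car (Osh z))) -> f = g.
Proof.
move=> fg0 fg1; have chart_ideal := near_shift z (near_Ahomog_chart_ideal X N0 N1).
apply/hom_eqP; near=> x => a /of_deg_Osh ha.
have [//|b [b' [hb hb' ->]]] := near chart_ideal x _ a ha.
by rewrite !raddfD /= (near fg0 x) // (near fg1 x).
Unshelve. all: by end_near. Qed.

Lemma lift_on_chart z B D (p : hom B D) (u : hom (Osh z) D) i : tail_surj p ->
  \forall N \near \oo, exists2 e : car B, of_deg (- z + Lgen i *+ N) e &
    forall y b, Ahomog y b -> hfun p (b *: e) = hfun u (b * Avar i ^+ N : car (Osh z)).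
Proof.
move=> p_surj; pose near_chart := near_mulrn (- z) (ldeg_gen_gt0 i).
have surjN := near_chart _ p_surj; have [pZ uZ] := (near_chart _ (hfunZ p), near_chart _ (hfunZ u)).
near=> N; have [//||e de eE] := near surjN N _ (hfun u (Avar i ^+ N : car (Osh z))).
  exact/hfun_of_deg/Osh_varX.
exists e => // y b hb; rewrite (near pZ N _ y) // eE -(near uZ N _ y) //.
exact: Osh_varX.
Unshelve. all: by end_near. Qed.

Lemma lift_on_charts z K B D (i : hom K B) (p : hom B D) (u : hom (Osh z) D) :
  short_exact i p -> power_stable K -> exists N0 N1 (f0 f1 : car B),
    [/\ of_deg (- z + x0 *+ N0) f0, of_deg (- z + x1 *+ N1) f1,
        X1 ^+ N1 *: f0 = X0 ^+ N0 *: f1,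
        forall y b, Ahomog y b -> hfun p (b *: f0) = hfun u (b * X0 ^+ N0 : car (Osh z))
      & forall y b, Ahomog y b -> hfun p (b *: f1) = hfun u (b * X1 ^+ N1 : car (Osh z))].
Proof.
move=> [i_inj p_surj e] K_stable.
have [n nP] := power_stable_divide K_stable (Ahomog_var ord0) (Ahomog_var o1) (ldeg_gen_gt0 o1).
have x01_gt0 : 0 < ldeg (x0 + x1) by rewrite raddfD addr_gt0 ?ldeg_gen_gt0.
have exactN := near_mulrn (- z) x01_gt0 e; have iZN := near_mulrn (- z) x01_gt0 (hfunZ i).
have [lift0 lift1] := (lift_on_chart u ord0 p_surj, lift_on_chart u o1 p_surj).
near \oo => N; have [//|e0 de0 pe0] := near lift0 N; have [//|e1 de1 pe1] := near lift1 N.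
pose w := - z + (x0 + x1) *+ N.
have [wE0 wE1] : w = - z + x0 *+ N + x1 *+ N /\ w = - z + x1 *+ N + x0 *+ N.
  by rewrite /w mulrnDl addrA; split=> //; rewrite addrAC.
have [k dk kE] : exists2 k, of_deg w k & hfun i k = X1 ^+ N *: e0 - X0 ^+ N *: e1.
  apply/(near exactN N) => //.
    by apply: of_degB; rewrite -/w; [rewrite wE0|rewrite wE1];
      apply: of_degZX => //; apply: Ahomog_var.
  rewrite raddfB /= (pe0 _ _ (Ahomog_varX o1 N)) (pe1 _ _ (Ahomog_varX ord0 N)).
  by rewrite mulrC subrr.
have iZM := near_mulrn (w - x0 *+ N) (ldeg_gen_gt0 o1) (hfunZ i).
have pZM := near_mulrn (w - x0 *+ N) (ldeg_gen_gt0 o1) (hfunZ p).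
have piM := near_mulrn (w - x0 *+ N) (ldeg_gen_gt0 o1) (hfun_comp_eq0 (tail_exact_comp0 e)).
near \oo => M; have [//|k2 dk2 k2E] := near (nP N w k dk) M.
have dk2' : of_deg (- z + x1 *+ (N + M)) k2.
  by move: dk2; rewrite wE1 addrK mulrnDr addrA.
exists (n + N)%N, (N + M)%N, (X0 ^+ n *: e0), (X1 ^+ M *: e1 + hfun i k2); split.
- by rewrite mulrnDr addrCA addrC; apply: of_degZX => //; apply: Ahomog_var.
- apply: of_degD; last exact: hfun_of_deg.
  by rewrite mulrnDr addrA; apply: of_degZX => //; apply: Ahomog_var.
- have E : X0 ^+ n *: (X1 ^+ M *: (X1 ^+ N *: e0 - X0 ^+ N *: e1)) = X0 ^+ (n + N) *: hfun i k2.
    rewrite -(near iZM M _ (x0 *+ (n + N))) //; last exact: Ahomog_varX.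
    rewrite -k2E -kE !scalerA.
    rewrite (near iZN N _ (x0 *+ n + x1 *+ M)) //.
    by apply: AhomogM; apply: Ahomog_varX.
  rewrite scalerDr -E !scalerBr !scalerA !exprD addrCA -scalerBl.
  by rewrite [X in X *: e1](_ : _ = 0) ?scale0r ?addr0; [congr (_ *: _)|]; ring.
- by move=> y b hb; rewrite scalerA (pe0 _ _ (AhomogM hb (Ahomog_varX ord0 n))) exprD mulrA.
- move=> y b hb; rewrite scalerDr raddfD /=.
  rewrite (near pZM M _ y b (hfun i k2)) //; last exact: hfun_of_deg.
  rewrite (near piM M) // scaler0 addr0 scalerA (pe1 _ _ (AhomogM hb (Ahomog_varX o1 M))).
  by rewrite addnC exprD mulrA.
Unshelve. all: by end_near. Qed.

Lemma Osh_lift z K B D (i : hom K B) (p : hom B D) (u : hom (Osh z) D) :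
  short_exact i p -> power_stable K -> exists v : hom (Osh z) B, comp p v = u.
Proof.
move=> ip_exact K_stable.
have [N0 [N1 [f0 [f1 [df0 df1 glue pf0 pf1]]]]] := lift_on_charts u ip_exact K_stable.
have [v vE] := Osh_glue df0 df1 glue; exists v.
apply: (Osh_hom_ext (N0 := N0) (N1 := N1)); near=> x => b hb.
  rewrite (near (hfunM _ _) x) //; last exact: Osh_varXM.
  have := near vE x _ b 0; rewrite mulr0 addr0 scale0r addr0 => -> //; last exact: Ahomog0.
  by rewrite (pf0 _ _ hb) mulrC.
rewrite (near (hfunM _ _) x) //; last exact: Osh_varXM.
have := near vE x _ 0 b; rewrite mulr0 add0r scale0r add0r => -> //; last exact: Ahomog0.
by rewrite (pf1 _ _ hb) mulrC.
Unshelve. all: by end_near. Qed.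

Lemma torsion_hom_Osh_eq0 z S (f : hom S (Osh z)) : power_stable S -> f = 0.
Proof.
move=> S_stable; apply/hom_eq0P.
have [n nP] := power_stable_divide S_stable (Ahomog_var ord0) (Ahomog_var o1) (ldeg_gen_gt0 o1).
near=> x => s ds; have /of_deg_Osh ha := hfun_of_deg f ds.
have [k k_neg] : exists k, ldeg (x + z - x0 *+ k) < 0.
  near \oo => k; exists k; rewrite -opprB raddfN /= oppr_lt0 addrC.
  by near: k; apply: near_mulrn (ldeg_gen_gt0 ord0) (near_ldeg_ge _ 1).
have fZM := near_mulrn (x - x0 *+ k) (ldeg_gen_gt0 o1) (hfunZ f).
near \oo => M; have [//|s2 ds2 /(congr1 (hfun f))] := near (nP k x s ds) M.
rewrite scalerA (near (hfunZ f) x _ (x0 *+ n + x1 *+ M)) //; last first.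
  by apply: AhomogM; apply: Ahomog_varX.
rewrite (near fZM M _ _ _ _ (Ahomog_varX ord0 (n + k))) // !OshZ exprD -!mulrA => E.
have X0n_neq0 : X0 ^+ n <> 0 := Ahomog_expf_neq0 (Ahomog_var ord0) (@Avar_neq0 _ _ ord0).
have {}E := Ahomog_mulfI (Ahomog_varX ord0 n) X0n_neq0 E.
have [a' ha' [-> _]] := Avar01_regular ha E.
by rewrite (Ahomog_neg k_neg ha') mulr0.
Unshelve. all: by end_near. Qed.

(* The kernel of an epimorphism O(z) -> Y is the annihilator of Y. *)
Lemma Osh_epi_kernel_sub z Y (p p' : hom (Osh z) Y) : tail_surj p ->
  \forall x \near large, forall a : car (Osh z), of_deg x a -> hfun p a = 0 -> hfun p' a = 0.
Proof.
move=> p_surj; near=> x => a da pa0.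
have kill i : \forall N \near \oo, Avar i ^+ N *: hfun p' a = 0.
  pose near_chart := near_mulrn (- z) (ldeg_gen_gt0 i).
  have surjN := near_chart _ p_surj.
  have [pZ p'Z] := (near_chart _ (hfunZ p), near_chart _ (hfunZ p')).
  near=> N; have [//||c dc cE] := near surjN N _ (hfun p' (Avar i ^+ N : car (Osh z))).
    exact/hfun_of_deg/Osh_varX.
  have /of_deg_Osh ha := da; have /of_deg_Osh hc := dc.
  rewrite -(near (hfunZ p') x _ _ _ _ (Ahomog_varX i N)) // OshZ mulrC -[_ * _](OshZ z).
  rewrite (near p'Z N _ _ _ _ ha); [|by []|exact: Osh_varX].
  rewrite -cE -(near pZ N _ _ _ _ ha) // OshZ mulrC -[_ * _](OshZ z).
  by rewrite (near (hfunZ p) x _ _ _ _ hc) // pa0 scaler0.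
near \oo => N; apply: (near (near_saturated (gsub0 Y)) x _ _ N N) => //.
- exact: hfun_of_deg.
- exact: (near (kill ord0) N).
- exact: (near (kill o1) N).
Unshelve. all: by end_near. Qed.

Lemma Osh_epi_unique z Y (p p' : hom (Osh z) Y) : tail_surj p -> tail_surj p' ->
  exists2 u : hom Y Y, is_iso u & comp u p = p'.
Proof.
move=> p_surj p'_surj; have [u uE] := tail_surj_lift p_surj (Osh_epi_kernel_sub p' p_surj).
have [v vE] := tail_surj_lift p'_surj (Osh_epi_kernel_sub p p'_surj).
exists u => //; exists v; split.
  by apply: (tail_surj_cancel p_surj); rewrite -comp_assoc uE vE comp_idl.
by apply: (tail_surj_cancel p'_surj); rewrite -comp_assoc vE uE comp_idl.
Qed.

Definition mul_by z z' (u : hom (Osh z) (Osh z' : C)) (f : A) : Prop :=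
  \forall x \near large, forall a, Ahomog (x + z) a -> hfun u (a : car (Osh z)) = a * f.

Lemma Osh_hom_mul z z' (u : hom (Osh z) (Osh z')) : exists2 f : A, Ahomog (z' - z) f & mul_by u f.
Proof.
have uZ0 := near_mulrn (- z) (ldeg_gen_gt0 ord0) (hfunZ u).
have uZ1 := near_mulrn (- z) (ldeg_gen_gt0 o1) (hfunZ u).
near \oo => N; pose a0 : A := hfun u (X0 ^+ N : car (Osh z)).
pose a1 : A := hfun u (X1 ^+ N : car (Osh z)).
have ha0 : Ahomog (- z + x0 *+ N + z') a0 by apply/of_deg_Osh/hfun_of_deg/Osh_varX.
have [|f hf [a0E a1E]] := @Avar01_regular F X _ a0 a1 N N ha0.
  rewrite -!(OshZ z') -(near uZ0 N _ _ _ _ (Ahomog_varX o1 N)) //; last exact: Osh_varX.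
  rewrite -(near uZ1 N _ _ _ _ (Ahomog_varX ord0 N)) //; last exact: Osh_varX.
  by rewrite !OshZ mulrC.
exists f; first by move: hf; rewrite [- z + _ + z']addrAC addrK addrC.
have chart_ideal := near_shift z (near_Ahomog_chart_ideal X N N).
near=> x => a ha; have [//|b [b' [hb hb' ->]]] := near chart_ideal x _ a ha.
rewrite raddfD /= mulrDl; congr (_ + _).
  rewrite mulrC -[b * _](OshZ z) (near uZ0 N _ _ _ _ hb) //; last exact: Osh_varX.
  by rewrite OshZ -/a0 a0E mulrA.
rewrite mulrC -[b' * _](OshZ z) (near uZ1 N _ _ _ _ hb') //; last exact: Osh_varX.
by rewrite OshZ -/a1 a1E mulrA.
Unshelve. all: by end_near. Qed.

Lemma Osh_mul_hom z z' (f : A) : Ahomog (z' - z) f ->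
  exists u : hom (Osh z) (Osh z'), mul_by u f.
Proof.
move=> hf; have [|u uE] := @tail_map_hom F X (Osh z) (Osh z') (fun a : A => a * f).
  split=> [a b|x a|]; first by rewrite mulrBl.
    rewrite -[LHS]/(Apr (x + z) a * f) -[RHS]/(Apr (x + z') (a * f)) ![_ * f]mulrC.
    by rewrite (Apr_mul _ _ hf) opprB addrA addrAC addrK.
  by apply: nearW => x y a m _ _; rewrite !OshZ mulrA.
by exists u; near=> x => a ha; apply: (near uE x) => //; apply/of_deg_Osh.
Unshelve. all: by end_near. Qed.

Lemma mul_by_unique z z' (u v : hom (Osh z) (Osh z')) f : mul_by u f -> mul_by v f -> u = v.
Proof.
move=> uE vE; apply/hom_eqP; near=> x => a /of_deg_Osh ha.
by rewrite (near uE x) // (near vE x).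
Unshelve. all: by end_near. Qed.

Lemma mul_by_comp z z2 z' (u : hom (Osh z) (Osh z2)) (w : hom (Osh z2) (Osh z')) f g :
  Ahomog (z2 - z) f -> mul_by u f -> mul_by w g -> mul_by (comp w u) (f * g).
Proof.
move=> hf uE wE; near=> x => a ha; rewrite (near (hfunM _ _) x); [|by []|exact/of_deg_Osh].
rewrite (near uE x) // (near wE x) ?mulrA //.
have -> : x + z2 = x + z + (z2 - z) by rewrite -addrA [z + _]addrC subrK.
exact: AhomogM.
Unshelve. all: by end_near. Qed.

Lemma Osh_not_zero z : ~ is_zero (Osh z : C).
Proof.
move=> /is_zeroP Z0; have null_N := near_mulrn (- z) (ldeg_gen_gt0 ord0) Z0.
near \oo => N; have X0N : X0 ^+ N = 0 by apply: (near null_N N) (Osh_varX z ord0 N).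
exact: Ahomog_expf_neq0 (Ahomog_var ord0) (@Avar_neq0 _ _ _) X0N.
Unshelve. all: by end_near. Qed.

Lemma mul_by_tail_inj z z' (u : hom (Osh z) (Osh z')) f : Ahomog (z' - z) f -> mul_by u f ->
  tail_inj u <-> f <> 0.
Proof.
move=> hf uE; split=> [u_inj f0|f0].
  apply: (@Osh_not_zero z); apply/is_zeroP; near=> x => a da; apply: (near u_inj x) => //.
  by rewrite (near uE x) ?f0 ?mulr0 //; apply/of_deg_Osh.
near=> x => a /of_deg_Osh ha; rewrite (near uE x) // mulrC.
by case/(Ahomog_mulf_eq0 hf) => // /f0.
Unshelve. all: by end_near. Qed.

End LineBundles.

(** * Localisation and finiteness *)

Section Germs.
Variables (F : finFieldType) (X : wpl F).
Local Notation L := (Lgrp X).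
Local Notation C := (coh X).
Implicit Types (M P K : C) (x y : L).

Definition germ_eq M (v w : nat -> car M) : Prop := \forall k \near \oo, v k = w k.

Lemma germ_eq_equiv M : Equivalence (@germ_eq M).
Proof.
split=> [v|v w vw|u v w uv vw]; first exact: nearW.
  by near=> k; rewrite (near vw k).
by near=> k; rewrite (near uv k) // (near vw k).
Unshelve. all: by end_near. Qed.

Section FixedDegree.
Variables (x y : L) (g : Aalg X).
Hypotheses (y_gt0 : 0 < ldeg y) (hg : Ahomog y g).

(* A homogeneous element m of degree x of the localisation of M at g, recorded by
   its multiples g^k m for large k. *)
Definition germ M (v : nat -> car M) : Prop :=
  \forall k \near \oo, of_deg (x + y *+ k) (v k) /\ v k.+1 = g *: v k.

Definition germ_card M (n : nat) : Prop := card_mod (@germ_eq M) (@germ M) n.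

Definition germ_of M (k : nat) (m : car M) (l : nat) : car M := g ^+ (l - k) *: m.

Lemma germ0 M : germ (fun=> 0 : car M).
Proof. by apply: nearW => k; split; [apply: of_deg0|rewrite scaler0]. Qed.

Lemma germB M (v w : nat -> car M) : germ v -> germ w -> germ (fun k => v k - w k).
Proof.
move=> gv gw; near=> k; have [//|dv vS] := near gv k; have [//|dw wS] := near gw k.
by split; [apply: of_degB|rewrite vS wS scalerBr].
Unshelve. all: by end_near. Qed.

Lemma germD M (v w : nat -> car M) : germ v -> germ w -> germ (fun k => v k + w k).
Proof.
move=> gv gw; near=> k; have [//|dv vS] := near gv k; have [//|dw wS] := near gw k.
by split; [apply: of_degD|rewrite vS wS scalerDr].
Unshelve. all: by end_near. Qed.

Lemma germ_hfun M P (f : hom M P) v : germ v -> germ (fun k => hfun f (v k)).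
Proof.
move=> gv; have fZ := near_mulrn x y_gt0 (hfunZ f).
near=> k; have [//|dv vS] := near gv k.
by split; [apply: hfun_of_deg|rewrite vS (near fZ k _ y)].
Unshelve. all: by end_near. Qed.

Lemma germ_germ_of M k (m : car M) : of_deg (x + y *+ k) m -> germ (germ_of k m).
Proof.
move=> dm; near=> l; have le_kl : (k <= l)%N by near: l; exists k.
rewrite /germ_of subSn // exprS -scalerA; split=> //.
by rewrite -(subnKC le_kl) mulrnDr addrA addKn; apply: of_degZX.
Unshelve. all: by end_near. Qed.

Lemma germ_determined M v : germ v ->
  \forall k \near \oo, of_deg (x + y *+ k) (v k : car M) /\ germ_eq v (germ_of k (v k)).
Proof.
move=> [k0 _ vP]; near=> k; have le_k : (k0 <= k)%N by near: k; exists k0.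
split; first by case: (vP k le_k).
exists k => // l /= le_l; rewrite /germ_of -[in LHS](subnKC le_l).
elim: (l - k)%N => [|j ih]; first by rewrite addn0 scale1r.
have [_] := vP (k + j)%N (leq_trans le_k (leq_addr _ _)).
by rewrite addnS => ->; rewrite ih scalerA exprS.
Unshelve. all: by end_near. Qed.

Lemma germ_of_hfun M P (f : hom M P) : \forall k \near \oo, forall m : car M,
  of_deg (x + y *+ k) m -> forall l, hfun f (germ_of k m l) = germ_of k (hfun f m) l.
Proof.
by have fZX := near_mulrn x y_gt0 (hfunZX f hg); near=> k => m dm l; apply: (near fZX k).
Unshelve. all: by end_near. Qed.

Lemma germ_lift P K (p : hom P K) u : tail_surj p -> germ u ->
  exists2 v, germ v & germ_eq (fun k => hfun p (v k)) u.
Proof.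
move=> p_surj gu; have [_ symE transE] := germ_eq_equiv K.
have surj_k := near_mulrn x y_gt0 p_surj; near \oo => k.
have [//|du uE] := near (germ_determined gu) k; have [//|b db bE] := near surj_k k _ _ du.
exists (germ_of k b); first exact: germ_germ_of.
apply: transE (symE _ _ uE); apply: nearW => l.
by rewrite (near (germ_of_hfun p) k) // bE.
Unshelve. all: by end_near. Qed.

Lemma germ_kernel M P K (i : hom M P) (p : hom P K) v : tail_exact i p -> germ v ->
  germ_eq (fun k => hfun p (v k)) (fun=> 0) ->
  exists2 w, germ w & germ_eq v (fun k => hfun i (w k)).
Proof.
move=> e gv pv0; have [_ _ transE] := germ_eq_equiv P.
have exact_k := near_mulrn x y_gt0 e; near \oo => k.
have [//|dv vE] := near (germ_determined gv) k.
have pk0 : hfun p (v k) = 0 by apply: (near pv0 k).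
have [//|a da aE] := proj1 (near exact_k k _ _ dv) pk0.
exists (germ_of k a); first exact: germ_germ_of.
apply: transE vE _; apply: nearW => l.
by rewrite (near (germ_of_hfun i) k) // aE.
Unshelve. all: by end_near. Qed.

Lemma germ_inj M P (i : hom M P) v w : tail_inj i -> germ v -> germ w ->
  germ_eq (fun k => hfun i (v k)) (fun k => hfun i (w k)) -> germ_eq v w.
Proof.
move=> /tail_inj_eq i_inj gv gw ivw; have inj_k := near_mulrn x y_gt0 i_inj.
near=> k; have [//|dv _] := near gv k; have [//|dw _] := near gw k.
by apply: (near inj_k k) => //; apply: (near ivw k).
Unshelve. all: by end_near. Qed.

Lemma germ_card_extension M P K (i : hom M P) (p : hom P K) m n :
  short_exact i p -> germ_card M m -> germ_card K n -> germ_card P (n * m).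
Proof.
move=> [i_inj p_surj e] cM cK; have [_ _ transK] := germ_eq_equiv K.
apply: (card_mod_mul (f := fun v k => hfun p (v k)) (germ_eq_equiv K) cK).
- by move=> v gv; apply: germ_hfun.
- by move=> v w _ _ vw; near=> k; rewrite (near vw k).
move=> u gu; have [v0 gv0 pv0] := germ_lift p_surj gu.
have pi0 := near_mulrn x y_gt0 (hfun_comp_eq0 (tail_exact_comp0 e)).
apply: (card_mod_bij (f := fun w k => v0 k + hfun i (w k))) (germ_eq_equiv P) cM.
- move=> w gw; split; first by apply: germD => //; apply: germ_hfun.
  apply: (transK _ _ _ _ pv0); near=> k; have [//|dw _] := near gw k.
  by rewrite raddfD /= (near pi0 k) // addr0.
- move=> v [gv pvu]; have [||w gw wE] := germ_kernel (v := fun k => v k - v0 k) e.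
  + exact: germB.
  + by near=> k; rewrite raddfB /= (near pvu k) // (near pv0 k) // subrr.
  by exists w => //; near=> k; rewrite -(near wE k) // addrC subrK.
- move=> w w' gw gw'; split=> [E|E]; last by near=> k; rewrite (near E k).
  by apply: (germ_inj i_inj gw gw'); near=> k; apply: (addrI (v0 k)); apply: (near E k).
Unshelve. all: by end_near. Qed.

Lemma germ_finite M : power_stable M -> finite_mod (@germ_eq M) (@germ M).
Proof.
move=> M_stable; have [n nP] := power_stableX M_stable hg.
have [k1 _ k1P] := near_mulrn x y_gt0 (nP 1%N).
have descend j (m : car M) : of_deg (x + y *+ (k1 + j)) m -> exists2 w : car M,
    of_deg (x + y *+ k1) w & g ^+ n *: m = g ^+ (n + j) *: w.
  elim: j m => [|j ih] m dm; first by exists m; rewrite ?addn0 // in dm *.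
  have [|m' dm' E] := k1P (k1 + j.+1)%N _ _ dm; first exact: leq_addr.
  have [|w dw wE] := ih m'; first by move: dm'; rewrite addnS mulrSr addrA addrK.
  by exists w => //; rewrite E addn1 exprS -scalerA wE scalerA -exprS addnS.
have [s sP] := low_degree_finite M (ldeg (x + y *+ k1) + 1).
have [_ symE transE] := germ_eq_equiv M.
apply: (finite_mod_classify (germ_eq_equiv M)
  (R := fun v (w : seq_sub s) => germ_eq v (germ_of k1 (ssval w)))).
- move=> v gv; near \oo => k; have le_k : (k1 <= k)%N by near: k; exists k1.
  have [//|dv vE] := near (germ_determined gv) k.
  have [|w dw wE] := descend (k - k1)%N (v k); first by rewrite subnKC.
  have sw : w \in s by apply: sP dw; lia.
  exists (SeqSub sw); apply: transE vE _; exists (k + n)%N => // l /= le_l.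
  rewrite /germ_of /= -(subnKC (leq_trans (leq_addr _ _) le_l)) addKn.
  have -> : (l - k)%N = (l - k - n + n)%N by lia.
  by rewrite exprD -scalerA wE scalerA -exprD; congr (_ ^+ _ *: _); lia.
- by move=> v v' w _ _ vw v'w; apply: transE vw _; apply: symE.
Unshelve. all: by end_near. Qed.

End FixedDegree.
End Germs.

Section HomFinite.
Variables (F : finFieldType) (X : wpl F).
Local Notation t := (wt_n X).+2.
Local Notation A := (Aalg X).
Local Notation L := (Lgrp X).
Local Notation C := (coh X).
Local Notation o1 := (lift ord0 ord0 : 'I_t).
Local Notation large := (large_degree X).
Implicit Types (M S : C) (z : L).

Lemma Osh_hom_germ z M (u : hom (Osh z) M) y g : 0 < ldeg y -> Ahomog y g ->
  germ (- z) y g (fun k => hfun u (g ^+ k : car (Osh z))).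
Proof.
move=> y_gt0 hg; have uZ := near_mulrn (- z) y_gt0 (hfunZ u); near=> k.
split; first exact/hfun_of_deg/Osh_exp.
by rewrite -(near uZ k _ _ _ _ hg) ?OshZ ?exprS //; apply: Osh_exp.
Unshelve. all: by end_near. Qed.

Lemma Osh_hom_germ_inj z M (u u' : hom (Osh z) M) :
  germ_eq (fun k => hfun u (Avar ord0 ^+ k : car (Osh z)))
    (fun k => hfun u' (Avar ord0 ^+ k : car (Osh z))) ->
  germ_eq (fun k => hfun u (Avar o1 ^+ k : car (Osh z)))
    (fun k => hfun u' (Avar o1 ^+ k : car (Osh z))) -> u = u'.
Proof.
have chart i : germ_eq (fun k => hfun u (Avar i ^+ k : car (Osh z)))
      (fun k => hfun u' (Avar i ^+ k : car (Osh z))) ->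
    \forall N \near \oo, forall x b, Ahomog (x + z - Lgen i *+ N) b ->
      hfun u (Avar i ^+ N * b : car (Osh z)) = hfun u' (Avar i ^+ N * b : car (Osh z)).
  move=> uu'; have uZ := near_mulrn (- z) (ldeg_gen_gt0 i) (hfunZ u).
  have u'Z := near_mulrn (- z) (ldeg_gen_gt0 i) (hfunZ u').
  near=> N => x b hb; rewrite mulrC -[b * _](OshZ z).
  by rewrite (near uZ N _ _ _ _ hb) ?(near u'Z N _ _ _ _ hb) ?(near uu' N) //; apply: Osh_varX.
move=> /chart chart0 /chart chart1; near \oo => N.
apply: (Osh_hom_ext (N0 := N) (N1 := N)); apply: nearW => x b.
  exact: (near chart0 N).
exact: (near chart1 N).
Unshelve. all: by end_near. Qed.

Lemma Osh_hom_finite z M : power_stable M -> finite_mod eq (fun _ : hom (Osh z) M => True).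
Proof.
move=> M_stable.
have [n0 [e0 [_ _ e0P]]] := germ_finite (- z) (ldeg_gen_gt0 ord0) (Ahomog_var ord0) M_stable.
have [n1 [e1 [_ _ e1P]]] := germ_finite (- z) (ldeg_gen_gt0 o1) (Ahomog_var o1) M_stable.
apply: (finite_mod_classify eq_equivalence (R := fun (u : hom (Osh z) M) (p : 'I_n0 * 'I_n1) =>
  germ_eq (fun k => hfun u (Avar ord0 ^+ k : car (Osh z))) (e0 p.1) /\
  germ_eq (fun k => hfun u (Avar o1 ^+ k : car (Osh z))) (e1 p.2))).
  move=> u _; have [i ui] := e0P _ (Osh_hom_germ u (ldeg_gen_gt0 ord0) (Ahomog_var ord0)).
  have [j uj] := e1P _ (Osh_hom_germ u (ldeg_gen_gt0 o1) (Ahomog_var o1)).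
  by exists (i, j).
move=> u u' p _ _ [u0 u1] [u0' u1']; have [_ symE transE] := germ_eq_equiv M.
apply: Osh_hom_germ_inj; first exact: transE u0 (symE _ _ u0').
exact: transE u1 (symE _ _ u1').
Qed.

Lemma Osh_elt M d (e : car M) : of_deg d e -> exists u : hom (Osh (- d)) M,
  \forall x \near large, forall a, Ahomog (x - d) a -> hfun u (a : car (Osh (- d))) = a *: e.
Proof.
move=> de; have [|u uE] := @tail_map_hom F X (Osh (- d)) M (fun a : A => a *: e).
  split=> [a b|x a|]; [by rewrite scalerBl|by rewrite (gpr_scale _ _ de)|].
  by apply: nearW => x y a m _ _; rewrite OshZ scalerA.
by exists u; near=> x => a ha; apply: (near uE x) => //; apply/of_deg_Osh.
Unshelve. all: by end_near. Qed.

Lemma hom_finite M S : power_stable S -> finite_mod eq (fun _ : hom M S => True).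
Proof.
move=> S_stable; have [n [d [e [eP e_gen]]]] := homogeneous_generators (gsubT M).
pose eps j := sval (cid (Osh_elt (proj2 (eP j)))).
have epsP j := svalP (cid (Osh_elt (proj2 (eP j)))).
pose homs j := cid (Osh_hom_finite (- d j) S_stable).
pose enum_homs j := sval (cid (svalP (homs j))); have enumP j := svalP (cid (svalP (homs j))).
apply: (finite_mod_classify eq_equivalence (R := fun f (r : {dffun forall j, 'I_(sval (homs j))}) =>
  forall j, comp f (eps j) = enum_homs j (r j))).
  move=> f _; have fP j : exists i, comp f (eps j) = enum_homs j i.
    by have [_ _] := enumP j; apply.
  by exists [ffun j => sval (cid (fP j))] => j; rewrite ffunE; apply: (svalP (cid (fP j))).
move=> f f' r _ _ fr f'r; have f_gen : \forall x \near large, forall j a, Ahomog (x - d j) a ->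
    hfun f (a *: e j) = hfun f' (a *: e j).
  apply: near_forall => j; have /hfun_comp_eq Ej : comp f (eps j) = comp f' (eps j).
    by rewrite fr f'r.
  near=> x => a ha; have da : of_deg x (a : car (Osh (- d j))) by apply/of_deg_Osh.
  by rewrite -(near (epsP j) x) // (near Ej x) // (near (hfunM _ _) x).
apply/hom_eqP; near=> x => m dm; have [a [ha ->]] := e_gen x m I dm.
by rewrite !raddf_sum; apply: eq_bigr => j _; apply: (near f_gen x).
Unshelve. all: by end_near. Qed.

Lemma Osh_hom_Osh_finite z z' : finite_mod eq (fun _ : hom (Osh z) (Osh z' : C) => True).
Proof.
have [s sP] := Ahomog_low_finite X (ldeg (z' - z) + 1).
apply: (finite_mod_classify eq_equivalence
  (R := fun (u : hom (Osh z) (Osh z')) (f : seq_sub s) => mul_by u (ssval f))).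
  move=> u _; have [f hf uE] := Osh_hom_mul u.
  have sf : f \in s by apply: sP hf; lia.
  by exists (SeqSub sf).
by move=> u u' f _ _; apply: mul_by_unique.
Qed.

End HomFinite.

(** * Quotients of line bundles by line bundles *)

Section CoprimeForms.
Variables (F : fieldType) (X : wpl F).
Local Notation A := (Aalg X).
Local Notation L := (Lgrp X).
Implicit Types (d : L) (f g : A) (G : {poly F}).

Lemma nf_mult_can n : nf_mult (Lcan X *+ n) = n.
Proof.
rewrite (@nf_mult_unique F X _ 0%MM n%:Z); last by rewrite mdegL0 add0r.
by rewrite big1 ?add0r // => i _; rewrite mnm0E div0n.
Qed.

Lemma Ahomog_gcd d f f' : Ahomog d f -> Ahomog d f' -> f <> 0 -> f' <> 0 ->
  exists n G G' g, [/\ f = homogenize X n G * g, f' = homogenize X n G' * g,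
    Ahomog (d - Lcan X *+ n) g, coprimep G G' & maxn (size G) (size G') = n.+1].
Proof.
move=> hf hf' f0 f'0.
have d_ge0 : 0 <= nf_mult d by rewrite leNgt; apply/negP => /Ahomog_nf_neg/(_ hf).
have [szf fE] := normal_form hf; have [szf' fE'] := normal_form hf'.
set H := dehom f in szf fE; set H' := dehom f' in szf' fE'; set N := `|_|%N in szf fE szf' fE'.
have H0 : H != 0 by apply/eqP => /(dehom_eq0 hf).
have H'0 : H' != 0 by apply/eqP => /(dehom_eq0 hf').
pose D : {poly F} := gcdp H H'; pose G : {poly F} := H %/ D; pose G' : {poly F} := H' %/ D.
have HE : H = G * D by rewrite divpK ?dvdp_gcdl.
have H'E : H' = G' * D by rewrite divpK ?dvdp_gcdr.
have D0 : D != 0 by rewrite gcdp_eq0 negb_and H0.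
have G0 : G != 0 by apply: contraNneq H0 => E; rewrite HE E mul0r.
have G'0 : G' != 0 by apply: contraNneq H'0 => E; rewrite H'E E mul0r.
have sGD : ((size G + size D).-1 <= N.+1)%N by rewrite -size_mul // -HE.
have sG'D : ((size G' + size D).-1 <= N.+1)%N by rewrite -size_mul // -H'E.
have [sG sG' sD] : [/\ 0 < size G, 0 < size G' & 0 < size D]%N by rewrite !size_poly_gt0.
pose n := (maxn (size G) (size G')).-1; have nD : (n + (size D).-1 <= N)%N by rewrite /n; lia.
have NE : N = (n + (N - n))%N by lia.
exists n, G, G', (Amon (nf_mnm d) * homogenize X (N - n) D); split.
- by rewrite fE HE {1}NE -homogenizeM /n; [ring|lia|lia].
- by rewrite fE' H'E {1}NE -homogenizeM /n; [ring|lia|lia].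
- have -> : d - Lcan X *+ n = mdegL (nf_mnm d) + Lcan X *+ (N - n).
    rewrite {1}[d]nf_eq -addrA mulrnBr; last by lia.
    by rewrite -[nf_mult d]gez0_abs // -pmulrn.
  by apply: AhomogM; [apply: Ahomog_mon|apply: Ahomog_homogenize].
- by rewrite coprimep_div_gcd ?H0.
- by rewrite prednK //; lia.
Qed.

Lemma homogenize0_proportional G G' : G != 0 -> G' != 0 -> maxn (size G) (size G') = 1%N ->
  exists2 c, c != 0 & homogenize X 0 G' = Aconst X c * homogenize X 0 G.
Proof.
have constE c : homogenize X 0 c%:P = Aconst X c.
  by rewrite /homogenize big_ord1 coefC eqxx !expr0 !mulr1.
rewrite -!size_poly_gt0 => sG sG' max_size.
have [|c c0 ->] := size_poly1P G _; first by apply/eqP; lia.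
have [|c' c'0 ->] := size_poly1P G' _; first by apply/eqP; lia.
by exists (c' / c); rewrite ?mulf_neq0 ?invr_eq0 // !constE -rmorphM divfK.
Qed.

Lemma dehom_homogenizeX n G k : (size G <= n.+1)%N -> dehom (homogenize X n G ^+ k) = G ^+ k.
Proof.
by move=> sG; elim: k => [|k ih]; rewrite ?expr0 ?dehom1 // !exprS dehom_homogenize ?ih.
Qed.

Lemma coprime_form_not_dvd n G G' k a : (0 < n)%N -> maxn (size G) (size G') = n.+1 ->
  G != 0 -> coprimep G G' -> Ahomog (Lcan X *+ (n * k)) a ->
  homogenize X n G ^+ k.+1 <> a * homogenize X n G'.
Proof.
move=> n_gt0 max_size G0 cop ha E.
have [sG sG'] : (size G <= n.+1)%N /\ (size G' <= n.+1)%N by lia.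
have {E}E : G ^+ k.+1 = G' * dehom a.
  by rewrite -(dehom_homogenizeX k.+1 sG) E mulrC dehom_homogenize.
have [sa _] := normal_form ha; rewrite nf_mult_can absz_nat in sa.
have G'1 : size G' = 1%N.
  have : coprimep G' (G ^+ k.+1) by rewrite coprimep_sym coprimep_expl.
  rewrite /coprimep => /eqP <-; have : G' %| G ^+ k.+1 by rewrite E dvdp_mulr.
  by move=> /dvdp_gcd_idl/eqp_size ->.
have a0 : dehom a != 0 by apply: contra_eqN E => /eqP ->; rewrite mulr0 expf_neq0.
have G'0 : G' != 0 by rewrite -size_poly_gt0 G'1.
have := congr1 (size \o polyseq) E; rewrite /= size_mul // G'1 add1n /=.
have := size_exp G k.+1; have -> : size G = n.+1 by lia.
by case: (size (G ^+ _)) => [|m] /= mE sE; move: sa; rewrite -sE ?mE; nia.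
Qed.

End CoprimeForms.

Section CokernelUniqueness.
Variables (F : finFieldType) (X : wpl F).
Local Notation L := (Lgrp X).
Local Notation C := (coh X).
Implicit Types (M K Y Q : C) (x y z : L).

Definition same_localisations Y Y' : Prop := forall x y g n n', 0 < ldeg y -> Ahomog y g ->
  germ_card x y g Y n -> germ_card x y g Y' n' -> n = n'.

Lemma cokernel_iso_of_comp_eq0 M K Y Y' (i i' : hom M K) (p : hom K Y) (p' : hom K Y') :
  tail_surj p -> tail_exact i p -> tail_surj p' -> tail_exact i' p' ->
  comp p' i = 0 -> comp p i' = 0 -> isomorphic Y Y'.
Proof.
move=> p_surj e p'_surj e' /(cokernel_lift p_surj e)[u uE] /(cokernel_lift p'_surj e')[v vE].
exists u, v; split.
  by apply: (tail_surj_cancel p_surj); rewrite -comp_assoc uE vE comp_idl.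
by apply: (tail_surj_cancel p'_surj); rewrite -comp_assoc vE uE comp_idl.
Qed.

Lemma mul_by_const_factor z z' c f (i i' : hom (Osh z) (Osh z' : C)) :
  mul_by i (Aconst X c * f) -> mul_by i' f -> exists s, i = comp i' s.
Proof.
move=> iE i'E; have hc : Ahomog (z - z) (Aconst X c) by rewrite subrr; apply: Ahomog_const.
have [s sE] := Osh_mul_hom hc; exists s.
by apply: (mul_by_unique iE); apply: mul_by_comp hc sE i'E.
Qed.

Lemma cokernel_iso_of_proportional z z' c f f' Y Y' (i i' : hom (Osh z) (Osh z'))
    (p : hom (Osh z') Y) (p' : hom (Osh z') Y') : c != 0 -> f' = Aconst X c * f ->
  mul_by i f -> mul_by i' f' -> short_exact i p -> short_exact i' p' -> isomorphic Y Y'.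
Proof.
move=> c0 f'E iE i'E [_ p_surj e] [_ p'_surj e']; rewrite f'E in i'E.
have [s' i'_s'] := mul_by_const_factor i'E iE.
have [s i_s] : exists s, i = comp i' s.
  by apply: mul_by_const_factor (c^-1) _ _ _ _ i'E; rewrite mulrA -rmorphM mulVf // rmorph1 mul1r.
apply: (cokernel_iso_of_comp_eq0 p_surj e p'_surj e').
  by rewrite i_s comp_assoc (tail_exact_comp0 e') comp0l.
by rewrite i'_s' comp_assoc (tail_exact_comp0 e) comp0l.
Qed.

Lemma cokernel_mul_germ_card z z' h Q (u : hom (Osh z) (Osh z')) (q : hom (Osh z') Q) x :
  0 < ldeg (z' - z) -> Ahomog (z' - z) h -> mul_by u h -> tail_surj q -> tail_exact u q ->
  germ_card x (z' - z) h Q 1.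
Proof.
set y := z' - z => y_gt0 hh uE q_surj e.
exists (fun=> fun=> 0); split=> [_|o o' _|v gv]; [exact: germ0|by rewrite !ord1|].
exists ord0; have [_ _ transE] := germ_eq_equiv Q.
have near_k := near_mulrn x y_gt0.
have [q_surj' qZ' uE'] := And3 (near_k _ q_surj) (near_k _ (hfunZ q)) (near_k _ (near_shift y uE)).
have e' := near_k _ (near_shift y e); near \oo => k.
have [//|dv vE] := near (germ_determined gv) k.
have [//|a da aE] := near q_surj' k _ _ dv; have /of_deg_Osh ha := da.
have hv0 : h *: v k = 0.
  rewrite -aE -(near qZ' k _ _ _ _ hh) //; apply/(near e' k) => //; first exact: of_degZ.
  have ha2 : Ahomog (x + y *+ k + y + z) a by rewrite -addrA subrK.
  by exists a; [apply/of_deg_Osh|rewrite (near uE' k) // OshZ mulrC].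
apply: transE vE _; exists k.+1 => // l /= lt_kl; rewrite /germ_of.
have -> : (l - k)%N = (l - k.+1).+1 by lia.
by rewrite exprSr -scalerA hv0 scaler0.
Unshelve. all: by end_near. Qed.

Lemma dvd_of_germ_card1 z z' y h h' Q (u : hom (Osh z) (Osh z')) (q : hom (Osh z') Q) :
  0 < ldeg y -> Ahomog y h -> mul_by u h' -> tail_exact u q -> germ_card (- z') y h Q 1 ->
  exists k a, Ahomog (y *+ k.+1 - (z' - z)) a /\ h ^+ k.+1 = a * h'.
Proof.
move=> y_gt0 hh uE e [c [_ _ c_surj]]; have [_ symE transE] := germ_eq_equiv Q.
have qh0 : germ_eq (fun k => hfun q (h ^+ k : car (Osh z'))) (fun=> 0).
  have [i vi] := c_surj _ (Osh_hom_germ q y_gt0 hh); apply: transE vi _.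
  have [j c0] := c_surj _ (germ0 (- z') y h Q); apply: symE.
  by rewrite (ord1 i) -(ord1 j).
have e' := near_mulrn (- z') y_gt0 e; have uE' := near_mulrn (- z') y_gt0 uE.
near \oo => k; have k_gt0 : (0 < k)%N by near: k; exists 1%N.
have [a /of_deg_Osh ha aE] : exists2 a, of_deg (- z' + y *+ k) a & hfun u a = h ^+ k.
  by apply/(near e' k) => //; [apply: Osh_exp|apply: (near qh0 k)].
exists k.-1, a; rewrite prednK // opprB addrA [_ - z']addrC addrA; split=> //.
by rewrite -(near uE' k).
Unshelve. all: by end_near. Qed.

Lemma same_localisations_cancel M P K Y Y' Q Q' (u u' : hom M P) (w : hom P K) (p : hom K Y)
    (p' : hom K Y') (q : hom P Q) (q' : hom P Q') : tail_inj w ->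
  short_exact (comp w u) p -> short_exact (comp w u') p' ->
  tail_surj q -> tail_exact u q -> tail_surj q' -> tail_exact u' q' ->
  power_stable Y -> power_stable Y' -> same_localisations Y Y' ->
  [/\ power_stable Q, power_stable Q' & same_localisations Q Q'].
Proof.
move=> w_inj [_ p_surj pe] [_ p'_surj p'e] q_surj qe q'_surj q'e Y_stable Y'_stable same.
have [R [r [r_surj re]]] := cokernel_exists w.
have [j [s js]] := cokernel_comp_short_exact w_inj q_surj qe r_surj re p_surj pe.
have [j' [s' js']] := cokernel_comp_short_exact w_inj q'_surj q'e r_surj re p'_surj p'e.
have [[j_inj s_surj _] [j'_inj _ _]] := (js, js').
have R_stable := power_stable_quotient s_surj Y_stable.
split; [exact: power_stable_sub j_inj Y_stable|exact: power_stable_sub j'_inj Y'_stable|].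
move=> x y g n n' y_gt0 hg cQ cQ'; have [m cR] := germ_finite x y_gt0 hg R_stable.
have /eqP := same _ _ _ _ _ y_gt0 hg (germ_card_extension y_gt0 hg js cQ cR)
  (germ_card_extension y_gt0 hg js' cQ' cR).
by rewrite eqn_pmul2l ?(card_mod_gt0 (germ0 x y g R) cR) // => /eqP.
Qed.

(* Writing the two inclusions of O(z) as D G and D G' with coprime forms G, G' of
   the same degree, localisation at G kills the cokernel of G but not that of G'
   unless the degree is 0. *)
Lemma Osh_cokernel_unique z z' Y Y' (i i' : hom (Osh z) (Osh z')) (p : hom (Osh z') Y)
    (p' : hom (Osh z') Y') : short_exact i p -> short_exact i' p' ->
  power_stable Y -> power_stable Y' -> same_localisations Y Y' -> isomorphic Y Y'.
Proof.
move=> ip_exact i'p'_exact Y_stable Y'_stable same.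
have [[f hf iE] [f' hf' i'E]] := (Osh_hom_mul i, Osh_hom_mul i').
have f0 : f <> 0 by apply/(mul_by_tail_inj hf iE); case: ip_exact.
have f'0 : f' <> 0 by apply/(mul_by_tail_inj hf' i'E); case: i'p'_exact.
have [n [G [G' [g [fE f'E hg cop max_size]]]]] := Ahomog_gcd hf hf' f0 f'0.
have [G0 G'0] : G != 0 /\ G' != 0.
  by split; apply/eqP => E; [apply: f0|apply: f'0]; rewrite ?fE ?f'E E raddf0 mul0r.
have [n0|n_gt0] := posnP n.
  rewrite n0 in fE f'E max_size; have [c c0 GE] := homogenize0_proportional X G0 G'0 max_size.
  apply: cokernel_iso_of_proportional c0 _ iE i'E ip_exact i'p'_exact.
  by rewrite f'E fE GE mulrA.
exfalso; pose y := Lcan X *+ n; pose z2 := z + y.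
have y_gt0 : 0 < ldeg y by rewrite raddfMn /= ldeg_can pmulrn_lgt0 // ltz_nat wt_prod_gt0.
have z2E : z2 - z = y by rewrite /z2 addrAC subrr add0r.
have [hh hh'] : Ahomog (z2 - z) (homogenize X n G) /\ Ahomog (z2 - z) (homogenize X n G').
  by rewrite z2E; split; apply: Ahomog_homogenize.
have {}hg : Ahomog (z' - z2) g by rewrite opprD addrA.
have [[u uE] [u' u'E] [w wE]] := And3 (Osh_mul_hom hh) (Osh_mul_hom hh') (Osh_mul_hom hg).
have w_inj : tail_inj w by apply/(mul_by_tail_inj hg wE) => g0; apply: f0; rewrite fE g0 mulr0.
have iwu : i = comp w u by apply: (mul_by_unique iE); rewrite fE; apply: mul_by_comp hh uE wE.
have i'wu' : i' = comp w u'.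
  by apply: (mul_by_unique i'E); rewrite f'E; apply: mul_by_comp hh' u'E wE.
rewrite {}iwu {}i'wu' in ip_exact i'p'_exact.
have [Q [q [q_surj qe]]] := cokernel_exists u; have [Q' [q' [q'_surj q'e]]] := cokernel_exists u'.
have [_ Q'_stable sameQ] := same_localisations_cancel w_inj ip_exact i'p'_exact q_surj qe
  q'_surj q'e Y_stable Y'_stable same.
rewrite -z2E in y_gt0; have [m cQ'] := germ_finite (- z2) y_gt0 hh Q'_stable.
have m1 := sameQ _ _ _ _ _ y_gt0 hh (cokernel_mul_germ_card (- z2) y_gt0 hh uE q_surj qe) cQ'.
have [|k [a [ha]]] := dvd_of_germ_card1 y_gt0 hh u'E q'e; first by rewrite m1.
apply: (coprime_form_not_dvd (k := k) n_gt0 max_size G0 cop).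
by rewrite mulrnA -/y -z2E; move: ha; rewrite mulrSr addrK.
Qed.

End CokernelUniqueness.

(** * Indecomposable torsion sheaves are uniserial *)

Section NilpotentAction.
Variables (F : finFieldType) (X : wpl F).
Local Notation t := (wt_n X).+2.
Local Notation A := (Aalg X).
Local Notation L := (Lgrp X).
Local Notation C := (coh X).
Local Notation o1 := (lift ord0 ord0 : 'I_t).
Local Notation large := (large_degree X).
Implicit Types (g h a b : A) (x y z : L) (i j : 'I_t).

Lemma not_near_element (M : gmod X) (P : L -> Prop) (Q : L -> M -> Prop) :
  ~ (\forall x \near large, forall m, of_deg x m -> Q x m) -> (\forall x \near large, P x) ->
  exists x m, [/\ P x, of_deg x m & ~ Q x m].
Proof.
move=> nQ /large_degreeP[d dP]; have [x /dP Px nQx] := not_near_ex d nQ.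
apply: contrapT => no; apply: nQx => m dm; apply: contrapT => nQm.
by apply: no; exists x, m.
Qed.

Variable S : C.

Definition nilpotent_on g : Prop :=
  exists n, \forall x \near large, forall s : car S, of_deg x s -> g ^+ n *: s = 0.

Lemma nilpotent_onMl g h : nilpotent_on g -> nilpotent_on (h * g).
Proof.
move=> [n gn0]; exists n; near=> x => s ds.
by rewrite exprMn -scalerA (near gn0 x) // scaler0.
Unshelve. all: by end_near. Qed.

Lemma nilpotent_on_expn g k : nilpotent_on (g ^+ k) -> nilpotent_on g.
Proof. by move=> [n]; exists (k * n)%N; rewrite exprM. Qed.

Lemma nilpotent_onD g h : nilpotent_on g -> nilpotent_on h -> nilpotent_on (g + h).
Proof.
move=> [n gn0] [m hm0]; exists (n + m)%N; near=> x => s ds.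
rewrite exprDn scaler_suml big1 // => k _; rewrite -scalerMnl.
suff -> : (g ^+ (n + m - k) * h ^+ k) *: s = 0 by rewrite mul0rn.
have [le_mk|lt_km] := leqP m k.
  by rewrite -(subnK le_mk) exprD mulrA -scalerA (near hm0 x) // scaler0.
have le_n : (n <= n + m - k)%N by lia.
by rewrite mulrC -(subnK le_n) exprD mulrA -scalerA (near gn0 x) // scaler0.
Unshelve. all: by end_near. Qed.

Lemma nilpotent_onB g h : nilpotent_on g -> nilpotent_on h -> nilpotent_on (g - h).
Proof.
by move=> ng nh; rewrite -mulN1r; exact: nilpotent_onD ng (nilpotent_onMl (-1) nh).
Qed.

Lemma nilpotent_on_Tvar i : nilpotent_on (Tvar i) <-> nilpotent_on (Avar i).
Proof.
split=> [/nilpotent_on_expn//|ni].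
by rewrite /Tvar -(prednK (wt_gt0 X i)) exprSr; apply: nilpotent_onMl.
Qed.

Lemma nilpotent_on_constM c g : c != 0 -> nilpotent_on (Aconst X c * g) -> nilpotent_on g.
Proof.
move=> c0 ncg; have -> : g = Aconst X c^-1 * (Aconst X c * g).
  by rewrite mulrA -rmorphM mulVf // rmorph1 mul1r.
exact: nilpotent_onMl.
Qed.

Hypotheses (S_stable : power_stable S) (S_indec : indecomposable S).

Let S_neq0 : ~ tail_null S.
Proof. by case: S_indec => nz _ /is_zeroP. Qed.

Lemma not_nilpotent_on1 : ~ nilpotent_on 1.
Proof.
move=> [n one_n]; apply: S_neq0; near=> x => s ds.
have : 1 ^+ n *: s = 0 by apply: (near one_n x).
by rewrite expr1n scale1r.
Unshelve. all: by end_near. Qed.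

Lemma not_nilpotent_onX g k : ~ nilpotent_on g -> ~ nilpotent_on (g ^+ k).
Proof. by move=> ng; case: k => [|k]; [apply: not_nilpotent_on1|move/nilpotent_on_expn]. Qed.

Lemma nilpotent_or_injective y g : Ahomog y g -> nilpotent_on g \/
  (\forall x \near large, forall s : car S, of_deg x s -> g *: s = 0 -> s = 0).
Proof.
move=> hg; have [n nP] := power_stableX S_stable hg.
have [l lP] := colon_powers_stable (gsub0 S) hg; pose N := maxn n l.
have [le_nN le_lN] : (n <= N)%N /\ (l <= N)%N by rewrite leq_maxl leq_maxr.
have kerN k (s : car S) : g ^+ k *: s = 0 -> g ^+ N *: s = 0.
  by move=> /lP E; rewrite -(subnK le_lN) exprD -scalerA E scaler0.
have gU := gsub_colon (gsub0 S) (AhomogX N hg); have gV := gsub_im S (AhomogX N hg).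
have [||U0|V0] := indecomposable_complement gU gV _ _ S_indec.
- apply: nearW => x s ds Us [s' sE]; rewrite sE; apply: (kerN (N + N)%N).
  by rewrite exprD -scalerA -sE.
- near=> x => s ds; have [//|s' ds' E] := near (nP N) x _ s ds.
  exists (s - g ^+ N *: s'), (g ^+ N *: s'); split; [|by exists s'|by rewrite subrK].
  rewrite /= scalerBr scalerA -exprD -{1}(subnK le_nN) exprD -scalerA E scalerA -exprD.
  by rewrite addnA subnK // subrr.
- right; near=> x => s ds gs; apply: (near U0 x) => //.
  by apply: (kerN 1%N); rewrite expr1.
- left; exists N; have V0' := near_shift (y *+ N) V0; near=> x => s ds.
  by apply: (near V0' x) => //; [apply: of_degZX|exists s].
Unshelve. all: by end_near. Qed.

Lemma not_nilpotent_injX y b k : Ahomog y b -> ~ nilpotent_on b ->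
  \forall x \near large, forall s : car S, of_deg x s -> b ^+ k *: s = 0 -> s = 0.
Proof.
by move=> hb nb; have [/(not_nilpotent_onX nb)|] := nilpotent_or_injective (AhomogX k hb).
Qed.

Lemma not_nilpotent_divisible y b l : Ahomog y b -> ~ nilpotent_on b ->
  \forall x \near large, forall s : car S, of_deg x s -> exists s', s = b ^+ l *: s'.
Proof.
move=> hb nb; have [n nP] := power_stableX S_stable hb.
have inj := not_nilpotent_injX n hb nb; near=> x => s ds.
have [//|s' ds' E] := near (nP l) x _ s ds; exists s'.
apply/eqP; rewrite -subr_eq0; apply/eqP; apply: (near inj x) => //.
  by apply: of_degB => //; rewrite -[x](subrK (y *+ l)); apply: of_degZX.
by rewrite scalerBr scalerA -exprD E subrr.
Unshelve. all: by end_near. Qed.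

Lemma near_colon_not_nilpotent (U : set (car S)) : gsub U ->
  \forall x \near large, forall y b (s : car S), Ahomog y b -> ~ nilpotent_on b ->
    of_deg x s -> U (b *: s) -> U s.
Proof.
move=> gU; near=> x => y b s hb nb ds Ubs.
have [l lP] := colon_powers_stable gU hb; have divisible := not_nilpotent_divisible l hb nb.
have U_var i : \forall N \near \oo, U (Avar i ^+ N *: s).
  have divN := near_mulrn x (ldeg_gen_gt0 i) divisible; near=> N.
  have [//||s' E] := near divN N _ (Avar i ^+ N *: s).
    by apply: of_degZX => //; apply: Ahomog_var.
  rewrite E; apply: (lP l.+1); rewrite exprS -scalerA -E scalerA mulrC -scalerA.
  exact: gsubZ.
near \oo => N; apply: (near (near_saturated gU) x _ s N N) => //.
  exact: (near (U_var ord0) N).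
exact: (near (U_var o1) N).
Unshelve. all: by end_near. Qed.

Lemma nilpotent_on_prime y z g h : Ahomog y g -> Ahomog z h -> nilpotent_on (g * h) ->
  nilpotent_on g \/ nilpotent_on h.
Proof.
move=> hg hh [n ghn0]; apply: contrapT => /not_orP[ng nh]; apply: S_neq0.
have [injg injh] := (not_nilpotent_injX n hg ng, not_nilpotent_injX n hh nh).
have injg' := near_shift (z *+ n) injg; near=> x => s ds.
apply: (near injh x) => //; apply: (near injg' x) => //; first exact: of_degZX.
by rewrite scalerA -exprMn; apply: (near ghn0 x).
Unshelve. all: by end_near. Qed.

Lemma nilpotent_on_exists : exists y g, [/\ Ahomog y g, g <> 0 & nilpotent_on g].
Proof.
apply: contrapT => no.
have [x [s [colon ds s0]]] := not_near_element S_neq0 (near_colon_not_nilpotent (gsub0 S)).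
have [u uE] := Osh_elt ds; have u_inj : tail_inj u.
  near=> z => a /of_deg_Osh ha; rewrite (near uE z) // => as0; apply: contrapT => a0.
  by apply: s0; apply: (colon _ _ _ ha _ ds as0) => na; apply: no; exists (z - x), a.
have id0 := torsion_hom_Osh_eq0 (idm (Osh (- x))) (power_stable_sub u_inj S_stable).
apply: (@Osh_not_zero _ _ (- x)); apply/is_zeroP; near=> z => a da.
by rewrite -[a](near (hfun1 _) z) // id0 (near (hfun0 _ _) z).
Unshelve. all: by end_near. Qed.

Lemma nilpotent_Avar01 : nilpotent_on (Avar ord0) -> nilpotent_on (Avar o1) -> False.
Proof.
move=> [n X0n] [m X1m]; apply: S_neq0; near=> x => s ds.
by apply: (near (near_saturated (gsub0 S)) x _ s n m); rewrite ?(near X0n x) ?(near X1m x).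
Unshelve. all: by end_near. Qed.

Lemma pt_coordE i : i != ord0 -> pt X i = Some (pt_coord i).
Proof.
move=> i0; rewrite /pt_coord; case E: (pt X i) => //.
by move: i0; rewrite (@pt_inj _ X _ _ (etrans E (esym (pt0 X)))) eqxx.
Qed.

Lemma nilpotent_Avar_unique i j : nilpotent_on (Avar i) -> nilpotent_on (Avar j) -> i = j.
Proof.
move=> /nilpotent_on_Tvar ni /nilpotent_on_Tvar nj; apply/eqP; apply: contraT => ij; exfalso.
suff : nilpotent_on (Tvar ord0) /\ nilpotent_on (Tvar o1).
  by move=> [/nilpotent_on_Tvar n0 /nilpotent_on_Tvar n1]; apply: nilpotent_Avar01.
have from0 k : k != ord0 -> nilpotent_on (Tvar ord0) -> nilpotent_on (Tvar k) ->
    nilpotent_on (Tvar ord0) /\ nilpotent_on (Tvar o1).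
  move=> k0 n0 nk; split; first exact: n0.
  have /eqP := TvarE k0; rewrite eq_sym subr_eq => /eqP ->.
  exact/nilpotent_onD/nilpotent_onMl.
have [i0|i0] := eqVneq i ord0.
  by rewrite i0 in ni ij; apply: (from0 j) => //; rewrite eq_sym.
have [j0|j0] := eqVneq j ord0; first by rewrite j0 in nj; apply: (from0 i).
apply: (from0 i) => //; have cij : pt_coord j - pt_coord i != 0.
  by apply: contra ij; rewrite subr_eq0 => /eqP E; apply/eqP/(@pt_inj _ X); rewrite !pt_coordE ?E.
apply: (nilpotent_on_constM cij); rewrite rmorphB mulrBl.
have -> : Aconst X (pt_coord j) * Tvar ord0 - Aconst X (pt_coord i) * Tvar ord0 =
    Tvar i - Tvar j by rewrite (TvarE i0) (TvarE j0); ring.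
exact: nilpotent_onB.
Qed.

Lemma nilpotent_on_Amon m : nilpotent_on (Amon m) ->
  exists j, (0 < m j)%N /\ nilpotent_on (Avar j).
Proof.
rewrite AmonE; have hprod r : Ahomog (\sum_(j <- r) Lgen j *+ m j) (\prod_(j <- r) Avar j ^+ m j).
  elim: r => [|j r ih]; first by rewrite !big_nil; apply: Ahomog1.
  by rewrite !big_cons; apply: AhomogM => //; apply: Ahomog_varX.
elim: (index_enum _) => [|j r ih]; first by rewrite big_nil => /not_nilpotent_on1.
rewrite big_cons => /(nilpotent_on_prime (Ahomog_varX j (m j)) (hprod r))[nj|/ih//].
exists j; split; last exact: nilpotent_on_expn nj.
by rewrite lt0n; apply/eqP => mj; move: nj; rewrite mj expr0 => /not_nilpotent_on1.
Qed.

End NilpotentAction.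

Section PrincipalForms.
Variables (F : fieldType) (X : wpl F).
Local Notation t := (wt_n X).+2.
Local Notation o1 := (lift ord0 ord0 : 'I_t).
Implicit Types (i j : 'I_t) (p q : {poly F}).

Lemma homogenize_pad n k p : (size p <= n.+1)%N ->
  homogenize X (n + k) p = Tvar ord0 ^+ k * homogenize X n p.
Proof.
move=> sp; elim: k => [|k ih]; first by rewrite addn0 mul1r.
by rewrite addnS -Tvar0_homogenize ?ih ?exprS ?mulrA // (leq_trans sp) // ltnS leq_addr.
Qed.

Lemma homogenize_polyC n c : homogenize X n c%:P = Aconst X c * Tvar ord0 ^+ n.
Proof.
rewrite -[c%:P]mulr1 mul_polyC homogenizeZ -[n]add0n.
by rewrite homogenize_pad ?homogenize1 ?mulr1 // size_poly1.
Qed.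

Lemma homogenizeXn n : homogenize X n 'X^n = Tvar o1 ^+ n.
Proof.
elim: n => [|n ih]; first by rewrite expr0 homogenize1.
by rewrite exprS -Tvar1_homogenize ih exprS.
Qed.

Lemma homogenize_mod_Tvar i n p : (size p <= n.+1)%N -> exists j b c,
  j != i /\ homogenize X n p = Tvar i * b + Aconst X c * Tvar j ^+ n.
Proof.
move=> sp; have [->|i0] := eqVneq i ord0.
  have pE : p = (p - p`_n *: 'X^n) + p`_n *: 'X^n by rewrite subrK.
  have sr : (size (p - p`_n *: 'X^n)%R <= n)%N.
    apply/leq_sizeP => k le_nk; rewrite coefB coefZ coefXn; case: eqVneq => [->|kn].
      by rewrite mulr1 subrr.
    by rewrite mulr0 subr0; apply: (leq_sizeP _ _ sp); rewrite ltn_neqAle eq_sym kn.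
  rewrite pE raddfD /= homogenizeZ homogenizeXn; case: n sr {pE} sp => [|n] sr sp.
    exists o1, 0, p`_0; split=> //; rewrite mulr0.
    by rewrite (_ : p - _ = 0) ?raddf0 //; apply/eqP; rewrite -size_poly_leq0.
  by exists o1, (homogenize X n (p - p`_n.+1 *: 'X^(n.+1))), p`_n.+1; rewrite Tvar0_homogenize.
exists ord0; rewrite eq_sym; case: n sp => [|n] sp.
  exists 0, p`_0; split=> //; rewrite mulr0 add0r -homogenize_polyC.
  by rewrite -size1_polyC.
have sl : size (linform i) = 2%N by rewrite linformE // size_XsubC.
have rE : p %% linform i = ((p %% linform i)`_0)%:P.
  by apply: size1_polyC; rewrite -ltnS -sl ltn_modp linform_neq0.
exists (homogenize X n (p %/ linform i)), (p %% linform i)`_0; split=> //.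
rewrite Tvar_homogenize; last by rewrite size_divp ?linform_neq0 // sl /= leq_subLR.
by rewrite -homogenize_polyC -raddfD -rE mulrC -divp_eq.
Qed.

Lemma poly_ideal_principal (J : {poly F} -> Prop) :
  (forall p q, J p -> J q -> J (p - q)) -> (forall p q, J p -> J (q * p)) ->
  (exists2 p, J p & p != 0) -> exists p, [/\ J p, p != 0 & forall q, J q -> p %| q].
Proof.
move=> JB JM [p0 Jp0 p00].
pose P n := `[< exists p, [/\ J p, p != 0 & size p = n] >].
have exP : exists n, P n by exists (size p0); apply/asboolP; exists p0.
case: (ex_minnP exP) => n /asboolP[p [Jp p_neq0 sp]] n_min; exists p; split=> // q Jq.
have Jr : J (q %% p) by rewrite -[q %% p](addKr (q %/ p * p)) addrC -divp_eq; apply/JB/JM.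
rewrite /dvdp; apply: contraT => r0.
have /n_min : P (size (q %% p)) by apply/asboolP; exists (q %% p).
by rewrite leqNgt -sp ltn_modp p_neq0.
Qed.

End PrincipalForms.

Section NilpotentPrime.
Variables (F : finFieldType) (X : wpl F) (S : coh X).
Hypotheses (S_stable : power_stable S) (S_indec : indecomposable S).
Local Notation A := (Aalg X).
Local Notation L := (Lgrp X).
Local Notation nilp := (nilpotent_on S).
Implicit Types (a b g : A) (y z : L) (p q : {poly F}).

Lemma nilpotent_const c a : nilp (Aconst X c * a) -> ~ nilp a -> c = 0.
Proof.
by move=> nca na; apply/eqP; apply: contraT => /nilpotent_on_constM/(_ nca).
Qed.

Lemma nilpotent_dvd_Avar i z a : nilp (Avar i) -> Ahomog z a -> nilp a ->
  exists b, a = Avar i * b.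
Proof.
move=> ni ha na; have [z0|/(Avar_dvd ha)//] := posnP (nf_coef z i).
have [sp aE] := normal_form ha; set n := `|_|%N in sp aE.
have nh : nilp (homogenize X n (dehom a)).
  have [|m_nilp|//] := nilpotent_on_prime S_stable S_indec (Ahomog_mon (nf_mnm z))
    (Ahomog_homogenize X n (dehom a)); first by rewrite -aE.
  have [j [mj nj]] := nilpotent_on_Amon S_stable S_indec m_nilp.
  have ij := nilpotent_Avar_unique S_indec ni nj.
  by exfalso; move: mj; rewrite mnmE -ij z0.
have [j [b [c [ji hE]]]] := homogenize_mod_Tvar i sp.
have c0 : c = 0.
  apply: (@nilpotent_const c (Tvar j ^+ n)).
    have -> : Aconst X c * Tvar j ^+ n = homogenize X n (dehom a) - b * Tvar i.
      by rewrite hE [b * _]mulrC addrAC subrr add0r.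
    exact/nilpotent_onB/nilpotent_onMl/nilpotent_on_Tvar.
  apply: (not_nilpotent_onX S_indec) => /nilpotent_on_Tvar nj.
  by move: ji; rewrite -(nilpotent_Avar_unique S_indec ni nj) eqxx.
exists (Amon (nf_mnm z) * (Avar i ^+ (wt X i).-1 * b)).
rewrite {1}aE hE c0 rmorph0 mul0r addr0 [RHS]mulrCA; congr (_ * _).
by rewrite /Tvar -{1}(prednK (wt_gt0 X i)) exprS -mulrA.
Qed.

Section NoNilpotentVariable.
Hypothesis no_nilp_var : forall i, ~ nilp (Avar i).

Lemma nilpotent_homogenize_pad n k p : (size p <= n.+1)%N ->
  nilp (homogenize X (n + k) p) -> nilp (homogenize X n p).
Proof.
move=> sp; rewrite (homogenize_pad X k sp).
move=> /(nilpotent_on_prime S_stable S_indec (AhomogX k (Ahomog_Tvar ord0))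
  (Ahomog_homogenize X n p))[|//].
by move=> /nilpotent_on_expn/nilpotent_on_Tvar/no_nilp_var.
Qed.

Definition nilpotent_form p : Prop := nilp (homogenize X (size p).-1 p).

Lemma nilpotent_homogenize n p : (size p <= n.+1)%N ->
  nilp (homogenize X n p) <-> nilpotent_form p.
Proof.
rewrite /nilpotent_form => sp; have -> : n = ((size p).-1 + (n - (size p).-1))%N by lia.
split; first exact/nilpotent_homogenize_pad/leqSpred.
by move=> np; rewrite (homogenize_pad _ _ (leqSpred _)); apply: nilpotent_onMl.
Qed.

Lemma nilpotent_dehom z a : Ahomog z a -> nilp a -> nilpotent_form (dehom a).
Proof.
move=> ha; have [sp {1}->] := normal_form ha.
move=> /(nilpotent_on_prime S_stable S_indec (Ahomog_mon (nf_mnm z)) (Ahomog_homogenize X _ _))[].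
  by move=> /(nilpotent_on_Amon S_stable S_indec)[j [_ /no_nilp_var]].
by move=> /(nilpotent_homogenize sp).
Qed.

Lemma nilpotent_form_generator : exists p, [/\ nilpotent_form p, p != 0 &
  forall z a, Ahomog z a -> nilp a -> p %| dehom a].
Proof.
have [|||p [np p0 p_dvd]] := @poly_ideal_principal F nilpotent_form.
- move=> p q np nq; pose n := (size p + size q)%N.
  have [sp sq] : (size p <= n.+1)%N /\ (size q <= n.+1)%N by lia.
  have spq : (size (p - q)%R <= n.+1)%N.
    by apply: leq_trans (size_polyD _ _) _; rewrite size_polyN geq_max sp.
  apply: (proj1 (nilpotent_homogenize spq)); rewrite raddfB /=.
  apply: nilpotent_onB; first exact: (proj2 (nilpotent_homogenize sp)).
  exact: (proj2 (nilpotent_homogenize sq)).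
- move=> p q np; have [sp sq] := (leqSpred (size p), leqSpred (size q)).
  have spq : (size (q * p)%R <= ((size q).-1 + (size p).-1).+1)%N.
    by apply: leq_trans (size_polyMleq _ _) _; lia.
  apply: (proj1 (nilpotent_homogenize spq)); rewrite -homogenizeM //.
  exact: nilpotent_onMl.
- have [z [a [ha a0 na]]] := nilpotent_on_exists S_stable S_indec.
  exists (dehom a); first exact: nilpotent_dehom ha na.
  by apply/eqP => /(dehom_eq0 ha).
by exists p; split=> // z a ha /(nilpotent_dehom ha)/p_dvd.
Qed.

End NoNilpotentVariable.

Lemma nilpotent_generator : exists y g, [/\ Ahomog y g, 0 < ldeg y, nilp g &
  forall z a, Ahomog z a -> nilp a -> exists b, a = g * b].
Proof.
have [[i ni]|/forallNP no_nilp_var] := pselect (exists i, nilp (Avar i)).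
  exists (Lgen i), (Avar i); split=> // [||z a]; [exact: Ahomog_var|exact: ldeg_gen_gt0|].
  exact: nilpotent_dvd_Avar.
have [p [np p0 p_dvd]] := nilpotent_form_generator no_nilp_var.
rewrite /nilpotent_form in np; set n := (size p).-1 in np.
have sp : size p = n.+1 by rewrite prednK // size_poly_gt0.
exists (Lcan X *+ n), (homogenize X n p); split=> //; first exact: Ahomog_homogenize.
  rewrite raddfMn /= ldeg_can pmulrn_lgt0 ?ltz_nat ?wt_prod_gt0 // lt0n; apply/eqP => n0.
  have pE : p = (p`_0)%:P by apply: size1_polyC; rewrite sp n0.
  move: np p0; rewrite n0 pE homogenize_polyC polyC_eq0 => np; apply/negP; rewrite negbK.
  by apply/eqP/(nilpotent_const np); rewrite expr0; apply: not_nilpotent_on1.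
move=> z a ha na; have [sa aE] := normal_form ha; have /divpK qE := p_dvd z a ha na.
have [a0|a0] := eqVneq (dehom a) 0; first by exists 0; rewrite mulr0; apply: dehom_eq0 ha a0.
exists (Amon (nf_mnm z) * homogenize X (`|nf_mult z| - n) (dehom a %/ p)).
have le_n : (n <= `|nf_mult z|)%N.
  by rewrite -ltnS -sp; apply: leq_trans (dvdp_leq a0 (p_dvd z a ha na)) sa.
rewrite {1}aE -{1}qE -{1}(subnK le_n) -homogenizeM ?sp //; first by ring.
by rewrite size_divp // sp -subSn //; apply: leq_sub2r.
Qed.

End NilpotentPrime.

Section CyclicTorsion.
Variables (F : finFieldType) (X : wpl F).
Local Notation A := (Aalg X).
Local Notation L := (Lgrp X).
Local Notation C := (coh X).
Local Notation large := (large_degree X).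
Implicit Types (a b : A) (x z w : L).

Lemma near_mulrn_all (P : L -> Prop) y : 0 < ldeg y -> (\forall x \near large, P x) ->
  \forall x \near large, forall k, P (x + y *+ k).
Proof.
move=> y_gt0 /large_degreeP[d dP]; apply/large_degreeP; exists d => x dx k.
by apply: dP; rewrite raddfD raddfMn /=; have : 0 <= ldeg y *+ k by [rewrite mulrn_wge0 ?ltW]; lia.
Qed.

Lemma of_deg_divisor (M : gmod X) x y g (m r : M) : Ahomog y g -> of_deg x m ->
  m = g *: r -> m = g *: gpr (x - y) r.
Proof. by move=> hg dm mE; rewrite -(gpr_act_sub _ _ hg) -mE dm. Qed.

Lemma maximal_complement (M : gmod X) (E : set M) : exists U : set M,
  [/\ gsub U, forall m, U m -> E m -> m = 0 &
    forall V : set M, gsub V -> U `<=` V -> (forall m, V m -> E m -> m = 0) -> V `<=` U].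
Proof.
pose P (U : set M) := [/\ forall a m n, U m -> U n -> U (a *: m + n),
  forall x m, U m -> U (gpr x m) & forall m, U m -> E m -> m = 0].
have [|U [[UD Ug U_E] U_max]] := @Zorn_bigcup M P.
  move=> FF FP tot; split.
  - move=> a m n [V FV Vm] [W FW Wn]; have [VW|WV] := tot V W FV FW.
      by exists W => //; have [WD _ _] := FP W FW; apply: WD => //; apply: VW.
    by exists V => //; have [VD _ _] := FP V FV; apply: VD => //; apply: WV.
  - by move=> x m [V FV Vm]; exists V => //; have [_ Vg _] := FP V FV; apply: Vg.
  - by move=> m [V FV Vm]; have [_ _] := FP V FV; apply.
have U0 : U 0.
  have [[m Um]|no] := pselect (exists m, U m).
    by have := UD (-1) m m Um Um; rewrite scaleN1r addNr.
  exfalso; apply: (U_max [set 0]).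
    split; first by move=> m Um; case: no; exists m.
    by move=> /(_ 0 erefl) U0; apply: no; exists 0.
  by have [_ D0 g0] := gsub0 M; split=> // m ->.
exists U; split=> // V [_ VD Vg] UV V_E m Vm; apply: contrapT => Um.
by apply: (U_max V); [split=> // VU; apply/Um/VU|].
Qed.

Variables (S : C) (y : L) (g : A).
Hypotheses (S_stable : power_stable S) (S_indec : indecomposable S).
Local Notation nilp := (nilpotent_on S).
Hypotheses (hg : Ahomog y g) (y_gt0 : 0 < ldeg y) (g_nilp : nilp g).
Hypothesis g_dvd : forall z a, Ahomog z a -> nilp a -> exists b, a = g * b.

Let annihilated n := \forall x \near large, forall s : car S, of_deg x s -> g ^+ n *: s = 0.

Lemma nilpotency_index : exists n, annihilated n.+1 /\ ~ annihilated n.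
Proof.
have exP : exists n, `[< annihilated n >] by case: g_nilp => n gn0; exists n; apply/asboolP.
case: (ex_minnP exP) => -[|n] /asboolP gn0 n_min.
  by case: (not_nilpotent_on1 S_indec); exists 0%N; rewrite expr0 in gn0 *.
by exists n; split=> // /asboolP/n_min; rewrite ltnn.
Qed.

Lemma g_dvd_homog z a : Ahomog z a -> nilp a -> exists2 b, Ahomog (z - y) b & a = g * b.
Proof.
move=> ha /(g_dvd ha)[b aE]; exists (Apr (z - y) b); first exact: Ahomog_Apr.
by rewrite -(Apr_mul _ _ hg) -aE; apply/esym/AhomogP.
Qed.

Section MaximalOrder.
Variables (n : nat) (w : L) (e : car S).
Hypotheses (gn_e : of_deg w e) (gn0 : annihilated n.+1).
Hypothesis e_order : forall z a, Ahomog z a -> a *: (g ^+ n *: e) = 0 -> nilp a.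
Let E : set (car S) := [set s | exists a, s = a *: e].

Lemma lift_modulo_cyclic (U : set (car S)) x s : gsub U -> (forall m, U m -> E m -> m = 0) ->
  of_deg x s -> g ^+ n.+1 *: s = 0 -> ~ gadd U E s -> gadd U E (g *: s) ->
  exists s', [/\ of_deg x s', ~ gadd U E s' & U (g *: s')].
Proof.
move=> gU U_E ds gns nWs [u0 [_ [Uu0 [a0 ->] gsE0]]].
have gE : gsub E := gsub_cyclic gn_e.
pose u := gpr (x + y) u0; pose a := Apr (x + y - w) a0.
have Uu : U u by case: gU => _ _; apply.
have ha : Ahomog (x + y - w) a by apply: Ahomog_Apr.
have gsE : g *: s = u + a *: e.
  by rewrite -(of_degZ hg ds) gsE0 raddfD /= (gpr_scale _ _ gn_e).
have a_nilp : nilp a.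
  apply: (e_order ha); rewrite scalerA mulrC -scalerA.
  apply: U_E; last by exists (g ^+ n * a); rewrite scalerA.
  have -> : g ^+ n *: (a *: e) = - (g ^+ n *: u).
    by apply/eqP; rewrite -addr_eq0 addrC -scalerDr -gsE scalerA -exprSr gns.
  by rewrite -scaleN1r; do 2! apply: gsubZ => //.
have [a' ha' aE] := g_dvd_homog ha a_nilp; exists (s - a' *: e); split.
- apply: of_degB => //; rewrite -[x](_ : w + (x + y - w - y) = _); first exact: of_degZ.
  by rewrite addrC [x + y - w - y]addrAC addrK subrK.
- move=> Ws'; apply: nWs; rewrite -[s](subrK (a' *: e)).
  apply: (submoduleD (gsub_submodule (gsubA gU gE))) => //.
  by apply: gaddr => //; exists a'.
- by rewrite scalerBr gsE scalerA -aE addrK.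
Qed.

Lemma maximal_complement_colon (U : set (car S)) x s :
  gsub U -> (forall m, U m -> E m -> m = 0) ->
  (forall V, gsub V -> U `<=` V -> (forall m, V m -> E m -> m = 0) -> V `<=` U) ->
  (forall z b, Ahomog z b -> ~ nilp b -> gadd U E (b *: s) -> gadd U E s) ->
  of_deg x s -> U (g *: s) -> gadd U E s.
Proof.
move=> gU U_E U_max colon ds Ugs; apply: contrapT => nWs.
have gE : gsub E := gsub_cyclic gn_e; have gs := gsub_cyclic ds.
have gW := gsubA gU gE; pose V := gadd U [set v : car S | exists b, v = b *: s].
apply: (nWs); apply: gaddl => //; apply: (U_max V) => [|||].
- exact: gsubA.
- exact: gaddl.
- move=> _ [u [_ [Uu [b0 ->] ->]]] Ev; apply: gpr_ext => q; rewrite gpr0.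
  have Eq : E (gpr q (u + b0 *: s)) by case: gE => _ _; apply.
  have Uq : U (gpr q u) by case: gU => _ _; apply.
  move: Eq; rewrite raddfD /= (gpr_scale _ _ ds); set b := Apr _ _ => Eq.
  have hb : Ahomog (q - x) b by apply: Ahomog_Apr.
  have [b_nilp|b_nnilp] := pselect (nilp b).
    apply: U_E => //; apply: (submoduleD (gsub_submodule gU)) => //.
    by have [b' ->] := g_dvd hb b_nilp; rewrite mulrC -scalerA; apply: gsubZ.
  exfalso; apply/nWs/(colon _ _ hb b_nnilp).
  rewrite -[b *: s](addKr (gpr q u)) addrC.
  by apply: (submoduleB (gsub_submodule gW)); [apply: gaddr|apply: gaddl].
- by apply: gaddr => //; exists 1; rewrite scale1r.
Qed.

Lemma maximal_complement_spans (U : set (car S)) :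
  gsub U -> (forall m, U m -> E m -> m = 0) ->
  (forall V, gsub V -> U `<=` V -> (forall m, V m -> E m -> m = 0) -> V `<=` U) ->
  \forall x \near large, forall s, of_deg x s -> gadd U E s.
Proof.
move=> gU U_E U_max; have gW := gsubA gU (gsub_cyclic gn_e).
have colon := near_colon_not_nilpotent S_stable S_indec gW.
apply: contrapT => /not_near_element.
case/(_ _ (near_mulrn_all y_gt0 (filterI colon gn0))) => x [s [good ds nWs]].
have [k [nWk Wk]] : exists k, ~ gadd U E (g ^+ k *: s) /\ gadd U E (g ^+ k.+1 *: s).
  apply: contrapT => no; have nW k : ~ gadd U E (g ^+ k *: s).
    by elim: k => [|k ih]; [rewrite scale1r|move=> Wk; apply: no; exists k].
  apply: (nW n.+1); have [_ gns] := good 0%N.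
  by rewrite gns; [case: gW|rewrite addr0].
have [colon_k gns] := good k; have dk := of_degZX k hg ds.
rewrite exprS -scalerA in Wk.
have [s' [ds' nWs' Us']] := lift_modulo_cyclic gU U_E dk (gns _ dk) nWk Wk.
apply: nWs'; apply: (maximal_complement_colon gU U_E U_max _ ds' Us') => z b hb nb.
exact: colon_k hb nb ds'.
Qed.

End MaximalOrder.

Lemma cyclic_generator : exists w (e : car S), \forall x \near large,
  forall s : car S, of_deg x s -> exists2 a, Ahomog (x - w) a & s = a *: e.
Proof.
have [n [gn0 gn_neq0]] := nilpotency_index.
have colon := near_colon_not_nilpotent S_stable S_indec (gsub0 S).
have sat := near_saturated (gsub0 S).
have := not_near_element gn_neq0 (filterI (near_shift (y *+ n) colon) sat).
case=> w [e [[colon_w sat_w] de ge0]]; exists w, e.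
have e_order z a : Ahomog z a -> a *: (g ^+ n *: e) = 0 -> nilp a.
  move=> ha age0; apply: contrapT => na; apply: ge0.
  exact: colon_w ha na (of_degZX n hg de) age0.
pose E := [set s : car S | exists a, s = a *: e]; have gE : gsub E := gsub_cyclic de.
have [U [gU U_E U_max]] := maximal_complement E.
have W_all := maximal_complement_spans de gn0 e_order gU U_E U_max.
have [|U0|E0] := indecomposable_complement gU gE _ W_all S_indec.
- by apply: nearW => x s _; apply: U_E.
- near=> x => s ds; have [|u [_ [Uu [a ->] sE]]] := near W_all x _ s ds; first by [].
  exists (Apr (x - w) a); first exact: Ahomog_Apr.
  have u0 : gpr x u = 0.
    by apply: (near U0 x) => //; [apply: of_deg_gpr|case: gU => _ _; apply].
  by rewrite -{1}ds sE raddfD /= u0 add0r (gpr_scale _ _ de).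
- exfalso; have var_e0 i : \forall N \near \oo, Avar i ^+ N *: e = 0.
    have E0N := near_mulrn w (ldeg_gen_gt0 i) E0; near=> N.
    apply: (near E0N N) => //; last by exists (Avar i ^+ N).
    by apply: of_degZX => //; apply: Ahomog_var.
  near \oo => N; apply: ge0; rewrite (sat_w e N N) ?scaler0 //.
    exact: (near (var_e0 ord0) N).
  exact: (near (var_e0 (lift ord0 ord0)) N).
Unshelve. all: by end_near. Qed.

Section CyclicSubmodules.
Variables (w : L) (e : car S).
Hypothesis e_gen : \forall x \near large,
  forall s : car S, of_deg x s -> exists2 a, Ahomog (x - w) a & s = a *: e.

Definition divisible (k : nat) (U : set (car S)) : Prop :=
  \forall x \near large, forall s, of_deg x s -> U s -> exists r, s = g ^+ k *: r.

Definition tail_sub (U V : set (car S)) : Prop :=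
  \forall x \near large, forall s, of_deg x s -> U s -> V s.

Lemma contains_power (U : set (car S)) k : gsub U -> divisible k U -> ~ divisible k.+1 U ->
  \forall x \near large, forall r, of_deg x r -> U (g ^+ k *: r).
Proof.
rewrite /divisible => gU divk ndivk; have e_gen' := near_shift (- (y *+ k)) e_gen.
have [x [s [[divk_x e_gen_x] ds]]] := not_near_element ndivk (filterI divk e_gen').
move=> /not_implyP[Us ndiv]; have [r0 /(of_deg_divisor (AhomogX k hg) ds) sE] := divk_x s ds Us.
have [a ha rE] := e_gen_x _ (of_deg_gpr _ r0); rewrite rE in sE.
have colon : \forall z \near large, forall q, of_deg (z + y *+ k) q -> U (a *: q) -> U q.
  have na : ~ nilp a.
    move=> /(g_dvd ha)[b aE]; apply: ndiv; exists (b *: e).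
    by rewrite sE aE exprSr !scalerA mulrA.
  have colon := near_shift (y *+ k) (near_colon_not_nilpotent S_stable S_indec gU).
  by apply: filterS colon => z colon q; apply: colon ha na.
near=> z => q dq; have [//|c _ qE] := near e_gen z _ q dq.
apply: (near colon z) => //; first exact: of_degZX.
suff -> : a *: (g ^+ k *: q) = c *: s by apply: gsubZ.
by rewrite qE sE !scalerA; congr (_ *: _); ring.
Unshelve. all: by end_near. Qed.

Lemma tail_sub_of_divisible (U V : set (car S)) k : divisible k U ->
  (\forall x \near large, forall r, of_deg x r -> V (g ^+ k *: r)) -> tail_sub U V.
Proof.
rewrite /divisible /tail_sub => divU gV; have gV' := near_shift (- (y *+ k)) gV.
near=> x => s ds Us.
have [//|r /(of_deg_divisor (AhomogX k hg) ds) ->] := near divU x _ s ds Us.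
by apply: (near gV' x) => //; apply: of_deg_gpr.
Unshelve. all: by end_near. Qed.

Lemma tail_sub_total (U V : set (car S)) : gsub U -> gsub V -> tail_sub U V \/ tail_sub V U.
Proof.
move=> gU gV; have [n gn0] := g_nilp.
suff [[divU _]|//] : (divisible n U /\ divisible n V) \/ (tail_sub U V \/ tail_sub V U).
  left; apply: (tail_sub_of_divisible divU); near=> x => r dr.
  by rewrite (near gn0 x) //; case: gV.
elim: n {gn0} => [|k [[divU divV]|]]; last by right.
  by left; split; apply: nearW => x s ds _; exists s; rewrite scale1r.
have [divU'|ndivU] := pselect (divisible k.+1 U); last first.
  by right; right; apply: (tail_sub_of_divisible divV); apply: contains_power.
have [divV'|ndivV] := pselect (divisible k.+1 V); first by left.
by right; left; apply: (tail_sub_of_divisible divU); apply: contains_power.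
Unshelve. all: by end_near. Qed.

End CyclicSubmodules.
End CyclicTorsion.

Lemma indecomposable_uniserial (F : finFieldType) (X : wpl F) (S K K' : coh X)
    (i : hom K S) (i' : hom K' S) : power_stable S -> indecomposable S ->
  tail_inj i -> tail_inj i' ->
  (exists u : hom K K', comp i' u = i) \/ (exists u : hom K' K, comp i u = i').
Proof.
move=> S_stable S_indec i_inj i'_inj.
have [y [g [hg y_gt0 g_nilp g_dvd]]] := nilpotent_generator S_stable S_indec.
have [w [e e_gen]] := cyclic_generator S_stable S_indec hg y_gt0 g_nilp g_dvd.
have lift_of_sub M M' (j : hom M S) (j' : hom M' S) U U' : tail_inj j' -> tail_image U j ->
    tail_image U' j' -> tail_sub U U' -> exists u : hom M M', comp j' u = j.
  rewrite /tail_sub => j'_inj jU j'U' UU'; apply: tail_inj_lift => //; near=> x => m dm.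
  apply/(near j'U' x) => //; first exact: hfun_of_deg.
  apply: (near UU' x) => //; first exact: hfun_of_deg.
  by apply/(near jU x) => //; [apply: hfun_of_deg|exists m].
have [[U [gU iU]] [U' [gU' i'U']]] := (image_gsub i, image_gsub i').
have [UU'|U'U] := tail_sub_total S_stable S_indec hg g_nilp g_dvd e_gen gU gU'.
  by left; apply: lift_of_sub UU'.
by right; apply: lift_of_sub U'U.
Unshelve. all: by end_near. Qed.

(** * Epimorphisms from a line bundle plus a torsion sheaf *)

Section LineBundleObjects.
Variables (F : finFieldType) (X : wpl F).
Local Notation C := (coh X).
Implicit Types M P K B D S Y : C.

Lemma tail_inj_of_comp_eq0 M N (f : hom M N) :
  (forall P (g : hom P M), comp f g = 0 -> g = 0) -> tail_inj f.
Proof.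
move=> f_mono; apply/is_monoP => P g h fgh; apply/eqP; rewrite -subr_eq0; apply/eqP.
by apply: f_mono; rewrite compBr fgh subrr.
Qed.

Lemma tail_surj_of_comp_eq0 M N (f : hom M N) :
  (forall P (g : hom N P), comp g f = 0 -> g = 0) -> tail_surj f.
Proof.
move=> f_epi; have [Q [p [_ e]]] := cokernel_exists f.
have p0 := f_epi _ _ (tail_exact_comp0 e); rewrite p0 in e.
near=> x => n dn; apply: (proj1 (near e x _ n dn)) => //.
exact: (near (hfun0 N Q) x).
Unshelve. all: by end_near. Qed.

Lemma tail_surj_of_restrictions M N P S Y (p : hom P S) (i : hom M P) (j : hom N P) (c : hom S Y) :
  tail_surj (comp c (comp p i)) -> tail_exact (comp p j) c -> tail_surj p.
Proof.
move=> cpi_surj e; apply: tail_surj_of_comp_eq0 => D g gp0.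
have c_surj : tail_surj c by apply: tail_surj_comp_l cpi_surj.
have [|w wE] := cokernel_lift (g := g) c_surj e; first by rewrite comp_assoc gp0 comp0l.
suff w0 : w = 0 by rewrite -wE w0 comp0l.
by apply: (tail_surj_cancel cpi_surj); rewrite comp_assoc wE comp_assoc gp0 !comp0l.
Qed.

Lemma tail_exact_of_lift M N P (f : hom M N) (g : hom N P) : comp g f = 0 ->
  (forall K (h : hom K N), comp g h = 0 -> exists u : hom K M, comp f u = h) -> tail_exact f g.
Proof.
move=> gf0 lift; have [K [k [_ e]]] := kernel_exists g.
have [u /hfun_comp_eq uE] := lift _ _ (tail_exact_comp0 e).
near=> x => n dn; split=> [gn0|[m dm <-]]; last by apply: (near (hfun_comp_eq0 gf0) x).
have [//|m dm <-] := proj1 (near e x _ n dn) gn0.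
by exists (hfun u m); [apply: hfun_of_deg|apply: (near uE x)].
Unshelve. all: by end_near. Qed.

Lemma line_bundle_lift M K B D (i : hom K B) (p : hom B D) (u : hom M D) : is_line_bundle M ->
  short_exact i p -> power_stable K -> exists v : hom M B, comp p v = u.
Proof.
move=> [z [f [g [gf fg]]]] ip_exact K_stable; have [v vE] := Osh_lift (comp u g) ip_exact K_stable.
by exists (comp v f); rewrite comp_assoc vE -comp_assoc gf comp_idr.
Qed.

Lemma torsion_line_bundle_eq0 M S (f : hom S M) : is_line_bundle M -> power_stable S -> f = 0.
Proof.
move=> [z [g [g' [gg' _]]]] S_stable; have := torsion_hom_Osh_eq0 (comp g f) S_stable.
by move=> /(congr1 (comp g')); rewrite comp_assoc gg' comp_idl comp0r.
Qed.

Lemma line_bundle_epi_unique M Y (p p' : hom M Y) : is_line_bundle M ->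
  tail_surj p -> tail_surj p' -> exists2 u : hom Y Y, is_iso u & comp u p = p'.
Proof.
move=> [z [g [g' [gg' g'g]]]] p_surj p'_surj.
have /is_isoP[_ g'_surj] : is_iso g' by exists g.
have [u u_iso uE] :=
  Osh_epi_unique (tail_surj_comp p_surj g'_surj) (tail_surj_comp p'_surj g'_surj).
by exists u => //; apply: (tail_surj_cancel g'_surj); rewrite -comp_assoc.
Qed.

Lemma line_bundle_mono_iso M M' (f : hom M M') : is_line_bundle M -> isomorphic M M' ->
  tail_inj f -> is_iso f.
Proof.
move=> [z [g [g' [g'g gg']]]] [h [h' [h'h hh']]] f_inj.
have endM_finite : finite_mod eq (fun _ : hom M M => True).
  have [n endO] := Osh_hom_Osh_finite z z; exists n.
  apply: (has_card_bij (f := fun u => comp g' (comp u g)) _ _ _ endO) => // [u _|u v _ _].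
    exists (comp g (comp u g')) => //.
    by rewrite !comp_assoc g'g comp_idl -comp_assoc g'g comp_idr.
  move=> /(congr1 (fun w => comp g (comp w g'))).
  by rewrite !comp_assoc gg' !comp_idl -!comp_assoc gg' !comp_idr.
have h_iso : is_iso h by exists h'.
have /is_isoP[h'_inj _] : is_iso h' by exists h.
have h'f_iso : is_iso (comp h' f).
  by apply: mono_end_iso endM_finite _; apply/is_monoP; apply: tail_inj_comp.
by rewrite -[f]comp_idl -hh' -comp_assoc; apply: is_iso_comp.
Qed.

Lemma line_bundle_cokernel_unique M M' Y Y' (i i' : hom M M') (p : hom M' Y) (p' : hom M' Y') :
  is_line_bundle M -> is_line_bundle M' -> short_exact i p -> short_exact i' p' ->
  power_stable Y -> power_stable Y' -> same_localisations Y Y' -> isomorphic Y Y'.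
Proof.
move=> [z [g [g' [gg' g'g]]]] [z' [h [h' [hh' h'h]]]] ip_exact i'p'_exact.
have g'_iso : is_iso g' by exists g.
apply: Osh_cokernel_unique (short_exact_iso ip_exact g'_iso h'h hh' (is_iso_id Y)) _.
exact: short_exact_iso i'p'_exact g'_iso h'h hh' (is_iso_id Y').
Qed.

Lemma image_short_exact S S' S'' S2 (a : hom S S') (h : hom S' S'') (c : hom S'' S2) :
  tail_inj a -> tail_exact a h -> tail_surj c -> tail_exact h c ->
  exists T (r : hom S' T) (j : hom T S''),
    [/\ comp j r = h, short_exact a r & short_exact j c].
Proof.
move=> a_inj ae c_surj ce; have [T [r [j [r_surj j_inj hE]]]] := image_exists h.
exists T, r, j; rewrite -hE in ae ce; split=> //.
  by split=> //; apply/(tail_exact_comp_inj _ _ j_inj).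
by split=> //; apply/(tail_exact_comp_surj _ _ r_surj).
Qed.

Section BiproductKernels.
Variables (M M' S S' S'' K K' : C).
Variables (j1 : hom M K) (j2 : hom S K) (q1 : hom K M) (q2 : hom K S).
Variables (i1 : hom M' K') (i2 : hom S' K') (p1 : hom K' M') (p2 : hom K' S').
Hypotheses (M_bundle : is_line_bundle M) (M'_bundle : is_line_bundle M').
Hypotheses (S_stable : power_stable S) (S'_stable : power_stable S').
Hypotheses (K_bip : biproduct_maps j1 j2 q1 q2) (K'_bip : biproduct_maps i1 i2 p1 p2).

Section OfShortExact.
Variables (k : hom K K') (p : hom K' S'').
Hypothesis kp_exact : short_exact k p.

Let k_inj : tail_inj k. Proof. by case: kp_exact. Qed.
Let kp_tail_exact : tail_exact k p. Proof. by case: kp_exact. Qed.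

Lemma kernel_torsion_part : exists a : hom S S',
  [/\ comp k j2 = comp i2 a, tail_inj a & tail_exact a (comp p i2)].
Proof.
pose a := comp p2 (comp k j2); have kj2 : comp k j2 = comp i2 a.
  rewrite -[LHS](pair_eta K'_bip) [comp p1 _](torsion_line_bundle_eq0 _ M'_bundle S_stable).
  by rewrite comp0r add0r.
have [_ q2j2 q1j2 _ _] := K_bip; have [_ p2i2 _ _ _] := K'_bip.
have kj2_inj : tail_inj (comp k j2) by apply: tail_inj_comp (tail_inj_retract q2j2).
exists a; split=> //; first by apply: (@tail_inj_comp_r _ _ _ _ _ i2); rewrite -kj2.
have [T [b [b_inj be]]] := kernel_exists (comp p i2).
have T_stable := power_stable_sub b_inj S'_stable.
apply: tail_exact_of_lift.
  by rewrite -comp_assoc -kj2 comp_assoc (tail_exact_comp0 kp_tail_exact) comp0l.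
move=> P h pi2h; have [v vE] := kernel_lift b_inj be pi2h; rewrite -vE.
have [|t tE] := @kernel_lift _ _ _ _ _ _ k p (comp i2 b) k_inj kp_tail_exact.
  by rewrite comp_assoc (tail_exact_comp0 be).
have tj : t = comp j2 (comp q2 t).
  rewrite -[LHS](pair_eta K_bip) [comp q1 _](torsion_line_bundle_eq0 _ M_bundle T_stable).
  by rewrite comp0r add0r.
exists (comp (comp q2 t) v); rewrite comp_assoc; congr (comp _ v).
apply: (tail_inj_cancel (tail_inj_retract p2i2)).
by rewrite comp_assoc -kj2 -comp_assoc -tj tE.
Qed.

Variables (Y : C) (c : hom S'' Y).
Hypotheses (c_surj : tail_surj c) (ce : tail_exact (comp p i2) c).

Lemma kernel_bundle_part : exists b : hom M M', short_exact b (comp c (comp p i1)).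
Proof.
have [a [kj2 a_inj ae]] := kernel_torsion_part; pose b := comp p1 (comp k j1).
have [_ p_surj _] := kp_exact; have pk0 := tail_exact_comp0 kp_tail_exact.
have [q1j1 _ q1j2 _ _] := K_bip; have [p1i1 _ p1i2 _ _] := K'_bip.
have p1k : comp p1 k = comp b q1.
  rewrite -[LHS](copair_eta K_bip) [comp _ j2](torsion_line_bundle_eq0 _ M'_bundle S_stable).
  by rewrite comp0l addr0 /b [comp p1 (comp k j1)]comp_assoc.
have cp : comp c p = comp (comp c (comp p i1)) p1.
  rewrite -[LHS](copair_eta K'_bip) -![comp (comp c p) _]comp_assoc.
  by rewrite (tail_exact_comp0 ce) comp0l addr0.
exists b; split.
- apply: tail_inj_of_comp_eq0 => P g bg0.
  have kj1g : comp k (comp j1 g) = comp i2 (comp p2 (comp k (comp j1 g))).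
    rewrite -[LHS](pair_eta K'_bip) [comp p1 _](_ : _ = 0) ?comp0r ?add0r //.
    by rewrite -bg0 /b -!comp_assoc.
  have [|u uE] := kernel_lift (g := comp p2 (comp k (comp j1 g))) a_inj ae.
    by rewrite -comp_assoc -kj1g comp_assoc pk0 comp0l.
  have j1g : comp j1 g = comp j2 u.
    by apply: (tail_inj_cancel k_inj); rewrite kj1g -uE !comp_assoc kj2.
  by rewrite -[g]comp_idl -q1j1 -comp_assoc j1g comp_assoc q1j2 comp0l.
- apply: (@tail_surj_comp_l _ _ _ _ _ _ p1); rewrite -cp; exact: tail_surj_comp.
- have cpi1b0 : comp (comp c (comp p i1)) b = 0.
    by rewrite /b comp_assoc -cp comp_assoc -[comp (comp c p) k]comp_assoc pk0 comp0r comp0l.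
  near=> x => n dn; split=> [cpn0|[m dm <-]]; last exact: (near (hfun_comp_eq0 cpi1b0) x).
  rewrite (near (hfunM _ _) x) // in cpn0; have dpn := hfun_of_deg (comp p i1) dn.
  have [//|s ds sE] := proj1 (near ce x _ _ dpn) cpn0.
  have de : of_deg x (hfun i1 n - hfun i2 s) by apply: of_degB; apply: hfun_of_deg.
  have pe0 : hfun p (hfun i1 n - hfun i2 s) = 0.
    by rewrite raddfB /= -(near (hfunM p i1) x) // -(near (hfunM p i2) x) // sE subrr.
  have [//|y dy yE] := proj1 (near kp_tail_exact x _ _ de) pe0.
  exists (hfun q1 y); first exact: hfun_of_deg.
  rewrite -(near (hfunM b q1) x) // -p1k (near (hfunM p1 k) x) // yE raddfB /=.
  by rewrite (near (hfun_comp_id p1i1) x) // (near (hfun_comp_eq0 p1i2) x) // subr0.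
Unshelve. all: by end_near. Qed.

End OfShortExact.

Lemma short_exact_assemble Y (p : hom K' S'') (c : hom S'' Y) (a : hom S S') (b : hom M M') :
  tail_inj a -> tail_exact a (comp p i2) -> tail_exact (comp p i2) c ->
  short_exact b (comp c (comp p i1)) -> exists k : hom K K', short_exact k p.
Proof.
move=> a_inj ae ce [b_inj cp_surj be]; have pi2a0 := tail_exact_comp0 ae.
have [T [r [t [r_surj t_inj rE]]]] := image_exists (comp p i2).
have [u uE] : exists u, comp t u = comp (comp p i1) b.
  apply: (kernel_lift (f := c) t_inj); last by rewrite comp_assoc (tail_exact_comp0 be).
  by apply/(tail_exact_comp_surj _ _ r_surj); rewrite rE.
have ar_exact : short_exact a r.
  by split=> //; apply/(tail_exact_comp_inj _ _ t_inj); rewrite rE.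
have [s sE] := line_bundle_lift u M_bundle ar_exact S_stable.
have pi2s : comp (comp p i2) s = comp (comp p i1) b by rewrite -rE -comp_assoc sE.
pose k := comp i1 (comp b q1) + comp i2 (comp a q2 - comp s q1).
have p1k : comp p1 k = comp b q1 by rewrite (pair_fst K'_bip).
have p2k : comp p2 k = comp a q2 - comp s q1 by rewrite (pair_snd K'_bip).
have pE P (f : hom P K') :
    comp p f = comp (comp p i1) (comp p1 f) + comp (comp p i2) (comp p2 f).
  by rewrite -{1}(copair_eta K'_bip p) compDl -!comp_assoc.
have p2kf P (f : hom P K) : comp p2 (comp k f) = comp a (comp q2 f) - comp s (comp q1 f).
  by rewrite comp_assoc p2k compBl -!comp_assoc.
have p1kf P (f : hom P K) : comp p1 (comp k f) = comp b (comp q1 f).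
  by rewrite comp_assoc p1k -comp_assoc.
exists k; split.
- apply: tail_inj_of_comp_eq0 => P f kf0; rewrite -[f](pair_eta K_bip).
  have q1f : comp q1 f = 0.
    by apply: (tail_inj_cancel b_inj); rewrite -p1kf kf0 !comp0r.
  have -> : comp q2 f = 0.
    apply: (tail_inj_cancel a_inj); have := p2kf _ f.
    by rewrite kf0 q1f !comp0r subr0.
  by rewrite q1f !comp0r addr0.
- exact: tail_surj_of_restrictions cp_surj ce.
- apply: tail_exact_of_lift => [|P f pf0].
    rewrite pE p1k p2k compBr comp_assoc -pi2s [comp (comp p i2) (comp a _)]comp_assoc pi2a0.
    by rewrite comp0l sub0r comp_assoc subrr.
  have [|v vE] := kernel_lift (g := comp p1 f) b_inj be.
    have := congr1 (comp c) pf0; rewrite comp0r pE compDr [comp c (comp (comp p i2) _)]comp_assoc.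
    by rewrite (tail_exact_comp0 ce) comp0l addr0 comp_assoc.
  have [|w wE] := kernel_lift (g := comp p2 f + comp s v) a_inj ae.
    by rewrite compDr [comp _ (comp s v)]comp_assoc pi2s -[comp _ v]comp_assoc vE addrC -pE.
  exists (comp j1 v + comp j2 w); rewrite -[LHS](pair_eta K'_bip) -[RHS](pair_eta K'_bip).
  by rewrite p1kf p2kf (pair_fst K_bip) (pair_snd K_bip) vE wE addrK.
Qed.

End BiproductKernels.
End LineBundleObjects.

(** * Hall numbers *)

Section HallCounting.
Variables (F : finFieldType) (X : wpl F).
Local Notation C := (coh X).
Implicit Types A B D K M P S Y Z : C.

Lemma hom_has_card M S : power_stable S -> has_card (fun _ : hom M S => True) (hom_card M S).
Proof. by move=> /(hom_finite M)[n cn]; rewrite /hom_card (ncard_has_card cn). Qed.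

Lemma hom_finite_sub M S (Q : hom M S -> Prop) : power_stable S -> exists n, has_card Q n.
Proof. by move=> /(hom_finite M); apply: (finite_mod_sub eq_equivalence). Qed.

Lemma hom_card_gt0 M S : power_stable S -> (0 < hom_card M S)%N.
Proof. by move=> /(hom_has_card M); apply: (@card_mod_gt0 _ _ _ _ (0 : hom M S)). Qed.

Lemma aut_has_card S : power_stable S -> has_card (@is_iso C S S) (aut_card S).
Proof.
by move=> /(hom_finite_sub (@is_iso C S S))[n cn]; rewrite /aut_card (ncard_has_card cn).
Qed.

Lemma aut_card_gt0 S : power_stable S -> (0 < aut_card S)%N.
Proof. by move=> /aut_has_card; apply: card_mod_gt0 (is_iso_id S). Qed.

Lemma line_bundle_lift_card M K B D (i : hom K B) (p : hom B D) (Q : hom M D -> Prop) n :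
  is_line_bundle M -> short_exact i p -> power_stable K -> has_card Q n ->
  has_card (fun g : hom M B => Q (comp p g)) (n * hom_card M K)%N.
Proof.
move=> M_bundle ip_exact K_stable cQ; have [i_inj _ e] := ip_exact.
apply: (has_card_mul (f := comp p) cQ) => // u Qu.
have [g0 g0E] := line_bundle_lift u M_bundle ip_exact K_stable.
apply: (has_card_bij (f := fun w => g0 + comp i w)) (hom_has_card M K_stable).
- move=> w _; suff -> : comp p (g0 + comp i w) = u by [].
  by rewrite compDr comp_assoc (tail_exact_comp0 e) comp0l addr0.
- move=> g [_ gE]; have [|w wE] := short_exact_difference (g := g) (g' := g0) ip_exact.
    by rewrite gE.
  by exists w.
- by move=> w w' _ _ /addrI/(tail_inj_cancel i_inj).
Qed.

Lemma hom_card_extension M K B D (i : hom K B) (p : hom B D) : is_line_bundle M ->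
  short_exact i p -> power_stable K -> power_stable B -> power_stable D ->
  hom_card M B = (hom_card M D * hom_card M K)%N.
Proof.
move=> M_bundle ip_exact K_stable B_stable D_stable.
apply: has_card_unique (hom_has_card M B_stable) _.
exact: line_bundle_lift_card M_bundle ip_exact K_stable (hom_has_card M D_stable).
Qed.

Lemma line_bundle_epi_card M Y (p : hom M Y) : is_line_bundle M -> tail_surj p ->
  power_stable Y -> has_card (fun q : hom M Y => tail_surj q) (aut_card Y).
Proof.
move=> M_bundle p_surj /aut_has_card.
apply: (has_card_bij (f := fun u => comp u p)) => [u /is_isoP[_ u_surj]|q q_surj|u v _ _].
- exact: tail_surj_comp.
- by have [u u_iso <-] := line_bundle_epi_unique M_bundle p_surj q_surj; exists u.
- exact: tail_surj_cancel.
Qed.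

Definition hall_subobject A B M (U : {Y : C & hom Y M} -> Prop) : Prop :=
  exists2 k : hom B M, exists p : hom M A, short_exact k p & U = sub_class k.

Lemma hallE A B M : hall A B M = ncard (@hall_subobject A B M).
Proof.
rewrite /hall; congr (ncard _); apply: funext => U; apply: propext; split.
  move=> [P [i [/is_monoP i_inj [u u_iso] [p /is_cokernelP[p_surj e]] ->]]].
  have [v [vu uv]] := u_iso; have /is_isoP[v_inj v_surj] : is_iso v by exists u.
  exists (comp i v); last first.
    by apply/sub_classP; exists u => //; rewrite -comp_assoc vu comp_idr.
  by exists p; split=> //; [exact: tail_inj_comp|apply/tail_exact_comp_surj].
move=> [k [p [k_inj p_surj e]] ->]; exists B, k.
split=> //; [exact/is_monoP|exact: isomorphic_refl|].
by exists p; apply/is_cokernelP.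
Qed.

Lemma hall_neq0 A B M : hall A B M <> 0%N -> exists (k : hom B M) (p : hom M A), short_exact k p.
Proof. by rewrite hallE => /ncard_neq0[U [k [p kp_exact] _]]; exists k, p. Qed.

Lemma hall_subobject_finite A B M : power_stable A -> exists h, has_card (@hall_subobject A B M) h.
Proof.
move=> /(hom_finite M)[n [f [_ _ f_surj]]].
apply: (finite_mod_classify eq_equivalence
  (R := fun U i => exists2 k : hom B M, short_exact k (f i) & U = sub_class k)).
  move=> U [k [p kp_exact] UE]; have [i pE] := f_surj p I.
  by exists i, k; rewrite -?pE.
move=> U U' i _ _ [k [k_inj _ e] ->] [k' [k'_inj _ e'] ->].
exact/sub_classP/(kernel_unique k_inj e k'_inj e').
Qed.

Lemma hall_epi_card A B M N : power_stable A ->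
  has_card (fun p : hom M A => exists k : hom B M, short_exact k p) N ->
  (hall A B M * aut_card A = N)%N.
Proof.
move=> A_stable cN; have [h ch] := @hall_subobject_finite A B M A_stable.
rewrite hallE (ncard_has_card ch); apply: has_card_unique _ cN.
have /choice[U UP] : forall p : hom M A, exists U : {Y : C & hom Y M} -> Prop,
    forall k : hom B M, short_exact k p -> U = sub_class k.
  move=> p; have [[k [k_inj p_surj e]]|no] := pselect (exists k : hom B M, short_exact k p).
    by exists (sub_class k) => k' [k'_inj _ e']; apply/sub_classP/(kernel_unique k_inj e k'_inj e').
  by exists (fun=> True) => k kp; case: no; exists k.
apply: (has_card_mul (f := U) ch) => [p [k kp_exact]|_ [k0 [p0 kp0_exact] ->]].
  by exists k; [exists p|apply: UP].
have [k0_inj p0_surj e0] := kp0_exact.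
apply: (has_card_bij (f := fun u => comp u p0)) (aut_has_card A_stable).
- move=> u /is_isoP[u_inj u_surj].
  have kup : short_exact k0 (comp u p0).
    by split=> //; [exact: tail_surj_comp|apply/tail_exact_comp_inj].
  by split; [exists k0|apply: UP].
- move=> p [[k kp_exact]]; rewrite (UP _ _ kp_exact) => /esym/sub_classP.
  have [k_inj p_surj e] := kp_exact; move=> [u /is_isoP[_ u_surj] uE].
  have e' : tail_exact k0 p by rewrite -uE; apply/tail_exact_comp_surj.
  by have [v v_iso vE] := cokernel_unique p0_surj e0 p_surj e'; exists v.
- by move=> u v _ _; apply: tail_surj_cancel.
Qed.

Lemma hall_mono_card A B M N : power_stable A -> power_stable B ->
  has_card (fun k : hom B M => exists p : hom M A, short_exact k p) N ->
  (hall A B M * aut_card B = N)%N.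
Proof.
move=> A_stable B_stable cN; have [h ch] := @hall_subobject_finite A B M A_stable.
rewrite hallE (ncard_has_card ch); apply: has_card_unique _ cN.
apply: (has_card_mul (f := fun k => sub_class k) ch) => [k [p kp]|_ [k0 [p0 kp0_exact] ->]].
  by exists k => //; exists p.
have [k0_inj p0_surj e0] := kp0_exact.
apply: (has_card_bij (f := comp k0)) (aut_has_card B_stable).
- move=> u u_iso; have /is_isoP[u_inj u_surj] := u_iso; split; last by apply/sub_classP; exists u.
  by exists p0; split=> //; [exact: tail_inj_comp|apply/tail_exact_comp_surj].
- by move=> k [_ /sub_classP[u u_iso uE]]; exists u.
- by move=> u v _ _; apply: tail_inj_cancel.
Qed.

Section ImageClasses.
Variables S S' S'' S2 : C.
Hypotheses (S'_stable : power_stable S') (S''_stable : power_stable S'').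

Definition has_kernel_cokernel (h : hom S' S'') : Prop :=
  (exists a : hom S S', tail_inj a /\ tail_exact a h) /\
  (exists c : hom S'' S2, tail_surj c /\ tail_exact h c).

Definition is_image (h : hom S' S'') Z : Prop :=
  exists (p : hom S' Z) (j : hom Z S''), [/\ tail_surj p, tail_inj j & comp j p = h].

Lemma is_image_unique h Z Z' : is_image h Z -> is_image h Z' -> isomorphic Z Z'.
Proof.
move=> [p [j [p_surj j_inj hE]]] [p' [j' [p'_surj j'_inj hE']]].
have [|u [u_iso _ _]] := factorization_unique p_surj j_inj p'_surj j'_inj; first by rewrite hE.
by exists u.
Qed.

Lemma is_image_iso h Z Z' : isomorphic Z Z' -> is_image h Z -> is_image h Z'.
Proof.
move=> [u [v [vu uv]]] [p [j [p_surj j_inj hE]]].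
have [/is_isoP[_ u_surj] /is_isoP[v_inj _]] : is_iso u /\ is_iso v by split; [exists v|exists u].
exists (comp u p), (comp j v); split; [exact: tail_surj_comp|exact: tail_inj_comp|].
by rewrite comp_assoc -[comp (comp j v) u]comp_assoc vu comp_idr.
Qed.

Lemma has_kernel_cokernel_factor Z (p : hom S' Z) (j : hom Z S'') : tail_surj p -> tail_inj j ->
  has_kernel_cokernel (comp j p) <->
  (exists a : hom S S', short_exact a p) /\ (exists c : hom S'' S2, short_exact j c).
Proof.
move=> p_surj j_inj; split=> -[[a aP] [c cP]]; split; [exists a|exists c|exists a|exists c].
- by case: aP => a_inj ae; split=> //; apply/(tail_exact_comp_inj _ _ j_inj).
- by case: cP => c_surj ce; split=> //; apply/(tail_exact_comp_surj _ _ p_surj).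
- by case: aP => a_inj _ ae; split=> //; apply/tail_exact_comp_inj.
- by case: cP => _ c_surj ce; split=> //; apply/tail_exact_comp_surj.
Qed.

Lemma image_card Z n : power_stable S2 -> power_stable Z ->
  has_card (fun h => has_kernel_cokernel h /\ is_image h Z) n ->
  n = (hall Z S S' * hall S2 Z S'' * aut_card Z)%N.
Proof.
move=> S2_stable Z_stable cn.
have [N1 c1] := hom_finite_sub (fun p : hom S' Z => exists a : hom S S', short_exact a p) Z_stable.
have [N2 c2] :=
  hom_finite_sub (fun j : hom Z S'' => exists c : hom S'' S2, short_exact j c) S''_stable.
suff : (N1 * N2 = n * aut_card Z)%N.
  rewrite -(hall_epi_card Z_stable c1) -(hall_mono_card S2_stable Z_stable c2) mulnACA => E.
  apply/eqP; rewrite -(eqn_pmul2r (aut_card_gt0 Z_stable)) -E; apply/eqP; ring.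
apply: has_card_unique (has_card_prod c1 c2) _.
apply: (has_card_mul (f := fun q => comp q.2 q.1) cn) => [[p j] /= [[a ap] [c jc]]|].
  have [[_ p_surj _] [j_inj _ _]] := (ap, jc); split; last by exists p, j.
  by apply/has_kernel_cokernel_factor => //; split; [exists a|exists c].
move=> h [h_kc [p0 [j0 [p0_surj j0_inj hE]]]].
have /choice[f fP] : forall u : hom Z Z, exists q : hom S' Z * hom Z S'',
    is_iso u -> q.1 = comp u p0 /\ comp q.2 u = j0.
  move=> u; have [[v [vu uv]]|nu] := pselect (is_iso u); last by exists (p0, j0).
  exists (comp u p0, comp j0 v) => _; split; first by [].
  by rewrite -(comp_assoc j0 v u) vu comp_idr.
apply: (has_card_bij (f := f)) (aut_has_card Z_stable) => [u u_iso|[p j] /=|u v u_iso v_iso uv].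
- have [f1 f2] := fP u u_iso; have /is_isoP[u_inj u_surj] := u_iso.
  have fE : comp (f u).2 (f u).1 = h by rewrite f1 comp_assoc f2.
  have f1_surj : tail_surj (f u).1 by rewrite f1; apply: tail_surj_comp.
  have f2_inj : tail_inj (f u).2.
    have [v [vu uv]] := u_iso; have /is_isoP[v_inj _] : is_iso v by exists u.
    by rewrite -[(f u).2]comp_idr -uv comp_assoc f2; apply: tail_inj_comp.
  by split=> //; apply/has_kernel_cokernel_factor => //; rewrite fE.
- move=> [[[a [_ p_surj _]] [c [j_inj _ _]]] E].
  have [|u [u_iso u1 u2]] := factorization_unique p0_surj j0_inj p_surj j_inj; first by rewrite hE.
  exists u => //; have [f1 f2] := fP u u_iso; have /is_isoP[_ u_surj] := u_iso.
  rewrite [f u]surjective_pairing f1 u1; congr pair.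
  by apply: (tail_surj_cancel u_surj); rewrite f2.
- apply: (tail_surj_cancel p0_surj).
  by rewrite -(proj1 (fP u u_iso)) -(proj1 (fP v v_iso)) uv.
Qed.

Lemma has_kernel_cokernel_card n : has_card has_kernel_cokernel n ->
  exists m (e : 'I_m -> C), [/\ forall i j, isomorphic (e i) (e j) -> i = j,
    forall Z (a : hom S S') (p : hom S' Z) (j : hom Z S'') (c : hom S'' S2),
      short_exact a p -> short_exact j c -> exists i, isomorphic Z (e i)
    & n = (\sum_i hall (e i) S S' * hall S2 (e i) S'' * aut_card (e i))%N].
Proof.
move=> cn; pose im (h : hom S' S'') := sval (cid (image_exists h)).
have imP h : is_image h (im h).
  by case: (svalP (cid (image_exists h))) => p [j pj]; exists p, j.
have [m [e [eP e_inj e_surj]]] : finite_mod (@isomorphic C)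
    (fun Z => exists2 h, has_kernel_cokernel h & is_image h Z).
  have [N [f [_ _ f_surj]]] := hom_finite S' S''_stable.
  apply: (finite_mod_classify (@isomorphic_equiv C) (R := fun Z i => is_image (f i) Z)).
    by move=> Z [h _ hZ]; have [i hE] := f_surj h I; exists i; rewrite -hE.
  by move=> Z Z' i _ _; apply: is_image_unique.
exists m, e; split=> [//|Z a p j c ap jc|].
  have [[_ p_surj _] [j_inj _ _]] := (ap, jc); apply: e_surj.
  exists (comp j p); last by exists p, j.
  by apply/has_kernel_cokernel_factor => //; split; [exists a|exists c].
have e_stable i : power_stable (e i) /\ power_stable S2.
  have [h h_kc [p [j [p_surj j_inj hE]]]] := eP i; have [_ [c [c_surj _]]] := h_kc.
  by split; [exact: power_stable_quotient p_surj _|exact: power_stable_quotient c_surj _].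
have /choice[k kP] i : exists k, has_card (fun h => has_kernel_cokernel h /\ is_image h (e i)) k.
  by apply: hom_finite_sub.
have -> : (\sum_i hall (e i) S S' * hall S2 (e i) S'' * aut_card (e i) = \sum_i k i)%N.
  by apply: eq_bigr => i _; have [? ?] := e_stable i; rewrite -(image_card _ _ (kP i)).
apply: has_card_unique cn _.
apply: (card_mod_sum (f := im) (@isomorphic_equiv C) e_inj e_surj) => [h h_kc|h h' _ _ ->|i].
- by exists h.
- exact: isomorphic_refl.
- apply: has_card_ext (kP i) => h; split=> -[h_kc hZ]; split=> //.
    exact: is_image_unique (imP h) hZ.
  exact: is_image_iso hZ (imP h).
Qed.

End ImageClasses.
End HallCounting.

Section Indecomposable.
Variables (F : finFieldType) (X : wpl F).
Local Notation C := (coh X).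
Implicit Types K M N P S T : C.

Lemma short_exact_is_iso M N P (i : hom M N) (p : hom N P) : short_exact i p ->
  is_iso i <-> tail_null P.
Proof.
move=> [i_inj p_surj e]; split=> [/is_isoP[_ i_surj]|P0].
  near=> x => n dn; have [//|m dm <-] := near p_surj x _ n dn.
  by apply/(near e x) => //; apply: (near i_surj x).
apply/is_isoP; split=> //; near=> x => n dn; apply: (proj1 (near e x _ n dn)) => //.
by apply: (near P0 x) => //; apply: hfun_of_deg.
Unshelve. all: by end_near. Qed.

Lemma aut_card_zero M : tail_null M -> aut_card M = 1%N.
Proof.
move=> M0; have uniq (f : hom M M) : f = idm M.
  apply/hom_eqP; near=> x => m dm; rewrite [m](near M0 x) //.
  by rewrite !raddf0.
apply: ncard_has_card; exists (fun=> idm M); split=> [i|i i' _|f _]; first exact: is_iso_id.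
  by rewrite !ord1.
by exists ord0; rewrite (uniq f).
Unshelve. all: by end_near. Qed.

Lemma indecomposable_mono_unique S K (i i' : hom K S) : power_stable S -> indecomposable S ->
  tail_inj i -> tail_inj i' -> exists2 u : hom K K, is_iso u & comp i u = i'.
Proof.
move=> S_stable S_indec i_inj i'_inj.
have endK_finite := hom_finite K (power_stable_sub i_inj S_stable).
have retract_iso (f g : hom K S) u : comp f u = g -> tail_inj g -> is_iso u.
  move=> <- /tail_inj_comp_r u_inj.
  by apply: mono_end_iso endK_finite _; apply/is_monoP.
have [[u uE]|[u uE]] := indecomposable_uniserial S_stable S_indec i_inj i'_inj; last first.
  by exists u => //; apply: retract_iso uE i'_inj.
have [v [vu uv]] := retract_iso _ _ _ uE i_inj; exists v; first by exists u.
by rewrite -uE -comp_assoc uv comp_idr.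
Qed.

Lemma indecomposable_cokernel_unique S S' T T' (a a' : hom S S') (p : hom S' T) (p' : hom S' T') :
  power_stable S' -> indecomposable S' -> short_exact a p -> short_exact a' p' ->
  isomorphic T T'.
Proof.
move=> S'_stable S'_indec [a_inj p_surj e] [a'_inj p'_surj e'].
have [u /is_isoP[_ u_surj] uE] := indecomposable_mono_unique S'_stable S'_indec a_inj a'_inj.
have [] := cokernel_unique p_surj e p'_surj _; last by move=> v v_iso _; exists v.
by apply/(tail_exact_comp_surj _ _ u_surj); rewrite uE.
Qed.

Lemma indecomposable_has_kernel_cokernel_card S S' S'' S1 S2 (a : hom S S') (r : hom S' S1)
    (j : hom S1 S'') (c : hom S'' S2) :
  power_stable S' -> power_stable S'' -> indecomposable S' -> indecomposable S'' ->
  short_exact a r -> short_exact j c ->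
  has_card (@has_kernel_cokernel F X S S' S'' S2) (aut_card S1).
Proof.
move=> S'_stable S''_stable S'_indec S''_indec [a_inj r_surj ae] [j_inj c_surj ce].
have S1_stable := power_stable_quotient r_surj S'_stable.
apply: (has_card_bij (f := fun u => comp j (comp u r))) (aut_has_card S1_stable).
- move=> u /is_isoP[u_inj u_surj]; split.
    by exists a; split=> //; apply/tail_exact_comp_inj => //; apply/tail_exact_comp_inj.
  by exists c; split=> //; apply/tail_exact_comp_surj => //; apply: tail_surj_comp.
- move=> h [[a' [a'_inj ae']] [c' [c'_surj ce']]].
  have [T [r' [j' [hE [_ r'_surj are'] [j'_inj _ _]]]]] := image_short_exact a'_inj ae' c'_surj ce'.
  have [w /is_isoP[_ w_surj] wE] := indecomposable_mono_unique S'_stable S'_indec a_inj a'_inj.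
  have are : tail_exact a r' by apply/(tail_exact_comp_surj _ _ w_surj); rewrite wE.
  have [v /is_isoP[v_inj _] vE] := cokernel_unique r_surj ae r'_surj are.
  have [u u_iso uE] := indecomposable_mono_unique S''_stable S''_indec j_inj
    (tail_inj_comp j'_inj v_inj).
  by exists u => //; rewrite comp_assoc uE -comp_assoc vE.
- by move=> u v _ _ /(tail_inj_cancel j_inj)/(tail_surj_cancel r_surj).
Qed.

Lemma indecomposable_epi_lift M S'' S1 S2 (j : hom S1 S'') (c : hom S'' S2) (g : hom M S'') :
  power_stable S'' -> indecomposable S'' -> ~ tail_null S2 -> short_exact j c ->
  tail_surj (comp c g) -> tail_surj g.
Proof.
move=> S''_stable S''_indec S2_neq0 [j_inj c_surj ce] cg_surj.
have [T [p [i [p_surj i_inj gE]]]] := image_exists g.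
have [[u uE]|[u uE]] := indecomposable_uniserial S''_stable S''_indec i_inj j_inj.
  have cg0 : comp c g = 0.
    by rewrite -gE -uE !comp_assoc (tail_exact_comp0 ce) !comp0l.
  case: S2_neq0; near=> x => n dn; have [//|m dm <-] := near cg_surj x _ n dn.
  by rewrite cg0; apply: (near (hfun0 M S2) x).
apply: tail_surj_of_comp_eq0 => P h hg0.
have hi0 : comp h i = 0.
  by apply: (tail_surj_cancel p_surj); rewrite -comp_assoc gE hg0 comp0l.
have [|w wE] := cokernel_lift (g := h) c_surj ce; first by rewrite -uE comp_assoc hi0 comp0l.
suff w0 : w = 0 by rewrite -wE w0 comp0l.
by apply: (tail_surj_cancel cg_surj); rewrite comp_assoc wE hg0 comp0l.
Unshelve. all: by end_near. Qed.

End Indecomposable.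

Section HallBiproduct.
Variables (F : finFieldType) (X : wpl F).
Local Notation C := (coh X).
Implicit Types B T Y : C.

Lemma same_localisations_cokernel T T' B Y Y' (i : hom T B) (p : hom B Y) (i' : hom T' B)
    (p' : hom B Y') : power_stable B -> short_exact i p -> short_exact i' p' ->
  same_localisations T T' -> same_localisations Y Y'.
Proof.
move=> B_stable ip_exact i'p'_exact same x y g n n' y_gt0 hg cY cY'.
have [[i_inj _ _] [i'_inj _ _]] := (ip_exact, i'p'_exact).
have [m cT] := germ_finite x y_gt0 hg (power_stable_sub i_inj B_stable).
have [m' cT'] := germ_finite x y_gt0 hg (power_stable_sub i'_inj B_stable).
have m_gt0 : (0 < m)%N by apply: card_mod_gt0 cT; apply: germ0.
have := card_mod_unique (germ_eq_equiv B) (germ_card_extension y_gt0 hg ip_exact cT cY)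
  (germ_card_extension y_gt0 hg i'p'_exact cT' cY').
by rewrite -(same _ _ _ _ _ y_gt0 hg cT cT') => /eqP; rewrite eqn_pmul2r // => /eqP.
Qed.

Variables (M M' S S' S'' K K' : C).
Variables (j1 : hom M K) (j2 : hom S K) (q1 : hom K M) (q2 : hom K S).
Variables (i1 : hom M' K') (i2 : hom S' K') (p1 : hom K' M') (p2 : hom K' S').
Hypotheses (M_bundle : is_line_bundle M) (M'_bundle : is_line_bundle M').
Hypotheses (S_stable : power_stable S) (S'_stable : power_stable S').
Hypotheses (K_bip : biproduct_maps j1 j2 q1 q2) (K'_bip : biproduct_maps i1 i2 p1 p2).

Lemma ses_components : ses K K' S'' ->
  exists S1 S2 : C, [/\ ses S S' S1, ses M M' S2 & ses S1 S'' S2].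
Proof.
move=> /sesP[k [p kp_exact]]; have [Y [c [c_surj ce]]] := cokernel_exists (comp p i2).
have [a [_ a_inj ae]] := kernel_torsion_part M_bundle M'_bundle S_stable S'_stable
  K_bip K'_bip kp_exact.
have [b bd_exact] := kernel_bundle_part M_bundle M'_bundle S_stable S'_stable
  K_bip K'_bip kp_exact c_surj ce.
have [T [r [j [_ ar_exact jc_exact]]]] := image_short_exact a_inj ae c_surj ce.
exists T, Y; split; apply/sesP; [by exists a, r| |by exists j, c].
by exists b, (comp c (comp p i1)).
Qed.

Variables (S1 S2 : C) (a : hom S S') (r : hom S' S1) (b : hom M M') (d : hom M' S2).
Variables (j : hom S1 S'') (c : hom S'' S2).
Hypotheses (S''_stable : power_stable S'').
Hypotheses (ar_exact : short_exact a r) (bd_exact : short_exact b d) (jc_exact : short_exact j c).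

Let S1_stable : power_stable S1.
Proof. by have [_ r_surj _] := ar_exact; apply: power_stable_quotient r_surj S'_stable. Qed.

Let S2_stable : power_stable S2.
Proof. by have [_ c_surj _] := jc_exact; apply: power_stable_quotient c_surj S''_stable. Qed.

Lemma copair_epi T (a' : hom S S') (r' : hom S' T) (j' : hom T S'') (c' : hom S'' S2)
    (g : hom M' S'') : short_exact a' r' -> short_exact j' c' -> tail_surj (comp c' g) ->
  exists k : hom K K', short_exact k (comp g p1 + comp (comp j' r') p2).
Proof.
move=> [a'_inj r'_surj ae] [j'_inj c'_surj ce] cg_surj; have [b_inj d_surj be] := bd_exact.
have [u /is_isoP[u_inj _] uE] := line_bundle_epi_unique M'_bundle d_surj cg_surj.
apply: (short_exact_assemble M_bundle S_stable K_bip K'_bip (c := c') (a := a') (b := b) a'_inj).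
- by rewrite (copair_inr K'_bip); apply/tail_exact_comp_inj.
- by rewrite (copair_inr K'_bip); apply/tail_exact_comp_surj.
- by rewrite (copair_inl K'_bip) -uE; split=> //; [rewrite uE|apply/tail_exact_comp_inj].
Qed.

Lemma ses_of_components : ses K K' S''.
Proof.
have [g gE] := line_bundle_lift d M'_bundle jc_exact S1_stable.
have g_surj : tail_surj (comp c g) by rewrite gE; case: bd_exact.
have [k kp_exact] := copair_epi ar_exact jc_exact g_surj.
by apply/sesP; exists k, (comp g p1 + comp (comp j r) p2).
Qed.

Lemma restriction_has_kernel_cokernel (k : hom K K') (p : hom K' S'') : short_exact k p ->
  has_kernel_cokernel S S2 (comp p i2).
Proof.
move=> kp_exact; have [Y [c' [c'_surj ce]]] := cokernel_exists (comp p i2).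
have [a' [_ a'_inj ae]] := kernel_torsion_part M_bundle M'_bundle S_stable S'_stable
  K_bip K'_bip kp_exact.
have [b' bd'_exact] := kernel_bundle_part M_bundle M'_bundle S_stable S'_stable
  K_bip K'_bip kp_exact c'_surj ce.
have [T [r' [j' [_ ar'_exact jc'_exact]]]] := image_short_exact a'_inj ae c'_surj ce.
have same : same_localisations Y S2.
  apply: (same_localisations_cokernel S''_stable jc'_exact jc_exact).
  apply: (same_localisations_cokernel S'_stable ar'_exact ar_exact) => x y g n n' _ _.
  exact: card_mod_unique (germ_eq_equiv S).
have [u u_iso] := line_bundle_cokernel_unique M_bundle M'_bundle bd'_exact bd_exact
  (power_stable_quotient c'_surj S''_stable) S2_stable same.
have /is_isoP[u_inj u_surj] : is_iso u := u_iso.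
split; first by exists a'.
by exists (comp u c'); split; [apply: tail_surj_comp|apply/tail_exact_comp_inj].
Qed.

Lemma bundle_epi_card T (a' : hom S S') (r' : hom S' T) (j' : hom T S'') (c' : hom S'' S2) :
  short_exact a' r' -> short_exact j' c' ->
  has_card (fun g : hom M' S'' => tail_surj (comp c' g)) (aut_card S2 * hom_card M' S1).
Proof.
move=> ar'_exact jc'_exact; have [_ r'_surj _] := ar'_exact; have [_ d_surj _] := bd_exact.
have T_stable := power_stable_quotient r'_surj S'_stable.
have -> : hom_card M' S1 = hom_card M' T.
  apply/eqP; rewrite -(eqn_pmul2r (hom_card_gt0 M' S_stable)); apply/eqP.
  rewrite -(hom_card_extension M'_bundle ar_exact) //.
  by rewrite -(hom_card_extension M'_bundle ar'_exact).
exact: line_bundle_lift_card M'_bundle jc'_exact T_stable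
  (line_bundle_epi_card M'_bundle d_surj S2_stable).
Qed.

Lemma hall_biproduct n : has_card (@has_kernel_cokernel F X S S' S'' S2) n ->
  (hall S'' K K' * aut_card S'' = n * (aut_card S2 * hom_card M' S1))%N.
Proof.
move=> cn; apply: (hall_epi_card S''_stable).
apply: (has_card_mul (f := fun p => comp p i2) cn) => [p [k]|h].
  exact: restriction_has_kernel_cokernel.
move=> [[a' [a'_inj ae]] [c' [c'_surj ce]]].
have [T [r' [j' [hE ar'_exact jc'_exact]]]] := image_short_exact a'_inj ae c'_surj ce.
apply: (has_card_bij (f := fun g => comp g p1 + comp h p2)) (bundle_epi_card ar'_exact jc'_exact).
- move=> g cg_surj; split; last by rewrite (copair_inr K'_bip).
  by rewrite -hE; apply: copair_epi ar'_exact jc'_exact cg_surj.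
- move=> p [[k kp_exact] pE]; rewrite -pE in ce *.
  exists (comp p i1); last by rewrite (copair_eta K'_bip).
  by have [b' []] := kernel_bundle_part M_bundle M'_bundle S_stable S'_stable
    K_bip K'_bip kp_exact c'_surj ce.
- move=> g g' _ _ E.
  by rewrite -(copair_inl K'_bip g h) E (copair_inl K'_bip).
Qed.

Lemma hall_biproduct_sum :
  (hall S'' K K')%:R = (hom_card M' S')%:R / (hom_card M' S)%:R *
    sum_iso (fun Z : C => (hall Z S S')%:R * (hall S2 Z S'')%:R *
      ((aut_card Z)%:R * (aut_card S2)%:R / (aut_card S'')%:R)) :> rat.
Proof.
have [n cn] := hom_finite_sub (@has_kernel_cokernel F X S S' S'' S2) S''_stable.
have [m [e [e_inj e_surj nE]]] := has_kernel_cokernel_card S'_stable S''_stable cn.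
rewrite (sum_iso_eq _ e_inj); first last.
- move=> Z Z0; have [|a' [r' ar'_exact]] := @hall_neq0 F X Z S S'.
    by move=> h0; apply: Z0; rewrite h0 !mul0r.
  have [|j' [c' jc'_exact]] := @hall_neq0 F X S2 Z S''; last exact: e_surj ar'_exact jc'_exact.
  by move=> h0; apply: Z0; rewrite h0 mulr0 mul0r.
- move=> Z Z' ZZ'; rewrite (hall_iso S' ZZ' (isomorphic_refl S)).
  by rewrite (hall_iso S'' (isomorphic_refl S2) ZZ') (aut_card_iso ZZ').
have -> : \sum_i (hall (e i) S S')%:R * (hall S2 (e i) S'')%:R *
    ((aut_card (e i))%:R * (aut_card S2)%:R / (aut_card S'')%:R) =
    n%:R * ((aut_card S2)%:R / (aut_card S'')%:R) :> rat.
  by rewrite nE natr_sum mulr_suml; apply: eq_bigr => i _; rewrite !natrM !mulrA.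
rewrite (hom_card_extension M'_bundle ar_exact) // natrM.
have aut_neq0 : (aut_card S'')%:R != 0 :> rat by rewrite pnatr_eq0 -lt0n aut_card_gt0.
have hom_neq0 : (hom_card M' S)%:R != 0 :> rat by rewrite pnatr_eq0 -lt0n hom_card_gt0.
apply: (mulIf aut_neq0); rewrite -[LHS]natrM (hall_biproduct cn) !natrM.
by field; rewrite aut_neq0 hom_neq0.
Qed.

Section IndecomposableHall.
Hypotheses (S'_indec : indecomposable S') (S''_indec : indecomposable S'').

Let hall_aut : (hall S'' K K' * aut_card S'' =
  aut_card S1 * (aut_card S2 * hom_card M' S1))%N.
Proof.
apply: hall_biproduct.
exact: indecomposable_has_kernel_cokernel_card ar_exact jc_exact.
Qed.

Lemma hall_biproduct_iso : isomorphic M M' -> hall S'' K K' = hom_card M S''.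
Proof.
move=> MM'; have [b_inj _ _] := bd_exact.
have S2_null := proj1 (short_exact_is_iso bd_exact) (line_bundle_mono_iso M_bundle MM' b_inj).
have S1S'' : isomorphic S1 S''.
  by exists j; apply/(short_exact_is_iso jc_exact).
apply/eqP; rewrite -(eqn_pmul2r (aut_card_gt0 S''_stable)) hall_aut (aut_card_zero S2_null).
by rewrite mul1n mulnC (aut_card_iso S1S'') (hom_card_iso MM' (isomorphic_sym S1S'')).
Qed.

Lemma hall_biproduct_not_iso : ~ isomorphic M M' -> hall S'' K K' = aut_card S1.
Proof.
move=> not_iso; have S2_neq0 : ~ tail_null S2.
  by move=> S2_null; apply: not_iso; exists b; apply/(short_exact_is_iso bd_exact).
have surj_lift (g : hom M' S'') : tail_surj (comp c g) -> tail_surj g.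
  exact: indecomposable_epi_lift S''_stable S''_indec S2_neq0 jc_exact.
have [g gE] := line_bundle_lift d M'_bundle jc_exact S1_stable.
have g_surj : tail_surj g by apply: surj_lift; rewrite gE; case: bd_exact.
apply/eqP; rewrite -(eqn_pmul2r (aut_card_gt0 S''_stable)) hall_aut; apply/eqP; congr (_ * _)%N.
apply: has_card_unique (bundle_epi_card ar_exact jc_exact) _.
apply: has_card_ext (line_bundle_epi_card M'_bundle g_surj S''_stable) => h; split.
  by move=> h_surj; apply: tail_surj_comp => //; case: jc_exact.
exact: surj_lift.
Qed.

End IndecomposableHall.

End HallBiproduct.

Theorem proposition3p6 (F : finFieldType) (X : wpl F)
    (L L' S S' S'' LS LS' : coh X)
    (hL : is_line_bundle L) (hL' : is_line_bundle L')
    (hS : is_torsion S) (hS' : is_torsion S') (hS'' : is_torsion S'')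
    (hLS : is_biproduct L S LS) (hLS' : is_biproduct L' S' LS') :
  [/\ ses LS LS' S'' <->
        (exists S1 S2 : coh X,
           [/\ ses S S' S1, ses L L' S2 & ses S1 S'' S2]),
      forall S1 S2 : coh X,
        ses S S' S1 -> ses L L' S2 -> ses S1 S'' S2 ->
        (hall S'' LS LS')%:R =
          (hom_card L' S')%:R / (hom_card L' S)%:R *
          sum_iso (fun X2 : coh X =>
            (hall X2 S S')%:R * (hall S2 X2 S'')%:R *
            ((aut_card X2)%:R * (aut_card S2)%:R / (aut_card S'')%:R)) :> rat
    & ses LS LS' S'' -> indecomposable S' -> indecomposable S'' ->
        (isomorphic L L' -> hall S'' LS LS' = hom_card L S'') /\
        (~ isomorphic L L' ->
           forall T : coh X, ses S S' T -> hall S'' LS LS' = aut_card T)].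
Proof.
have tS : power_stable S := torsion_power_stable hS.
have tS' : power_stable S' := torsion_power_stable hS'.
have tS'' : power_stable S'' := torsion_power_stable hS''.
have [j1 [j2 [q1 [q2 LS_bip]]]] := proj1 (biproductP _ _ _) hLS.
have [i1 [i2 [p1 [p2 LS'_bip]]]] := proj1 (biproductP _ _ _) hLS'.
have components := ses_components hL hL' tS tS' LS_bip LS'_bip.
split.
- split=> [|[S1 [S2 [/sesP[a [r ar]] /sesP[b [d bd]] /sesP[j [c jc]]]]]]; first exact: components.
  exact: (ses_of_components hL hL' tS tS' LS_bip LS'_bip ar bd jc).
- move=> S1 S2 /sesP[a [r ar]] /sesP[b [d bd]] /sesP[j [c jc]].
  exact: (hall_biproduct_sum hL hL' tS tS' LS_bip LS'_bip tS'' ar bd jc).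
move=> /components[S1 [S2 [/sesP[a [r ar]] /sesP[b [d bd]] /sesP[j [c jc]]]]] iS' iS''.
split=> [LL'|not_iso T /sesP[a' [r' ar']]].
  exact: (hall_biproduct_iso hL hL' tS tS' LS_bip LS'_bip tS'' ar bd jc iS' iS'' LL').
rewrite -(aut_card_iso (indecomposable_cokernel_unique tS' iS' ar ar')).
exact: (hall_biproduct_not_iso hL hL' tS tS' LS_bip LS'_bip tS'' ar bd jc iS' iS'' not_iso).
Qed.
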